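(* Let $q\ge 2$ be an integer, let $r$ be a positive integer, and let $f$ be a positive real-valued function on the nonnegative integers that is $q$-quasimultiplicative with parameter $r$, i.e. $f(q^{k+r}a+b)=f(a)f(b)$ for all nonnegative integers $a,b,k$ with $0\le b<q^k$. Assume $f$ has at most polynomial growth, i.e. there is a constant $c\ge 0$ with $f(n)=O(n^c)$ and $f(n)=\Omega(n^{-c})$ as $n\to\infty$. Let $\mathcal{B}$ be the set of all positive integers not divisible by $q$ whose $q$-ary representation does not contain the block $0^r$ ($r$ consecutive zeros), let $\ell(n)$ be the length of the $q$-ary representation of $n$, and let $$B(x,t)=\sum_{n\in\mathcal{B}} x^{\ell(n)} f(n)^t .$$ Write $B_t,B_{tt},B_{tx}$ for the corresponding partial derivatives of $B$, evaluated at $(x,t)=(1/q,0)$. Let $N_k$ be an integer chosen uniformly at random from $\{0,1,\dots,q^k-1\}$ and $L_k=\log f(N_k)$. Then $L_k$ has mean $\mu k+O(1)$ and variance $\sigma^2k+O(1)$, where $$\mu=\frac{B_t(1/q,0)}{q^{2r}}$$ and $$\sigma^2 = -B_t(1/q,0)^2 q^{-4r+1}(q-1)^{-1} + 2B_t(1/q,0)^2 q^{-3r+1}(q-1)^{-1} - B_t(1/q,0)^2 q^{-4r}(q-1)^{-1} - 4rB_t(1/q,0)^2 q^{-4r} + B_{tt}(1/q,0)q^{-2r} - 2B_t(1/q,0)B_{tx}(1/q,0)q^{-4r-1}.$$ If $f$ is not the constant function $f\equiv 1$, then $\sigma^2\neq 0$ and $(L_k-\mu k)/(\sigma\sqrt{k})$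 converges weakly to a standard Gaussian distribution as $k\to\infty$.
   Context: An arithmetic function is a function defined on the nonnegative integers. The $q$-ary representation of a positive integer has no leading zeros. *)

(* Defs.v *)
From Stdlib Require Import Reals List Arith.
From Coquelicot Require Import Coquelicot.
Import ListNotations.
Open Scope R_scope.

(* q-ary digits of n, least significant first; for q >= 2 the fuel n is
   sufficient, and the representation has no leading zeros (0 has none). *)
Fixpoint qdigits_aux (fuel q n : nat) : list nat :=
  match fuel with
  | O => []
  | S fuel' => if Nat.eqb n 0 then [] else (n mod q)%nat :: qdigits_aux fuel' q (n / q)
  end.
Definition qdigits (q n : nat) : list nat := qdigits_aux n q n.

Definition qlen (q n : nat) : nat := length (qdigits q n).

Fixpoint starts_with_zeros (r : nat) (l : list nat) : bool :=
  match r with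
  | O => true
  | S r' => match l with
            | [] => false
            | d :: l' => Nat.eqb d 0 && starts_with_zeros r' l'
            end
  end.

Fixpoint has_zero_block (r : nat) (l : list nat) : bool :=
  starts_with_zeros r l ||
  match l with [] => false | _ :: l' => has_zero_block r l' end.

Definition inB (q r n : nat) : bool :=
  (0 <? n)%nat && negb (Nat.eqb (n mod q) 0) && negb (has_zero_block r (qdigits q n)).

Definition quasimultiplicative (q r : nat) (f : nat -> R) : Prop :=
  forall a b k : nat, (b < q ^ k)%nat ->
    f (q ^ (k + r) * a + b)%nat = f a * f b.

Definition poly_growth (f : nat -> R) : Prop :=
  exists c : R, 0 <= c /\ exists C : R, 0 < C /\ exists N : nat,
    forall n : nat, (N <= n)%nat ->
      f n <= C * Rpower (INR n) c /\ Rpower (INR n) (- c) <= C * f n.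

Definition Bfun (q r : nat) (f : nat -> R) (x t : R) : R :=
  Series (fun n => if inB q r n then x ^ qlen q n * Rpower (f n) t else 0).

Definition B_t (q r : nat) (f : nat -> R) : R :=
  Derive (fun t => Bfun q r f (/ INR q) t) 0.
Definition B_tt (q r : nat) (f : nat -> R) : R :=
  Derive_n (fun t => Bfun q r f (/ INR q) t) 2 0.
Definition B_tx (q r : nat) (f : nat -> R) : R :=
  Derive (fun x => Derive (fun t => Bfun q r f x t) 0) (/ INR q).

Definition mu_const (q r : nat) (f : nat -> R) : R :=
  B_t q r f / INR q ^ (2 * r).

Definition sigma2_const (q r : nat) (f : nat -> R) : R :=
  let Bt := B_t q r f in
  let Btt := B_tt q r f in
  let Btx := B_tx q r f in
  let Q := INR q in
  - Bt ^ 2 * Q / Q ^ (4 * r) / (Q - 1)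
  + 2 * Bt ^ 2 * Q / Q ^ (3 * r) / (Q - 1)
  - Bt ^ 2 / Q ^ (4 * r) / (Q - 1)
  - 4 * INR r * Bt ^ 2 / Q ^ (4 * r)
  + Btt / Q ^ (2 * r)
  - 2 * Bt * Btx / Q ^ (4 * r + 1).

Fixpoint rsum (g : nat -> R) (m : nat) : R :=
  match m with O => 0 | S m' => rsum g m' + g m' end.

Definition unif_expect (q k : nat) (X : nat -> R) : R :=
  rsum X (q ^ k) / INR (q ^ k).

Definition Lmean (q : nat) (f : nat -> R) (k : nat) : R :=
  unif_expect q k (fun n => ln (f n)).
Definition Lvar (q : nat) (f : nat -> R) (k : nat) : R :=
  unif_expect q k (fun n => (ln (f n) - Lmean q f k) ^ 2).

Definition gauss_density (x : R) : R := exp (- x ^ 2 / 2) / sqrt (2 * PI).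

Definition weak_conv_std_gauss (q : nat) (Z : nat -> nat -> R) : Prop :=
  forall g : R -> R, continuity g -> (exists M, forall x, Rabs (g x) <= M) ->
    exists l : R,
      is_RInt_gen (fun x => g x * gauss_density x)
        (Rbar_locally m_infty) (Rbar_locally p_infty) l /\
      is_lim_seq (fun k => unif_expect q k (fun n => g (Z k n))) l.

(* Main.v *)
Require Import Defs.
From Stdlib Require Import Reals Lra Lia Arith List Psatz Bool.
From Coquelicot Require Import Coquelicot.
Import ListNotations.
Open Scope R_scope.

(* Reading the digits of a uniform N_k from the lowest one upwards splits N_k into
   steps: either a single digit 0, or a word b of the set B followed by the
   block 0^r.  By quasimultiplicativity L_k is the sum of the rewards log f(b) of
   the steps, so it is a renewal-reward process whose steps have span
   T = l(b) + r (T = 1 for the digit 0) and probability q^-T.  Spans have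
   exponential moments, the three derivatives of B are first and second moments of
   one step, and with X = log f(b) - mu T the constants satisfy E X = 0 and
   sigma^2 E T = E X^2.  A position starts a step exactly when the r digits below
   it vanish, so the renewal sequence is explicit (q^-min(n,r)); this gives
   E T and E T^2, and shows that E L_k - mu k converges exponentially fast, which
   is what the variance estimate needs.  The characteristic function satisfies the
   same recursion and is compared with exp(-sigma^2 th^2 k / 2) by a maximum
   principle.  If sigma = 0 then log f = mu T on all steps; the digit 0 forces
   mu = 0, hence f = 1.  Weak convergence follows from that of
   E cos(c + t Z), because on a large interval a continuous function is nearly a
   polynomial in sin(y / A). *)
(** * Finite sums and uniform expectations *)

(** With only [k] digits left the last step is cut after [k] digits, so at finite [k] the recursions
    do not see the true step distribution. Every moment therefore comes in two versions, [cut_mean]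
    and [step_mean]. They agree on steps of span at most [k]. A longer word that fits into [k]
    digits has span at most [k + r], so cutting inflates its weight by at most q^r. With exponential
    moments the two means differ by an exponentially small amount; such errors are summable over
    [k], and this is where O(1) comes from.

    The digit 0 is a step of its own because words of B begin with a nonzero lowest digit. Its
    reward is log f(0) = 0, but its span counts in E T.

    The renewal sequence is constant from index [r] on, so differencing the renewal equation leaves
    finitely many terms, from which limits can be read off.

    Polynomials in sin(y / A) are convenient test functions because products of sines and cosines
    are again sums of cosines, whose Gaussian limits are known; a second moment bound controls the
    part outside [-A, A]. *)

Lemma rsum_ext (g h : nat -> R) (m : nat) :
  (forall i, (i < m)%nat -> g i = h i) -> rsum g m = rsum h m.
Proof.
  induction m as [|m IH]; intros H; simpl; [reflexivity|].
  rewrite IH by (intros; apply H; lia). rewrite H by lia. reflexivity.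
Qed.

Lemma rsum_le (g h : nat -> R) (m : nat) :
  (forall i, (i < m)%nat -> g i <= h i) -> rsum g m <= rsum h m.
Proof.
  induction m as [|m IH]; intros H; simpl; [lra|].
  apply Rplus_le_compat; [apply IH; intros; apply H|apply H]; lia.
Qed.

Lemma rsum_plus (g h : nat -> R) (m : nat) :
  rsum (fun i => g i + h i) m = rsum g m + rsum h m.
Proof. induction m as [|m IH]; simpl; [|rewrite IH]; ring. Qed.

Lemma rsum_scal (c : R) (g : nat -> R) (m : nat) :
  rsum (fun i => c * g i) m = c * rsum g m.
Proof. induction m as [|m IH]; simpl; [|rewrite IH]; ring. Qed.

Lemma rsum_minus (g h : nat -> R) (m : nat) :
  rsum (fun i => g i - h i) m = rsum g m - rsum h m.
Proof. induction m as [|m IH]; simpl; [|rewrite IH]; ring. Qed.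

Lemma rsum_const (c : R) (m : nat) : rsum (fun _ => c) m = INR m * c.
Proof. induction m as [|m IH]; [simpl; ring|]. rewrite S_INR; simpl rsum; rewrite IH; ring. Qed.

Lemma rsum_zero (g : nat -> R) (m : nat) :
  (forall i, (i < m)%nat -> g i = 0) -> rsum g m = 0.
Proof. intros H. rewrite (rsum_ext _ (fun _ => 0)) by exact H. rewrite rsum_const; ring. Qed.

Lemma rsum_nonneg (g : nat -> R) (m : nat) :
  (forall i, (i < m)%nat -> 0 <= g i) -> 0 <= rsum g m.
Proof.
  intros H. rewrite <- (rsum_zero (fun _ => 0) m) by reflexivity. now apply rsum_le.
Qed.

Lemma rsum_abs (g : nat -> R) (m : nat) : Rabs (rsum g m) <= rsum (fun i => Rabs (g i)) m.
Proof.
  induction m as [|m IH]; simpl; [rewrite Rabs_R0; lra|].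
  eapply Rle_trans; [apply Rabs_triang|]. lra.
Qed.

Lemma rsum_swap (g : nat -> nat -> R) (m n : nat) :
  rsum (fun i => rsum (fun j => g i j) n) m = rsum (fun j => rsum (fun i => g i j) m) n.
Proof.
  induction m as [|m IH]; simpl.
  - symmetry; apply rsum_zero; reflexivity.
  - rewrite IH, <- rsum_plus. reflexivity.
Qed.

Lemma rsum_trunc (g : nat -> R) (m n : nat) :
  (m <= n)%nat -> (forall i, (m <= i < n)%nat -> g i = 0) -> rsum g n = rsum g m.
Proof.
  intros Hmn. induction Hmn as [|n Hmn IH]; intros H; [reflexivity|].
  simpl. rewrite H by lia. rewrite IH by (intros; apply H; lia). ring.
Qed.

Lemma rsum_single (g : nat -> R) (j m : nat) :
  (j < m)%nat -> (forall i, (i < m)%nat -> i <> j -> g i = 0) -> rsum g m = g j.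
Proof.
  intros Hj H. rewrite (rsum_trunc g (S j) m) by (try lia; intros; apply H; lia).
  simpl. rewrite rsum_zero by (intros; apply H; lia). ring.
Qed.

Lemma rsum_monotone (g : nat -> R) (m n : nat) :
  (m <= n)%nat -> (forall i, (i < n)%nat -> 0 <= g i) -> rsum g m <= rsum g n.
Proof.
  intros Hmn. induction Hmn as [|n Hmn IH]; intros H; [lra|].
  simpl. assert (0 <= g n) by (apply H; lia).
  assert (rsum g m <= rsum g n) by (apply IH; intros; apply H; lia). lra.
Qed.

Lemma rsum_shift (g : nat -> R) (m : nat) :
  rsum g (S m) = g 0%nat + rsum (fun i => g (S i)) m.
Proof.
  induction m as [|m IH]; [simpl; ring|].
  change (rsum g (S (S m))) with (rsum g (S m) + g (S m)). rewrite IH. simpl. ring.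
Qed.

Lemma sum_n_rsum (g : nat -> R) (m : nat) : sum_n g m = rsum g (S m).
Proof.
  induction m as [|m IH].
  - rewrite sum_O. simpl. ring.
  - rewrite sum_Sn, IH. reflexivity.
Qed.

Lemma is_series_rsum (g : nat -> R) (l : R) : is_series g l -> is_lim_seq (rsum g) l.
Proof.
  intros H. apply is_lim_seq_incr_1.
  apply is_lim_seq_ext with (sum_n g); [intros; apply sum_n_rsum|exact H].
Qed.

Lemma INR_pow (q k : nat) : INR (q ^ k) = INR q ^ k.
Proof. apply pow_INR. Qed.

Lemma qpow_pos (q k : nat) : (2 <= q)%nat -> (0 < q ^ k)%nat.
Proof. intros. pose proof (Nat.pow_nonzero q k). lia. Qed.

Lemma INR_qpow_pos (q k : nat) : (2 <= q)%nat -> 0 < INR (q ^ k).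
Proof. intros. apply lt_0_INR, qpow_pos; assumption. Qed.

Section Expectation.
Context (q : nat) (hq : (2 <= q)%nat).

Lemma unif_expect_ext (k : nat) (X Y : nat -> R) :
  (forall n, (n < q ^ k)%nat -> X n = Y n) -> unif_expect q k X = unif_expect q k Y.
Proof. intros H. unfold unif_expect. now rewrite (rsum_ext X Y). Qed.

Lemma unif_expect_plus (k : nat) (X Y : nat -> R) :
  unif_expect q k (fun n => X n + Y n) = unif_expect q k X + unif_expect q k Y.
Proof. unfold unif_expect. rewrite rsum_plus. unfold Rdiv; ring. Qed.

Lemma unif_expect_minus (k : nat) (X Y : nat -> R) :
  unif_expect q k (fun n => X n - Y n) = unif_expect q k X - unif_expect q k Y.
Proof. unfold unif_expect. rewrite rsum_minus. unfold Rdiv; ring. Qed.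

Lemma unif_expect_scal (k : nat) (c : R) (X : nat -> R) :
  unif_expect q k (fun n => c * X n) = c * unif_expect q k X.
Proof. unfold unif_expect. rewrite rsum_scal. unfold Rdiv; ring. Qed.

Lemma unif_expect_const (k : nat) (c : R) : unif_expect q k (fun _ => c) = c.
Proof.
  unfold unif_expect. rewrite rsum_const. pose proof (INR_qpow_pos q k hq). field. lra.
Qed.

Lemma unif_expect_le (k : nat) (X Y : nat -> R) :
  (forall n, X n <= Y n) -> unif_expect q k X <= unif_expect q k Y.
Proof.
  intros H. unfold unif_expect. apply Rmult_le_compat_r.
  - left. apply Rinv_0_lt_compat, INR_qpow_pos, hq.
  - apply rsum_le; auto.
Qed.

Lemma unif_expect_abs (k : nat) (X : nat -> R) :
  Rabs (unif_expect q k X) <= unif_expect q k (fun n => Rabs (X n)).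
Proof.
  apply Rabs_le. split.
  - replace (- unif_expect q k (fun n => Rabs (X n)))
      with (unif_expect q k (fun n => - 1 * Rabs (X n))) by (rewrite unif_expect_scal; ring).
    apply unif_expect_le. intros n. unfold Rabs; destruct Rcase_abs; lra.
  - apply unif_expect_le. intros n. apply Rle_abs.
Qed.

End Expectation.

(** * Words over the digits and their parsing *)

Section Digits.
Context (q : nat) (hq : (2 <= q)%nat).
Local Open Scope nat_scope.

Lemma qdigits_aux_fuel (m1 m2 n : nat) :
  n <= m1 -> n <= m2 -> qdigits_aux m1 q n = qdigits_aux m2 q n.
Proof.
  revert m2 n; induction m1 as [|m1 IH]; intros [|m2] n H1 H2; simpl.
  - reflexivity.
  - assert (n = 0) as -> by lia. reflexivity.
  - assert (n = 0) as -> by lia. reflexivity.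
  - destruct (Nat.eqb_spec n 0) as [|Hn]; [reflexivity|].
    assert (n / q < n) by (apply Nat.div_lt; lia).
    f_equal. apply IH; lia.
Qed.

Lemma qdigits_pos (n : nat) : 0 < n -> qdigits q n = n mod q :: qdigits q (n / q).
Proof.
  intros Hn. unfold qdigits at 1. destruct n as [|n]; [lia|].
  cbn [qdigits_aux Nat.eqb]. f_equal.
  assert (S n / q < S n) by (apply Nat.div_lt; lia).
  apply qdigits_aux_fuel; lia.
Qed.

Lemma qlen_0 : qlen q 0 = 0.
Proof. reflexivity. Qed.

Lemma qlen_pos (n : nat) : 0 < n -> qlen q n = S (qlen q (n / q)).
Proof. intros Hn. unfold qlen. now rewrite qdigits_pos. Qed.

Lemma qlen_spec (n i : nat) : n < q ^ i <-> qlen q n <= i.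
Proof.
  revert n. induction i as [|i IH]; intros n.
  - destruct (Nat.eq_dec n 0) as [->|Hn]; [rewrite qlen_0; simpl; lia|].
    rewrite qlen_pos by lia. simpl; lia.
  - destruct (Nat.eq_dec n 0) as [->|Hn].
    + rewrite qlen_0. pose proof (qpow_pos q (S i) hq). lia.
    + rewrite qlen_pos by lia.
      rewrite Nat.pow_succ_r'. split; intros H.
      * apply le_n_S, IH. apply Nat.Div0.div_lt_upper_bound. exact H.
      * apply le_S_n in H. apply IH in H.
        pose proof (Nat.div_mod n q ltac:(lia)). pose proof (Nat.mod_upper_bound n q ltac:(lia)). nia.
Qed.

Lemma qlen_lt_pow (n : nat) : n < q ^ qlen q n.
Proof. apply qlen_spec; lia. Qed.

Lemma starts_with_zeros_spec (s n : nat) : 0 < n ->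
  starts_with_zeros s (qdigits q n) = true <-> n mod q ^ s = 0.
Proof.
  revert n; induction s as [|s IH]; intros n Hn.
  - simpl starts_with_zeros. rewrite Nat.pow_0_r, Nat.mod_1_r. tauto.
  - rewrite qdigits_pos by exact Hn. cbn [starts_with_zeros].
    rewrite Nat.pow_succ_r', Nat.Div0.mod_mul_r, andb_true_iff, Nat.eqb_eq.
    pose proof (Nat.div_mod n q ltac:(lia)).
    split.
    + intros [H1 H2]. rewrite IH in H2 by nia. rewrite H1, H2. lia.
    + intros H0. assert (H1 : n mod q = 0) by lia. split; [exact H1|]. apply IH; [nia|]. nia.
Qed.

(** The condition [q ^ i <= n] keeps the window inside the representation: a nonzero number
    divisible by q^r has its [r] low zeros below its leading digit, so zeros padded above [n] never
    count. *)
Lemma has_zero_block_spec (r n : nat) : 1 <= r ->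
  has_zero_block r (qdigits q n) = true <-> exists i, q ^ i <= n /\ (n / q ^ i) mod q ^ r = 0.
Proof.
  intros hr. induction n as [n IH] using lt_wf_ind.
  destruct (Nat.eq_dec n 0) as [->|Hn].
  - split.
    + destruct r; [lia|]. simpl. discriminate.
    + intros [i [Hi _]]. pose proof (qpow_pos q i hq). lia.
  - assert (Hd : n / q < n) by (apply Nat.div_lt; lia).
    rewrite qdigits_pos by lia.
    cbn [has_zero_block]. rewrite <- qdigits_pos by lia.
    rewrite orb_true_iff, starts_with_zeros_spec, IH by lia. split.
    + intros [H|[i [Hi H]]].
      * exists 0. rewrite Nat.pow_0_r, Nat.div_1_r. lia.
      * exists (S i). rewrite Nat.pow_succ_r', <- Nat.Div0.div_div. split; [|exact H].
        pose proof (Nat.div_mod n q ltac:(lia)). nia.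
    + intros [[|i] [Hi H]].
      * left. now rewrite Nat.pow_0_r, Nat.div_1_r in H.
      * right. exists i. rewrite Nat.pow_succ_r', <- Nat.Div0.div_div in H. split; [|exact H].
        rewrite Nat.pow_succ_r' in Hi. apply Nat.div_le_lower_bound; lia.
Qed.

Lemma inB_spec (r b : nat) : 1 <= r ->
  inB q r b = true <->
  0 < b /\ b mod q <> 0 /\ forall i, q ^ i <= b -> (b / q ^ i) mod q ^ r <> 0.
Proof.
  intros hr. unfold inB. rewrite !andb_true_iff, !negb_true_iff, Nat.ltb_lt, Nat.eqb_neq.
  rewrite <- not_true_iff_false, has_zero_block_spec by exact hr. split.
  - intros [[H1 H2] H3]. split; [|split]; try assumption. intros i Hi H. apply H3. eauto.
  - intros [H1 [H2 H3]]. split; [tauto|]. intros [i [Hi H]]. exact (H3 i Hi H).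
Qed.

(* [b = 0] stands for the step reading the single digit 0; the other steps read
   a word [b] of the set B and the block 0^r above it. *)
Definition is_atom (r b : nat) : bool := (b =? 0) || inB q r b.
Definition span (r b : nat) : nat := if b =? 0 then 1 else qlen q b + r.

Lemma div_shift (a b i e s : nat) : 
  (q ^ (i + e + s) * a + b) / q ^ i = q ^ e * (q ^ s * a) + b / q ^ i.
Proof.
  pose proof (qpow_pos q i hq).
  rewrite <- Nat.add_assoc, Nat.pow_add_r, Nat.pow_add_r.
  replace (q ^ i * (q ^ e * q ^ s) * a + b) with (b + (q ^ e * (q ^ s * a)) * q ^ i) by ring.
  rewrite Nat.div_add by lia. ring.
Qed.

Lemma mod_shift (a b s e : nat) : (q ^ s * (q ^ e * a) + b) mod q ^ s = b mod q ^ s.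
Proof.
  pose proof (qpow_pos q s hq).
  rewrite Nat.add_comm, (Nat.mul_comm (q ^ s)). apply Nat.Div0.mod_add.
Qed.

(** * Existence and uniqueness of the first step *)

Section Parse.
Context (r : nat) (hr : 1 <= r).

(** A window that starts inside [b] ends below position [qlen q b + r], so it does not see [a]. *)
Lemma parse_window (a b i : nat) : q ^ i <= b ->
  ((q ^ (qlen q b + r) * a + b) / q ^ i) mod q ^ r = (b / q ^ i) mod q ^ r.
Proof.
  intros Hi.
  assert (i < qlen q b).
  { destruct (Nat.lt_ge_cases i (qlen q b)) as [|H]; [assumption|].
    apply qlen_spec in H. lia. }
  replace (qlen q b + r) with (i + r + (qlen q b - i)) by lia.
  rewrite div_shift. rewrite <- (mod_shift a (b / q ^ i) r (qlen q b - i)). reflexivity.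
Qed.

Lemma parse_end (a b : nat) : 
  ((q ^ (qlen q b + r) * a + b) / q ^ qlen q b) mod q ^ r = 0.
Proof.
  replace (qlen q b + r) with (qlen q b + r + 0) by lia.
  rewrite div_shift. rewrite mod_shift. rewrite Nat.div_small by apply qlen_lt_pow.
  apply Nat.Div0.mod_0_l.
Qed.

(** If [b'] were longer, the block 0^r closing [b] would start below the leading digit of [b'],
    which a word of B forbids. *)
Lemma parse_inj_B (a a' b b' : nat) : inB q r b = true -> inB q r b' = true ->
  q ^ (qlen q b + r) * a + b = q ^ (qlen q b' + r) * a' + b' -> qlen q b' <= qlen q b.
Proof.
  rewrite !inB_spec by exact hr. intros [Hb [_ HB]] [Hb' [_ HB']] E.
  destruct (Nat.le_gt_cases (qlen q b') (qlen q b)) as [|H]; [assumption|exfalso].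
  assert (Hi : q ^ qlen q b <= b').
  { destruct (Nat.le_gt_cases (q ^ qlen q b) b') as [|H']; [assumption|].
    apply qlen_spec in H'. lia. }
  apply (HB' _ Hi). rewrite <- (parse_window a') by assumption. rewrite <- E. apply parse_end.
Qed.

Lemma pow_mul_mod_q (T a b : nat) : 1 <= T -> (q ^ T * a + b) mod q = b mod q.
Proof.
  intros HT. destruct T as [|T]; [lia|]. rewrite Nat.pow_succ_r'.
  replace (q * q ^ T * a + b) with (b + (q ^ T * a) * q) by ring.
  apply Nat.Div0.mod_add.
Qed.

Lemma span_pos (b : nat) : 1 <= span r b.
Proof. unfold span. destruct (Nat.eqb_spec b 0); [lia|]. lia. Qed.

Lemma parse_inj (a a' b b' : nat) : is_atom r b = true -> is_atom r b' = true ->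
  q ^ span r b * a + b = q ^ span r b' * a' + b' -> b = b' /\ a = a'.
Proof.
  intros Hb Hb' E.
  assert (Eb : b = b').
  (* The lowest digit separates the step [b = 0] from the words of B. *)
  { assert (Em : b mod q = b' mod q).
    { rewrite <- (pow_mul_mod_q (span r b) a b), E by apply span_pos.
      apply pow_mul_mod_q, span_pos. }
    unfold is_atom, span in *.
    destruct (Nat.eqb_spec b 0) as [->|H0]; destruct (Nat.eqb_spec b' 0) as [->|H0'];
      simpl in Hb, Hb'.
    - reflexivity.
    - apply inB_spec in Hb'; [|exact hr]. rewrite Nat.Div0.mod_0_l in Em. lia.
    - apply inB_spec in Hb; [|exact hr]. rewrite Nat.Div0.mod_0_l in Em. lia.
    - assert (El : qlen q b = qlen q b').
      { apply Nat.le_antisymm; eapply parse_inj_B; eauto. }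
      rewrite El in E.
      assert (Hl : b < q ^ (qlen q b' + r)).
      { rewrite <- El. apply qlen_spec. lia. }
      assert (Hl' : b' < q ^ (qlen q b' + r)) by (apply qlen_spec; lia).
      assert ((q ^ (qlen q b' + r) * a + b) mod q ^ (qlen q b' + r) = b).
      { rewrite Nat.add_comm, Nat.mul_comm, Nat.Div0.mod_add. now apply Nat.mod_small. }
      rewrite E, Nat.add_comm, Nat.mul_comm, Nat.Div0.mod_add, Nat.mod_small in H by assumption.
      congruence. }
  subst b'. split; [reflexivity|].
  pose proof (qpow_pos q (span r b) hq). nia.
Qed.

(** A zero block exists at the latest above the leading digit. Taking the lowest one makes the word
    below it free of 0^r. *)
Lemma first_zero_block (n : nat) : exists i, (n / q ^ i) mod q ^ r = 0 /\
  forall j, j < i -> (n / q ^ j) mod q ^ r <> 0.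
Proof.
  assert (H : forall m, (n / q ^ m) mod q ^ r = 0 -> exists i, (n / q ^ i) mod q ^ r = 0 /\
    forall j, j < i -> (n / q ^ j) mod q ^ r <> 0).
  { induction m as [m IH] using lt_wf_ind. intros Hm.
    destruct (List.existsb (fun j => (n / q ^ j) mod q ^ r =? 0) (seq 0 m)) eqn:E.
    - apply existsb_exists in E. destruct E as [j [Hj E]].
      apply in_seq in Hj. apply Nat.eqb_eq in E. apply (IH j); [lia|exact E].
    - exists m. split; [exact Hm|]. intros j Hj Hc.
      assert (Ht : existsb (fun j => (n / q ^ j) mod q ^ r =? 0) (seq 0 m) = true).
      { apply existsb_exists. exists j. split; [apply in_seq; lia|now apply Nat.eqb_eq]. }
      congruence. }
  apply (H (qlen q n)). rewrite Nat.div_small by apply qlen_lt_pow. apply Nat.Div0.mod_0_l.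
Qed.

Lemma parse_exists (n : nat) : exists a b, is_atom r b = true /\ n = q ^ span r b * a + b.
Proof.
  destruct (Nat.eq_dec (n mod q) 0) as [H0|H0].
  - exists (n / q), 0. split; [reflexivity|]. unfold span; simpl.
    pose proof (Nat.div_mod n q ltac:(lia)). lia.
  - destruct (first_zero_block n) as [i [Hi Hmin]].
    assert (Hipos : i <> 0).
    { intros ->. rewrite Nat.pow_0_r, Nat.div_1_r in Hi. apply H0.
      replace r with (S (r - 1)) in Hi by lia.
      rewrite Nat.pow_succ_r', Nat.Div0.mod_mul_r in Hi. lia. }
    set (b := n mod q ^ i).
    pose proof (qpow_pos q i hq) as Hqi. pose proof (qpow_pos q r hq) as Hqr.
    assert (En : n = q ^ i * (n / q ^ i) + b) by (apply Nat.div_mod; lia).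
    assert (Ea : n / q ^ i = q ^ r * (n / q ^ i / q ^ r)).
    { pose proof (Nat.div_mod (n / q ^ i) (q ^ r) ltac:(lia)). lia. }
    set (a := n / q ^ i / q ^ r) in *.
    assert (Hbi : b < q ^ i) by (apply Nat.mod_upper_bound; lia).
    assert (En' : n = q ^ (i + r) * a + b) by (rewrite Nat.pow_add_r; nia).
    assert (Hw : forall j, j < i -> (b / q ^ j) mod q ^ r <> 0).
    { intros j Hj. specialize (Hmin j Hj). rewrite En' in Hmin.
      replace (i + r) with (j + r + (i - j)) in Hmin by lia.
      now rewrite div_shift, mod_shift in Hmin. }
    (* A zero top digit of [b] would let the zero block start one position lower, against the
       minimality of [i]. *)
    assert (Hlen : qlen q b = i).
    { apply Nat.le_antisymm; [now apply qlen_spec|].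
      destruct (Nat.le_gt_cases i (qlen q b)) as [|Hlt]; [assumption|exfalso].
      assert (Hs : b < q ^ (i - 1)) by (apply qlen_spec; lia).
      apply (Hw (i - 1)); [lia|]. rewrite Nat.div_small by exact Hs. apply Nat.Div0.mod_0_l. }
    assert (Hbpos : 0 < b).
    { destruct (Nat.eq_dec b 0) as [Eb|]; [|lia]. rewrite Eb, qlen_0 in Hlen. lia. }
    exists a, b. unfold is_atom, span. destruct (Nat.eqb_spec b 0) as [|_]; [lia|].
    simpl. split; [|now rewrite Hlen].
    apply inB_spec; [exact hr|]. split; [exact Hbpos|]. split.
    + rewrite En' in H0. rewrite pow_mul_mod_q in H0 by lia. exact H0.
    + intros j Hj. apply Hw. destruct (Nat.lt_ge_cases j i) as [|H]; [assumption|].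
      rewrite <- Hlen in H. apply qlen_spec in H. lia.
Qed.

(** Truncated subtraction encodes the cut: if the span exceeds [k], the bound on [a] is q^0 = 1,
    which leaves only [a = 0]. *)
Lemma parse_bounds (k a b : nat) : 1 <= k -> is_atom r b = true ->
  q ^ span r b * a + b < q ^ k <-> b < q ^ k /\ a < q ^ (k - span r b).
Proof.
  intros Hk Hb. pose proof (qpow_pos q (span r b) hq) as HT. split.
  - intros H. split; [lia|].
    destruct (Nat.le_gt_cases (span r b) k) as [Hle|Hgt].
    + apply (Nat.mul_lt_mono_pos_l (q ^ span r b)); [exact HT|].
      rewrite <- Nat.pow_add_r. replace (span r b + (k - span r b)) with k by lia. lia.
    + replace (k - span r b) with 0 by lia. simpl.
      assert (q ^ k < q ^ span r b) by (apply Nat.pow_lt_mono_r; lia). nia.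
  - intros [Hbk Ha]. destruct (Nat.le_gt_cases (span r b) k) as [Hle|Hgt].
    + assert (Hbl : b < q ^ span r b).
      { unfold span in *. destruct (Nat.eqb_spec b 0) as [->|Hb0]; [simpl; lia|].
        apply qlen_spec. lia. }
      replace k with (span r b + (k - span r b)) by lia. rewrite Nat.pow_add_r. nia.
    + replace (k - span r b) with 0 in Ha by lia. simpl in Ha.
      assert (a = 0) as -> by lia. lia.
Qed.

End Parse.
End Digits.

(** * The renewal recursion *)

Section Recursion.
Context (q r : nat) (hq : (2 <= q)%nat) (hr : (1 <= r)%nat).

(** Double counting with the indicator [hit]: parsing is a bijection between the numbers below q^k
    and the admissible pairs of a step and a remainder. *)
Lemma block_sum (G : nat -> R) (k : nat) : (1 <= k)%nat ->
  rsum G (q ^ k) =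
  rsum (fun b => if is_atom q r b
                 then rsum (fun a => G (q ^ span q r b * a + b)%nat) (q ^ (k - span q r b))
                 else 0) (q ^ k).
Proof.
  intros Hk. set (N := (q ^ k)%nat).
  set (hit := fun n b a => (is_atom q r b && (a <? q ^ (k - span q r b)) &&
                       (n =? q ^ span q r b * a + b))%nat).
  transitivity (rsum (fun n => rsum (fun b => rsum (fun a =>
    if hit n b a then G n else 0) N) N) N).
  - apply rsum_ext. intros n Hn.
    destruct (parse_exists q hq r hr n) as [a [b [Hb E]]].
    assert (Hn' := Hn). rewrite E in Hn'. apply parse_bounds in Hn'; try assumption.
    destruct Hn' as [HbN Ha].
    assert (HaN : (a < N)%nat).
    { assert (q ^ (k - span q r b) <= N)%nat by (apply Nat.pow_le_mono_r; lia). lia. }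
    assert (Hhit : forall b' a', hit n b' a' = true -> b' = b /\ a' = a).
    { intros b' a' H. unfold hit in H. rewrite !andb_true_iff, Nat.eqb_eq in H.
      destruct H as [[H1 _] H2]. rewrite E in H2.
      destruct (parse_inj q hq r hr _ _ _ _ Hb H1 H2) as [-> ->]. split; reflexivity. }
    rewrite (rsum_single _ b N HbN).
    + rewrite (rsum_single _ a N HaN).
      * replace (hit n b a) with true; [reflexivity|]. symmetry. unfold hit.
        rewrite !andb_true_iff, Nat.eqb_eq, Nat.ltb_lt. auto.
      * intros a' _ Hne. destruct (hit n b a') eqn:Eh; [|reflexivity].
        destruct (Hhit _ _ Eh). contradiction.
    + intros b' _ Hne. apply rsum_zero. intros a' _.
      destruct (hit n b' a') eqn:Eh; [|reflexivity]. destruct (Hhit _ _ Eh). contradiction.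
  - rewrite rsum_swap. apply rsum_ext. intros b HbN. rewrite rsum_swap.
    destruct (is_atom q r b) eqn:Hb.
    2:{ apply rsum_zero. intros a _. apply rsum_zero. intros n _. unfold hit. now rewrite Hb. }
    rewrite (rsum_trunc _ (q ^ (k - span q r b)) N).
    + apply rsum_ext. intros a Ha.
      assert (Hlt : (q ^ span q r b * a + b < N)%nat) by (apply parse_bounds; auto).
      rewrite (rsum_single _ _ N Hlt).
      * unfold hit. rewrite Hb, Nat.eqb_refl, andb_true_r.
        apply Nat.ltb_lt in Ha. rewrite Ha. reflexivity.
      * intros n _ Hne. unfold hit. destruct (Nat.eqb_spec n (q ^ span q r b * a + b)); [lia|].
        now rewrite andb_false_r.
    + apply Nat.pow_le_mono_r; lia.
    + intros a [Ha _]. apply rsum_zero. intros n _. unfold hit.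
      apply Nat.ltb_ge in Ha. now rewrite Ha, andb_false_r.
Qed.

Definition weight (b : nat) : R := if is_atom q r b then / INR q ^ span q r b else 0.
(* A step starting with [k] digits left is cut after [k] digits. *)
Definition cut_weight (k b : nat) : R :=
  if is_atom q r b then / INR q ^ Nat.min k (span q r b) else 0.

(** Given the first step, the remaining digits are again uniform, now on [k - min k span] positions.
    All later recursions rest on this Markov property. *)
Lemma unif_expect_rec (G : nat -> R) (k : nat) : (1 <= k)%nat ->
  unif_expect q k G =
  rsum (fun b => cut_weight k b *
          unif_expect q (k - Nat.min k (span q r b)) (fun a => G (q ^ span q r b * a + b)%nat))
    (q ^ k).
Proof.
  intros Hk. unfold unif_expect at 1. rewrite block_sum by exact Hk.
  unfold Rdiv. rewrite Rmult_comm, <- rsum_scal. apply rsum_ext. intros b Hb.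
  unfold cut_weight, unif_expect. destruct (is_atom q r b); [|ring].
  replace (k - Nat.min k (span q r b))%nat with (k - span q r b)%nat by lia.
  rewrite !INR_pow.
  assert (Hq : 0 < INR q) by (apply lt_0_INR; lia).
  replace (INR q ^ k) with (INR q ^ Nat.min k (span q r b) * INR q ^ (k - span q r b))
    by (rewrite <- pow_add; f_equal; lia).
  field. split; apply pow_nonzero; lra.
Qed.

Lemma INR_q_ge2 : 2 <= INR q.
Proof. change 2 with (INR 2). now apply le_INR. Qed.

Lemma weight_nonneg (b : nat) : 0 <= weight b.
Proof.
  unfold weight. pose proof INR_q_ge2. destruct is_atom; [|lra].
  left. apply Rinv_0_lt_compat, pow_lt. lra.
Qed.

Lemma cut_weight_nonneg (k b : nat) : 0 <= cut_weight k b.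
Proof.
  unfold cut_weight. pose proof INR_q_ge2. destruct is_atom; [|lra].
  left. apply Rinv_0_lt_compat, pow_lt. lra.
Qed.

Lemma cut_weight_eq (k b : nat) : (span q r b <= k)%nat -> cut_weight k b = weight b.
Proof. intros H. unfold cut_weight, weight. now rewrite Nat.min_r. Qed.

Lemma span_atom_lt (b k : nat) : (span q r b <= k)%nat -> (b < q ^ k)%nat.
Proof.
  unfold span. destruct (Nat.eqb_spec b 0) as [->|Hb]; intros H.
  - now apply qpow_pos.
  - apply qlen_spec; lia.
Qed.

Lemma span_le (b k : nat) : (1 <= k)%nat -> (b < q ^ k)%nat -> (span q r b <= k + r)%nat.
Proof.
  intros Hk Hb. unfold span. destruct (Nat.eqb_spec b 0); [lia|].
  apply qlen_spec in Hb; lia.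
Qed.

Lemma cut_weight_le (k b : nat) : (1 <= k)%nat -> (b < q ^ k)%nat ->
  cut_weight k b <= INR q ^ r * weight b.
Proof.
  intros Hk Hb. pose proof INR_q_ge2. pose proof (span_le b k Hk Hb).
  unfold cut_weight, weight. destruct (is_atom q r b); [|lra].
  set (m := Nat.min k (span q r b)).
  assert (Hm : 0 < INR q ^ m) by (apply pow_lt; lra).
  assert (Hs : 0 < INR q ^ span q r b) by (apply pow_lt; lra).
  apply (Rmult_le_reg_r (INR q ^ m * INR q ^ span q r b)); [now apply Rmult_lt_0_compat|].
  replace (/ INR q ^ m * (INR q ^ m * INR q ^ span q r b)) with (INR q ^ span q r b)
    by (field; lra).
  replace (INR q ^ r * / INR q ^ span q r b * (INR q ^ m * INR q ^ span q r b))
    with (INR q ^ (r + m)) by (rewrite pow_add; field; lra).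
  apply Rle_pow; [lra|]. unfold m. lia.
Qed.

(** This is the recursion applied to the constant 1. *)
Lemma cut_weight_total (k : nat) : (1 <= k)%nat -> rsum (cut_weight k) (q ^ k) = 1.
Proof.
  intros Hk. rewrite <- (unif_expect_const q hq k 1), unif_expect_rec by exact Hk.
  apply rsum_ext. intros b Hb. rewrite unif_expect_const by exact hq. ring.
Qed.

(** * Geometric tail of the span *)

Definition mass (k : nat) : R :=
  rsum (fun b => if (span q r b <=? k)%nat then weight b else 0) (q ^ k).

Lemma mass_extend (g : nat -> R) (k N : nat) : (q ^ k <= N)%nat ->
  rsum (fun b => if (span q r b <=? k)%nat then g b else 0) N =
  rsum (fun b => if (span q r b <=? k)%nat then g b else 0) (q ^ k).
Proof.
  intros HN. apply rsum_trunc; [exact HN|]. intros b [Hb _].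
  destruct (Nat.leb_spec (span q r b) k) as [H|]; [|reflexivity].
  apply span_atom_lt in H. lia.
Qed.

Lemma tail_mass (k : nat) : (1 <= k)%nat ->
  1 - mass k = rsum (fun b => if (span q r b <=? k)%nat then 0 else cut_weight k b) (q ^ k).
Proof.
  intros Hk. rewrite <- (cut_weight_total k Hk). unfold mass. rewrite <- rsum_minus.
  apply rsum_ext. intros b _. destruct (Nat.leb_spec (span q r b) k).
  - rewrite cut_weight_eq by assumption. ring.
  - ring.
Qed.

Lemma mass_le1 (k : nat) : (1 <= k)%nat -> mass k <= 1.
Proof.
  intros Hk. cut (0 <= 1 - mass k); [lra|]. rewrite tail_mass by exact Hk.
  apply rsum_nonneg. intros b _. pose proof (cut_weight_nonneg k b). destruct Nat.leb; lra.
Qed.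

(* A word of span [> k] fitting in [k] digits has span at most [k + r]. *)
Lemma mass_step (k : nat) : (1 <= k)%nat ->
  1 - mass (k + r) <= (1 - / INR q ^ r) * (1 - mass k).
Proof.
  intros Hk. pose proof INR_q_ge2 as Hq.
  assert (Hqr : 0 < INR q ^ r) by (apply pow_lt; lra).
  cut (/ INR q ^ r * (1 - mass k) <= mass (k + r) - mass k); [lra|].
  rewrite tail_mass by exact Hk. rewrite <- rsum_scal.
  assert (HN : (q ^ k <= q ^ (k + r))%nat) by (apply Nat.pow_le_mono_r; lia).
  unfold mass. rewrite <- (mass_extend weight k _ HN), <- rsum_minus.
  eapply Rle_trans; [|apply (rsum_monotone _ (q ^ k)); [exact HN|]].
  - apply rsum_le. intros b Hb.
    pose proof (span_le b k Hk Hb).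
    destruct (Nat.leb_spec (span q r b) (k + r)); [|lia].
    destruct (Nat.leb_spec (span q r b) k); [lra|].
    rewrite Rminus_0_r. apply (Rmult_le_reg_l (INR q ^ r)); [exact Hqr|].
    rewrite <- Rmult_assoc, Rinv_r, Rmult_1_l by lra. now apply cut_weight_le.
  - intros b Hb. pose proof (weight_nonneg b).
    destruct (Nat.leb_spec (span q r b) (k + r)); destruct (Nat.leb_spec (span q r b) k);
      try lia; lra.
Qed.

Lemma mass_decay (m : nat) : 1 - mass (m * r + 1) <= (1 - / INR q ^ r) ^ m.
Proof.
  pose proof INR_q_ge2 as Hq.
  assert (Hqr : 1 <= INR q ^ r) by (apply pow_R1_Rle; lra).
  assert (H1 : / INR q ^ r <= 1) by (rewrite <- Rinv_1; apply Rinv_le_contravar; lra).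
  induction m as [|m IH].
  - simpl. cut (0 <= mass 1); [lra|]. apply rsum_nonneg. intros b _.
    pose proof (weight_nonneg b). destruct Nat.leb; lra.
  - replace (S m * r + 1)%nat with (m * r + 1 + r)%nat by lia.
    eapply Rle_trans; [apply mass_step; lia|]. simpl.
    apply Rmult_le_compat_l; [lra|exact IH].
Qed.
End Recursion.

(** * Exponential moments of one step *)

Lemma geometric_rsum_le (y : R) (m : nat) : 0 <= y < 1 -> rsum (pow y) m <= / (1 - y).
Proof.
  intros Hy.
  assert (E : rsum (pow y) m = (1 - y ^ m) / (1 - y)).
  { induction m as [|m IH]; simpl; [field; lra|]. rewrite IH. field. lra. }
  rewrite E. unfold Rdiv. rewrite <- (Rmult_1_l (/ (1 - y))) at 2.
  apply Rmult_le_compat_r; [left; apply Rinv_0_lt_compat; lra|].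
  pose proof (pow_le y m). lra.
Qed.

Lemma exp_le (x y : R) : x <= y -> exp x <= exp y.
Proof. intros [H| ->]; [left; now apply exp_increasing|right; reflexivity]. Qed.

Lemma exp_INR_mult (x : R) (n : nat) : exp (x * INR n) = exp x ^ n.
Proof.
  induction n as [|n IH]; [simpl; rewrite Rmult_0_r; apply exp_0|].
  rewrite S_INR, Rmult_plus_distr_l, exp_plus, IH, Rmult_1_r. simpl. ring.
Qed.

Section Moments.
Context (q r : nat) (hq : (2 <= q)%nat) (hr : (1 <= r)%nat).

(** Over [r] digits the exponential grows by exp(q^-r / 2), while the tail of the span shrinks by 1
    - q^-r <= exp(-q^-r). The factor 2 leaves a net geometric decay. *)
Definition rate : R := / INR q ^ r / (2 * INR r).

Lemma rate_pos : 0 < rate.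
Proof.
  pose proof (INR_q_ge2 q hq). unfold rate.
  assert (0 < INR r) by (apply lt_0_INR; lia).
  apply Rdiv_lt_0_compat; [apply Rinv_0_lt_compat, pow_lt; lra|lra].
Qed.

Definition exp_mass (k : nat) : R :=
  rsum (fun b => if (span q r b <=? k)%nat
                 then weight q r b * exp (rate * INR (span q r b)) else 0) (q ^ k).

(** Steps with span between [k + 1] and [k + r] weigh together at most the tail [1 - mass q r k],
    and the exponential is monotone in the span. *)
Lemma exp_mass_step (k : nat) : (1 <= k)%nat ->
  exp_mass (k + r) <= exp_mass k + exp (rate * INR (k + r)) * (1 - mass q r k).
Proof.
  intros Hk. pose proof rate_pos.
  assert (HN : (q ^ k <= q ^ (k + r))%nat) by (apply Nat.pow_le_mono_r; lia).
  apply Rle_trans with (exp_mass k + exp (rate * INR (k + r)) * (mass q r (k + r) - mass q r k)).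
  2:{ apply Rplus_le_compat_l, Rmult_le_compat_l; [left; apply exp_pos|].
      pose proof (mass_le1 q r hq hr (k + r) ltac:(lia)). lra. }
  cut (exp_mass (k + r) - exp_mass k <= exp (rate * INR (k + r)) * (mass q r (k + r) - mass q r k));
    [lra|].
  unfold exp_mass at 2, mass at 2.
  rewrite <- (mass_extend q r hq hr (weight q r) k _ HN).
  rewrite <- (mass_extend q r hq hr (fun b => weight q r b * exp (rate * INR (span q r b))) k _ HN).
  unfold exp_mass, mass. rewrite <- !rsum_minus, <- rsum_scal.
  apply rsum_le. intros b _. pose proof (weight_nonneg q r hq b).
  destruct (Nat.leb_spec (span q r b) (k + r)) as [H1|]; destruct (Nat.leb_spec (span q r b) k);
    try lia; try lra.
  rewrite !Rminus_0_r, Rmult_comm. apply Rmult_le_compat_r; [assumption|].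
  apply exp_le, Rmult_le_compat_l; [lra|]. now apply le_INR.
Qed.

Definition exp_ratio : R := exp (rate * INR r) * (1 - / INR q ^ r).

Lemma exp_ratio_bounds : 0 <= exp_ratio < 1.
Proof.
  pose proof (INR_q_ge2 q hq). unfold exp_ratio, rate.
  assert (Hr : 0 < INR r) by (apply lt_0_INR; lia).
  assert (Hqr : 1 <= INR q ^ r) by (apply pow_R1_Rle; lra).
  assert (H1 : / INR q ^ r <= 1) by (rewrite <- Rinv_1; apply Rinv_le_contravar; lra).
  assert (H0 : 0 < / INR q ^ r) by (apply Rinv_0_lt_compat; lra).
  set (x := / INR q ^ r) in *.
  replace (x / (2 * INR r) * INR r) with (x / 2) by (field; lra).
  split; [apply Rmult_le_pos; [left; apply exp_pos|lra]|].
  apply Rle_lt_trans with (exp (x / 2) * exp (- x)).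
  - apply Rmult_le_compat_l; [left; apply exp_pos|]. pose proof (exp_ineq1_le (- x)). lra.
  - rewrite <- exp_plus, <- exp_0. apply exp_increasing. lra.
Qed.

Lemma exp_mass_bound (m : nat) :
  exp_mass (m * r + 1) <= exp_mass 1 + exp (rate * INR (1 + r)) * / (1 - exp_ratio).
Proof.
  pose proof exp_ratio_bounds as Hy.
  apply Rle_trans with (exp_mass 1 + exp (rate * INR (1 + r)) * rsum (pow exp_ratio) m).
  2:{ apply Rplus_le_compat_l, Rmult_le_compat_l; [left; apply exp_pos|].
      now apply geometric_rsum_le. }
  induction m as [|m IH]; [simpl; lra|].
  replace (S m * r + 1)%nat with (m * r + 1 + r)%nat by lia.
  eapply Rle_trans; [apply exp_mass_step; lia|].
  simpl rsum. rewrite Rmult_plus_distr_l, <- Rplus_assoc.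
  apply Rplus_le_compat; [exact IH|].
  unfold exp_ratio. rewrite Rpow_mult_distr, <- exp_INR_mult.
  rewrite <- Rmult_assoc, <- exp_plus.
  replace (rate * INR (1 + r) + rate * INR r * INR m) with (rate * INR (m * r + 1 + r))
    by (rewrite !plus_INR, mult_INR; ring).
  apply Rmult_le_compat_l; [left; apply exp_pos|]. now apply mass_decay.
Qed.

Lemma ex_series_exp : ex_series (fun b => weight q r b * exp (rate * INR (span q r b))).
Proof.
  set (g := fun b => weight q r b * exp (rate * INR (span q r b))).
  assert (Hg : forall b, 0 <= g b).
  { intros b. apply Rmult_le_pos; [now apply weight_nonneg|left; apply exp_pos]. }
  apply ex_finite_lim_seq_incr
    with (M := exp_mass 1 + exp (rate * INR (1 + r)) * / (1 - exp_ratio)).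
  - intros n. rewrite sum_Sn. unfold plus; simpl. pose proof (Hg (S n)). lra.
  - intros n. rewrite sum_n_rsum.
    eapply Rle_trans; [|apply (exp_mass_bound (S n))].
    unfold exp_mass. fold g.
    (* The series runs over [b], the masses over spans: [b <= n] has length at most [n], so the
       first [n + 1] terms sit inside a single [exp_mass]. *)
    assert (Hs : forall b, (b <= n)%nat -> (span q r b <= S n * r + 1)%nat).
    { intros b Hb. unfold span. destruct (Nat.eqb_spec b 0); [lia|].
      assert (qlen q b <= b)%nat by (apply qlen_spec; [exact hq|]; apply Nat.pow_gt_lin_r; lia).
      nia. }
    rewrite (rsum_ext g (fun b => if (span q r b <=? S n * r + 1)%nat then g b else 0) (S n)).
    + apply rsum_monotone.
      * pose proof (Nat.pow_gt_lin_r q (S n * r + 1) ltac:(lia)). nia.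
      * intros b _. destruct Nat.leb; [apply Hg|lra].
    + intros b Hb. destruct (Nat.leb_spec (span q r b) (S n * r + 1)); [reflexivity|].
      specialize (Hs b ltac:(lia)). lia.
Qed.

(** * Means over a full step and over a cut step *)

Definition step_mean (G : nat -> R) : R := Series (fun b => weight q r b * G b).
Definition cut_mean (k : nat) (G : nat -> R) : R :=
  rsum (fun b => cut_weight q r k b * G b) (q ^ k).

Lemma ex_series_dominated (u : nat -> R) (C : R) :
  (forall b, Rabs (u b) <= C * (weight q r b * exp (rate * INR (span q r b)))) -> ex_series u.
Proof.
  intros Hu. apply (ex_series_le (K := R_AbsRing) (V := R_CompleteNormedModule) _ _ Hu).
  exact (ex_series_scal (K := R_AbsRing) (V := R_NormedModule) C _ ex_series_exp).
Qed.

Lemma ex_step_mean (G : nat -> R) (C : R) :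
  (forall b, Rabs (G b) <= C * exp (rate * INR (span q r b))) ->
  ex_series (fun b => weight q r b * G b).
Proof.
  intros HG. apply (ex_series_dominated _ C). intros b.
  pose proof (weight_nonneg q r hq b). rewrite Rabs_mult, (Rabs_pos_eq (weight q r b)) by lra.
  eapply Rle_trans; [apply Rmult_le_compat_l; [lra|apply HG]|]. right; ring.
Qed.

Lemma cut_mean_le (k : nat) (G H : nat -> R) :
  (forall b, G b <= H b) -> cut_mean k G <= cut_mean k H.
Proof.
  intros HGH. apply rsum_le. intros b _.
  apply Rmult_le_compat_l; [now apply cut_weight_nonneg|apply HGH].
Qed.

Lemma cut_mean_scal (k : nat) (c : R) (G : nat -> R) :
  cut_mean k (fun b => c * G b) = c * cut_mean k G.
Proof. unfold cut_mean. rewrite <- rsum_scal. apply rsum_ext. intros; ring. Qed.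

Lemma cut_mean_plus (k : nat) (G H : nat -> R) :
  cut_mean k (fun b => G b + H b) = cut_mean k G + cut_mean k H.
Proof. unfold cut_mean. rewrite <- rsum_plus. apply rsum_ext. intros; ring. Qed.

Lemma cut_mean_minus (k : nat) (G H : nat -> R) :
  cut_mean k (fun b => G b - H b) = cut_mean k G - cut_mean k H.
Proof. unfold cut_mean. rewrite <- rsum_minus. apply rsum_ext. intros; ring. Qed.

Lemma cut_mean_const (k : nat) (c : R) : (1 <= k)%nat -> cut_mean k (fun _ => c) = c.
Proof.
  intros Hk. transitivity (c * rsum (cut_weight q r k) (q ^ k)).
  - unfold cut_mean. rewrite <- rsum_scal. apply rsum_ext. intros; ring.
  - rewrite (cut_weight_total q r hq hr k Hk). ring.
Qed.

Lemma cut_mean_abs (k : nat) (G : nat -> R) :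
  Rabs (cut_mean k G) <= cut_mean k (fun b => Rabs (G b)).
Proof.
  eapply Rle_trans; [apply rsum_abs|]. apply rsum_le. intros b _.
  rewrite Rabs_mult, (Rabs_pos_eq (cut_weight q r k b)); [lra|now apply cut_weight_nonneg].
Qed.

Lemma cut_mean_exp_bounded : exists K, 0 <= K /\ forall k, (1 <= k)%nat ->
  cut_mean k (fun b => exp (rate * INR (span q r b))) <= K.
Proof.
  set (E := fun b => weight q r b * exp (rate * INR (span q r b))).
  assert (HL : is_lim_seq (rsum E) (Series E))
    by (apply is_series_rsum, Series_correct, ex_series_exp).
  assert (Hsum : forall N, rsum E N <= Series E).
  { intros N. apply (is_lim_seq_incr_compare _ _ HL). intros n. simpl.
    assert (0 <= E n) by (apply Rmult_le_pos; [now apply weight_nonneg|left; apply exp_pos]). lra. }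
  assert (Hq : 0 <= INR q ^ r) by (apply pow_le; pose proof (INR_q_ge2 q hq); lra).
  exists (INR q ^ r * Series E). split.
  - apply Rmult_le_pos; [exact Hq|]. apply Rle_trans with (rsum E 0); [simpl; lra|apply Hsum].
  - intros k Hk. eapply Rle_trans; [|apply Rmult_le_compat_l; [exact Hq|apply (Hsum (q ^ k)%nat)]].
    rewrite <- rsum_scal. apply rsum_le. intros b Hb. unfold E. rewrite <- Rmult_assoc.
    apply Rmult_le_compat_r; [left; apply exp_pos|now apply cut_weight_le].
Qed.

(** The second argument of [G] is the number of digits actually read. Steps with span at most [k]
    contribute equally to both means; for the others a factor exp(-lam k) is gained by doubling the
    exponent, which [2 * lam <= rate] allows. *)
Lemma cut_mean_converges (lam C : R) (G : nat -> nat -> R) :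
  0 < lam -> 2 * lam <= rate -> 0 <= C ->
  (forall b T, (T <= span q r b)%nat -> Rabs (G b T) <= C * exp (lam * INR (span q r b))) ->
  exists C', 0 <= C' /\ forall k, (1 <= k)%nat ->
    Rabs (cut_mean k (fun b => G b (Nat.min k (span q r b)))
          - step_mean (fun b => G b (span q r b))) <= C' * exp (- lam * INR k).
Proof.
  intros Hlam Hrate HC HG.
  set (w := weight q r). set (T := span q r).
  assert (Hw : forall b, 0 <= w b) by (intros; now apply weight_nonneg).
  set (E := fun b => w b * exp (rate * INR (T b))).
  assert (HE0 : forall b, 0 <= E b).
  { intros b. apply Rmult_le_pos; [apply Hw|left; apply exp_pos]. }
  assert (Hq : 0 <= INR q ^ r) by (apply pow_le; pose proof (INR_q_ge2 q hq); lra).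
  (* For a step longer than [k], q^r bounds the cut weight and 1 the full weight, both relative to
     [weight]. *)
  set (A := (INR q ^ r + 1) * C).
  assert (HA : 0 <= A) by (apply Rmult_le_pos; lra).
  assert (Hsum : forall N, rsum E N <= Series E).
  { intros N. 
    assert (HL : is_lim_seq (rsum E) (Series E))
      by (apply is_series_rsum, Series_correct, ex_series_exp).
    apply (is_lim_seq_incr_compare _ _ HL). intros n. simpl. specialize (HE0 n). lra. }
  assert (HS0 : 0 <= Series E) by (apply Rle_trans with (rsum E 0); [simpl; lra|apply Hsum]).
  exists (A * Series E). split; [now apply Rmult_le_pos|].
  intros k Hk.
  assert (HTexp : forall b, exp (lam * INR (T b)) <= exp (rate * INR (T b))).
  { intros b. apply exp_le, Rmult_le_compat_r; [apply pos_INR|lra]. }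
  assert (HexG : ex_series (fun b => w b * G b (T b))).
  { apply (ex_step_mean _ C). intros b. eapply Rle_trans; [apply HG; unfold T; lia|].
    apply Rmult_le_compat_l; [exact HC|apply HTexp]. }
  assert (HL : is_lim_seq
     (fun N => cut_mean k (fun b => G b (Nat.min k (T b))) - rsum (fun b => w b * G b (T b)) N)
     (cut_mean k (fun b => G b (Nat.min k (T b))) - step_mean (fun b => G b (T b)))).
  { apply is_lim_seq_minus'; [apply is_lim_seq_const|].
    apply is_series_rsum, Series_correct, HexG. }
  apply is_lim_seq_abs in HL. cbn [Rbar_abs] in HL.
  refine (is_lim_seq_le_loc _ _ _ (A * Series E * exp (- lam * INR k)) _ HL (is_lim_seq_const _)).
  exists (q ^ k)%nat. intros N HN.
  set (g := fun b => if (b <? q ^ k)%nat then cut_weight q r k b * G b (Nat.min k (T b)) else 0).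
  assert (Eg : cut_mean k (fun b => G b (Nat.min k (T b))) = rsum g N).
  { unfold cut_mean. rewrite (rsum_trunc g (q ^ k) N HN).
    - apply rsum_ext. intros b Hb. unfold g. apply Nat.ltb_lt in Hb. now rewrite Hb.
    - intros b [Hb _]. unfold g. apply Nat.ltb_ge in Hb. now rewrite Hb. }
  rewrite Eg, <- rsum_minus.
  eapply Rle_trans; [apply rsum_abs|].
  apply Rle_trans with (A * exp (- lam * INR k) * rsum E N).
  2:{ replace (A * Series E * exp (- lam * INR k)) with (A * exp (- lam * INR k) * Series E) by ring.
      apply Rmult_le_compat_l; [|apply Hsum].
      apply Rmult_le_pos; [exact HA|left; apply exp_pos]. }
  rewrite <- rsum_scal. apply rsum_le. intros b _.
  destruct (Nat.le_gt_cases (T b) k) as [Hle|Hgt].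
  - assert (Hb : (b < q ^ k)%nat) by now apply (span_atom_lt q r hq).
    unfold g. apply Nat.ltb_lt in Hb. rewrite Hb, cut_weight_eq by exact Hle.
    rewrite Nat.min_r by exact Hle. unfold w.
    rewrite Rminus_diag, Rabs_R0. 
    apply Rmult_le_pos; [apply Rmult_le_pos; [exact HA|left; apply exp_pos]|apply HE0].
  - assert (Hexp : exp (lam * INR (T b)) <= exp (- lam * INR k) * exp (rate * INR (T b))).
    { rewrite <- exp_plus. apply exp_le. apply lt_INR in Hgt. pose proof (pos_INR (T b)). nra. }
    assert (H1 : Rabs (g b) <= INR q ^ r * w b * (C * exp (lam * INR (T b)))).
    { unfold g. destruct (Nat.ltb_spec b (q ^ k)) as [Hb|Hb].
      - rewrite Rabs_mult, (Rabs_pos_eq (cut_weight q r k b)) by now apply cut_weight_nonneg.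
        apply Rmult_le_compat; [now apply cut_weight_nonneg|apply Rabs_pos| |].
        + now apply cut_weight_le.
        + apply HG. unfold T; lia.
      - rewrite Rabs_R0. apply Rmult_le_pos; [now apply Rmult_le_pos|].
        apply Rmult_le_pos; [exact HC|left; apply exp_pos]. }
    assert (H2 : Rabs (w b * G b (T b)) <= w b * (C * exp (lam * INR (T b)))).
    { rewrite Rabs_mult, (Rabs_pos_eq (w b)) by apply Hw.
      apply Rmult_le_compat_l; [apply Hw|]. apply HG. unfold T; lia. }
    eapply Rle_trans; [apply Rabs_triang|]. rewrite Rabs_Ropp.
    apply Rle_trans with (A * w b * exp (lam * INR (T b))).
    + unfold A. lra.
    + replace (A * exp (- lam * INR k) * E b) with
        (A * w b * (exp (- lam * INR k) * exp (rate * INR (T b)))) by (unfold E; ring).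
      apply Rmult_le_compat_l; [|exact Hexp]. apply Rmult_le_pos; [exact HA|apply Hw].
Qed.

End Moments.

(** * The renewal equation *)

Lemma rsum_reindex (h : nat -> R) (T k : nat) : (T <= k)%nat ->
  rsum (fun i => h (T + i)%nat) (k - T) = rsum (fun m => if (T <=? m)%nat then h m else 0) k.
Proof.
  intros H. induction H as [|k H IH].
  - rewrite Nat.sub_diag. symmetry. apply rsum_zero. intros i Hi.
    apply Nat.leb_gt in Hi. now rewrite Hi.
  - replace (S k - T)%nat with (S (k - T)) by lia. cbn [rsum]. rewrite IH.
    replace (T + (k - T))%nat with k by lia. apply Nat.leb_le in H. now rewrite H.
Qed.

Section Renewal.
Context (q r : nat) (hq : (2 <= q)%nat) (hr : (1 <= r)%nat).

Lemma unif_expect_initial (i j : nat) : (i <= j)%nat ->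
  unif_expect q j (fun a => if (a <? q ^ i)%nat then 1 else 0) = / INR q ^ (j - i).
Proof.
  intros Hij. unfold unif_expect.
  rewrite (rsum_trunc _ (q ^ i)).
  - rewrite (rsum_ext _ (fun _ => 1)).
    + rewrite rsum_const, !INR_pow. pose proof (INR_q_ge2 q hq).
      replace j with (i + (j - i))%nat at 1 by lia. rewrite pow_add. field.
      split; apply pow_nonzero; lra.
    + intros a Ha. apply Nat.ltb_lt in Ha. now rewrite Ha.
  - apply Nat.pow_le_mono_r; lia.
  - intros a [Ha _]. apply Nat.ltb_ge in Ha. now rewrite Ha.
Qed.

(* Probability that position [n] starts a new step: the [r] preceding digits,
   padded by zeros, vanish. *)
Definition renewal (n : nat) : R := / INR q ^ Nat.min n r.

(** The event is that the top [r] of [k] digits vanish, that is n < q^(k - r); for [k < r] truncated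
    subtraction turns it into n = 0, in agreement with the zero padding. After the first step it
    becomes the same event for the remaining digits. *)
Lemma renewal_rec (k : nat) : (1 <= k)%nat ->
  renewal k = rsum (fun b => if (span q r b <=? k)%nat
                             then weight q r b * renewal (k - span q r b) else 0) (q ^ k).
Proof.
  intros Hk.
  transitivity (unif_expect q k (fun n => if (n <? q ^ (k - r))%nat then 1 else 0)).
  { rewrite unif_expect_initial by lia. unfold renewal. do 2 f_equal. lia. }
  rewrite (unif_expect_rec q r hq hr) by exact Hk. apply rsum_ext. intros b Hb.
  destruct (is_atom q r b) eqn:Hat.
  2:{ unfold cut_weight, weight. rewrite Hat. destruct Nat.leb; ring. }
  assert (Hlen : span q r b = if (b =? 0)%nat then 1%nat else (qlen q b + r)%nat) by reflexivity.
  destruct (Nat.leb_spec (span q r b) k) as [HT|HT].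
  - rewrite cut_weight_eq by exact HT. f_equal. rewrite Nat.min_r by exact HT.
    assert (Hbr : (b < q ^ (k - r))%nat).
    { apply qlen_spec; [exact hq|]. destruct (Nat.eqb_spec b 0) as [->|]; [rewrite qlen_0|]; lia. }
    transitivity (unif_expect q (k - span q r b)
                    (fun a => if (a <? q ^ (k - r - span q r b))%nat then 1 else 0)).
    2:{ rewrite unif_expect_initial by lia. unfold renewal. do 2 f_equal. lia. }
    apply unif_expect_ext. intros a _.
    assert (Hiff : (q ^ span q r b * a + b < q ^ (k - r))%nat <-> (a < q ^ (k - r - span q r b))%nat).
    { destruct (Nat.eq_dec (k - r) 0) as [E0|E0].
      - rewrite E0 in *. simpl in Hbr |- *. pose proof (qpow_pos q (span q r b) hq).
        assert (b = 0%nat) as -> by lia. nia.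
      - rewrite (parse_bounds q hq r hr) by (try lia; assumption). tauto. }
    destruct (Nat.ltb_spec (q ^ span q r b * a + b) (q ^ (k - r)));
      destruct (Nat.ltb_spec a (q ^ (k - r - span q r b))); try reflexivity; lia.
  (* A cut step excludes the event: a word within the lowest [k - r] digits has a span that fits
     into [k]. *)
  - rewrite (unif_expect_ext q _ _ (fun _ => 0)).
    { rewrite (unif_expect_const q hq). ring. } intros a _.
    destruct (Nat.ltb_spec (q ^ span q r b * a + b) (q ^ (k - r))) as [Hlt|]; [|reflexivity].
    exfalso. assert (Hb' : (b < q ^ (k - r))%nat) by lia.
    apply qlen_spec in Hb'; [|exact hq].
    destruct (Nat.eqb_spec b 0) as [->|]; [lia|].
    destruct (Nat.le_gt_cases r k); [lia|].
    assert (0 < qlen q b)%nat by (rewrite qlen_pos; lia). lia.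
Qed.

(** Convolution with the renewal sequence solves the renewal equation. The induction hypothesis is
    inserted for each first step, the sums over steps and positions are exchanged, and [renewal_rec]
    collapses the inner one. *)
Lemma renewal_solution (a e : nat -> R) :
  a 0%nat = 0 ->
  (forall k, (1 <= k)%nat ->
     a k = rsum (fun b => cut_weight q r k b * a (k - Nat.min k (span q r b))%nat) (q ^ k) + e k) ->
  forall k, a k = rsum (fun i => renewal i * e (k - i)%nat) k.
Proof.
  intros H0 Hrec k. induction k as [k IH] using lt_wf_ind.
  destruct (Nat.eq_dec k 0) as [->|Hk]; [exact H0|].
  rewrite Hrec by lia.
  transitivity (rsum (fun b => rsum (fun m => if (span q r b <=? m)%nat
      then weight q r b * renewal (m - span q r b) * e (k - m)%nat else 0) k) (q ^ k) + e k).
  { f_equal. apply rsum_ext. intros b Hb. pose proof (span_pos q hq r hr b) as HT1.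
    destruct (Nat.le_gt_cases (span q r b) k) as [HT|HT].
    - rewrite cut_weight_eq, Nat.min_r by exact HT.
      rewrite (IH (k - span q r b)%nat) by lia.
      rewrite <- rsum_scal.
      rewrite <- (rsum_reindex (fun m => weight q r b * renewal (m - span q r b) * e (k - m)%nat))
        by exact HT.
      apply rsum_ext. intros i _.
      replace (span q r b + i - span q r b)%nat with i by lia.
      replace (k - (span q r b + i))%nat with (k - span q r b - i)%nat by lia. ring.
    - rewrite Nat.min_l, Nat.sub_diag, H0, Rmult_0_r by lia. symmetry. apply rsum_zero.
      intros m Hm. destruct (Nat.leb_spec (span q r b) m); [lia|reflexivity]. }
  rewrite rsum_swap.
  destruct k as [|k']; [lia|]. rewrite !rsum_shift.
  rewrite (rsum_zero _ (q ^ S k')).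
  2:{ intros b _. pose proof (span_pos q hq r hr b).
      destruct (Nat.leb_spec (span q r b) 0); [lia|reflexivity]. }
  rewrite Nat.sub_0_r.
  replace (renewal 0) with 1 by (unfold renewal; simpl; field).
  rewrite (rsum_ext (fun j => rsum _ (q ^ S k')) (fun i => renewal (S i) * e (S k' - S i)%nat)).
  { ring. }
  intros m Hm. rewrite (renewal_rec (S m)) by lia.
  rewrite (Rmult_comm _ (e _)), <- rsum_scal.
  transitivity (rsum (fun b => if (span q r b <=? S m)%nat then
     e (S k' - S m)%nat * (weight q r b * renewal (S m - span q r b)) else 0) (q ^ S k')).
  - apply rsum_ext. intros b _. destruct Nat.leb; ring.
  - rewrite (mass_extend q r hq hr _ (S m)).
    + apply rsum_ext. intros b _. destruct Nat.leb; ring.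
    + apply Nat.pow_le_mono_r; lia.
Qed.

(** The increments of [renewal] vanish from index [r] on, so a sum over the whole past collapses to
    [r + 1] terms. *)
Lemma renewal_diff (a e : nat -> R) :
  a 0%nat = 0 ->
  (forall k, (1 <= k)%nat ->
     a k = rsum (fun b => cut_weight q r k b * a (k - Nat.min k (span q r b))%nat) (q ^ k) + e k) ->
  forall k, (r < k)%nat ->
  a k - a (k - 1)%nat = e k + rsum (fun i => (/ INR q - 1) / INR q ^ i * e (k - 1 - i)%nat) r.
Proof.
  intros H0 Hrec k Hk.
  rewrite (renewal_solution a e H0 Hrec k), (renewal_solution a e H0 Hrec (k - 1)).
  destruct k as [|k]; [lia|]. rewrite rsum_shift. replace (S k - 1)%nat with k by lia.
  replace (renewal 0) with 1 by (unfold renewal; simpl; field).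
  rewrite Nat.sub_0_r, Rmult_1_l. unfold Rminus at 1. rewrite Rplus_assoc. f_equal.
  change (rsum (fun i => renewal (S i) * e (S k - S i)%nat) k
          - rsum (fun i => renewal i * e (k - i)%nat) k
          = rsum (fun i => (/ INR q - 1) / INR q ^ i * e (k - i)%nat) r).
  rewrite <- rsum_minus. pose proof (INR_q_ge2 q hq).
  rewrite (rsum_trunc _ r k).
  - apply rsum_ext. intros i Hi. unfold renewal. rewrite !Nat.min_l by lia. simpl.
    field. split; [|apply pow_nonzero]; lra.
  - lia.
  - intros i Hi. unfold renewal. rewrite !Nat.min_r by lia. simpl. ring.
Qed.

End Renewal.

(** * Differentiating exponential series *)

(** A quadratic remainder bound passes through sums and integrals term by term; it serves below to
    differentiate series and integrals in a parameter. *)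
Lemma is_derive_quadratic (g : R -> R) (x l M d : R) : 0 < d ->
  (forall y, Rabs (y - x) < d -> Rabs (g y - g x - l * (y - x)) <= M * (y - x) ^ 2) ->
  is_derive g x l.
Proof.
  intros Hd H. apply is_derive_Reals. intros eps Heps.
  assert (HM : 0 < Rabs M + 1) by (pose proof (Rabs_pos M); lra).
  assert (Hd' : 0 < Rmin d (eps / (Rabs M + 1))).
  { apply Rmin_pos; [exact Hd|now apply Rdiv_lt_0_compat]. }
  exists (mkposreal _ Hd'). intros h Hh0 Hh. simpl in Hh.
  assert (Hh1 : Rabs h < d) by (eapply Rlt_le_trans; [exact Hh|apply Rmin_l]).
  assert (Hh2 : Rabs h < eps / (Rabs M + 1)) by (eapply Rlt_le_trans; [exact Hh|apply Rmin_r]).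
  specialize (H (x + h)). replace (x + h - x) with h in H by ring. specialize (H Hh1).
  assert (Hpos : 0 < Rabs h) by now apply Rabs_pos_lt.
  replace ((g (x + h) - g x) / h - l) with ((g (x + h) - g x - l * h) / h) by (field; exact Hh0).
  unfold Rdiv. rewrite Rabs_mult, Rabs_inv.
  apply (Rmult_lt_reg_r (Rabs h)); [exact Hpos|].
  rewrite Rmult_assoc, Rinv_l, Rmult_1_r by lra.
  apply Rle_lt_trans with ((Rabs M + 1) * Rabs h * Rabs h).
  - eapply Rle_trans; [exact H|]. rewrite <- (pow2_abs h).
    pose proof (Rle_abs M). nra.
  - apply Rmult_lt_compat_r; [exact Hpos|].
    apply (Rmult_lt_compat_l (Rabs M + 1)) in Hh2; [|exact HM].
    replace ((Rabs M + 1) * (eps / (Rabs M + 1))) with eps in Hh2 by (field; lra). exact Hh2.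
Qed.

Lemma is_derive_series (u : nat -> R -> R) (du M : nat -> R) (x d : R) : 0 < d ->
  (forall y, Rabs (y - x) < d -> ex_series (fun n => u n y)) ->
  ex_series du -> ex_series M ->
  (forall n y, Rabs (y - x) < d ->
     Rabs (u n y - u n x - du n * (y - x)) <= M n * (y - x) ^ 2) ->
  is_derive (fun y => Series (fun n => u n y)) x (Series du).
Proof.
  intros Hd Hu Hdu HM H. apply (is_derive_quadratic _ _ _ (Series M) d Hd).
  intros y Hy.
  assert (Hx : Rabs (x - x) < d) by (rewrite Rminus_diag, Rabs_R0; exact Hd).
  assert (E1 : ex_series (fun n => u n y - u n x)).
  { apply (ex_series_minus (K := R_AbsRing) (V := R_NormedModule)); now apply Hu. }
  assert (E2 : ex_series (fun n => du n * (y - x))) by now apply ex_series_scal_r.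
  rewrite <- Series_minus by (now apply Hu).
  rewrite <- !Series_scal_r. rewrite <- Series_minus by assumption.
  eapply Rle_trans; [apply Series_Rabs|apply Series_le].
  - apply (ex_series_le (K := R_AbsRing) (V := R_CompleteNormedModule) _ (fun n => M n * (y - x) ^ 2)).
    + intros n. change (norm ?a) with (Rabs a). rewrite Rabs_Rabsolu. now apply H.
    + now apply ex_series_scal_r.
  - intros n. split; [apply Rabs_pos|now apply H].
  - now apply ex_series_scal_r.
Qed.

Lemma exp_taylor1 (s : R) : Rabs (exp s - 1 - s) <= s ^ 2 * exp (Rabs s).
Proof.
  pose proof (exp_ineq1_le s) as H1. pose proof (exp_ineq1_le (- s)) as H2.
  pose proof (exp_pos s) as H3.
  assert (H4 : exp s * exp (- s) = 1) by (rewrite <- exp_plus, Rplus_opp_r; apply exp_0).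
  assert (H5 : exp s - 1 <= s * exp s) by nra.
  rewrite Rabs_pos_eq by lra.
  destruct (Rle_or_lt 0 s) as [Hs|Hs].
  - rewrite Rabs_pos_eq by exact Hs. nra.
  - rewrite Rabs_left by exact Hs. 
    assert (1 <= exp (- s)) by lra. assert (exp s - 1 - s <= s ^ 2) by nra. nra.
Qed.

Lemma le_exp_scaled (a x : R) : 0 < a -> x <= / a * exp (a * x).
Proof.
  intros Ha. pose proof (exp_ineq1_le (a * x)).
  apply (Rmult_le_reg_l a); [exact Ha|]. rewrite <- Rmult_assoc, Rinv_r, Rmult_1_l by lra. lra.
Qed.

Section ExpSeries.
Context (q r : nat) (hq : (2 <= q)%nat) (hr : (1 <= r)%nat).

(** Half of the exponent [rate] is spent on the coefficients. Of the other half, two eighths of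
    [rate] absorb the square of the span and one eighth the exponential in the second-order
    remainder, which explains the radius [rate / (8 K)]. *)
Lemma is_derive_exp_series (c lam : nat -> R) (C K : R) :
  0 < K -> 
  (forall n, Rabs (c n) <= C * (weight q r n * exp (rate q r / 2 * INR (span q r n)))) ->
  (forall n, Rabs (lam n) <= K * INR (span q r n)) ->
  is_derive (fun t => Series (fun n => c n * exp (lam n * t))) 0 (Series (fun n => c n * lam n)).
Proof.
  intros HK Hc Hlam. pose proof (rate_pos q r hq hr) as Hrate.
  set (T := fun n => INR (span q r n)) in *.
  set (p := rate q r) in *.
  assert (HT : forall n, 0 <= T n) by (intros; apply pos_INR).
  assert (HTe : forall n, T n <= 8 / p * exp (p / 8 * T n)).
  { intros n. replace (8 / p) with (/ (p / 8)) by (field; lra). apply le_exp_scaled. lra. }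
  assert (Hlt : forall n t, Rabs t < p / (8 * K) -> Rabs (lam n * t) <= p / 8 * T n).
  { intros n t Ht. rewrite Rabs_mult.
    apply Rle_trans with (K * T n * (p / (8 * K))).
    - apply Rmult_le_compat; try apply Rabs_pos; [apply Hlam|lra].
    - right. field. lra. }
  assert (Hd : 0 < p / (8 * K)) by (apply Rdiv_lt_0_compat; lra).
  assert (He : forall n t, Rabs t < p / (8 * K) -> exp (Rabs (lam n * t)) <= exp (p / 8 * T n)).
  { intros n t Ht. apply exp_le. now apply Hlt. }
  assert (Hm : forall x n, x <= 1 -> exp (x * p * T n) <= exp (p * T n)).
  { intros x n Hx. apply exp_le. pose proof (HT n).
    assert (0 <= p * T n) by (apply Rmult_le_pos; lra). nra. }
  assert (Hcw : forall n, 0 <= C * (weight q r n * exp (p / 2 * T n))).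
  { intros n. eapply Rle_trans; [apply Rabs_pos|apply Hc]. }
  assert (Hsplit : forall n A B, 0 <= A -> Rabs B <= A * exp (p / 2 * T n) ->
    Rabs (c n * B) <= A * C * (weight q r n * exp (p * T n))).
  { intros n A B HA HB. rewrite Rabs_mult.
    apply Rle_trans with (C * (weight q r n * exp (p / 2 * T n)) * (A * exp (p / 2 * T n))).
    - apply Rmult_le_compat; try apply Rabs_pos; [apply Hc|exact HB].
    - right. replace (p * T n) with (p / 2 * T n + p / 2 * T n) by field. rewrite exp_plus. ring. }
  apply (is_derive_series (fun n t => c n * exp (lam n * t)) (fun n => c n * lam n)
    (fun n => Rabs (c n) * ((K * T n) ^ 2 * exp (p / 8 * T n))) 0 (p / (8 * K)) Hd).
  - intros y Hy. rewrite Rminus_0_r in Hy.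
    apply (ex_series_dominated q r hq hr _ (1 * C)). intros n. apply Hsplit; [lra|].
    rewrite Rmult_1_l, Rabs_pos_eq by (left; apply exp_pos). apply exp_le.
    pose proof (Hlt n y Hy). pose proof (Rle_abs (lam n * y)). pose proof (HT n).
    assert (0 <= p * T n) by (apply Rmult_le_pos; lra). lra.
  - apply (ex_series_dominated q r hq hr _ (K * (8 / p) * C)). intros n.
    assert (Hp8 : 0 < 8 / p) by (apply Rdiv_lt_0_compat; lra).
    apply Hsplit; [apply Rmult_le_pos; lra|].
    eapply Rle_trans; [apply Hlam|]. fold (T n). rewrite Rmult_assoc.
    apply Rmult_le_compat_l; [lra|]. eapply Rle_trans; [apply HTe|].
    apply Rmult_le_compat_l; [lra|]. apply exp_le. pose proof (HT n).
    assert (0 <= p * T n) by (apply Rmult_le_pos; lra). lra.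
  - apply (ex_series_dominated q r hq hr _ (K ^ 2 * (8 / p) ^ 2 * C)). intros n.
    rewrite Rabs_mult, Rabs_Rabsolu, <- Rabs_mult. apply Hsplit.
    { apply Rmult_le_pos; apply pow2_ge_0. }
    rewrite Rabs_pos_eq.
    2:{ apply Rmult_le_pos; [apply pow2_ge_0|left; apply exp_pos]. }
    apply Rle_trans with ((K * (8 / p * exp (p / 8 * T n))) ^ 2 * exp (p / 8 * T n)).
    + apply Rmult_le_compat_r; [left; apply exp_pos|]. apply pow_incr. split.
      * apply Rmult_le_pos; [lra|apply HT].
      * apply Rmult_le_compat_l; [lra|apply HTe].
    + replace ((K * (8 / p * exp (p / 8 * T n))) ^ 2 * exp (p / 8 * T n)) with
        (K ^ 2 * (8 / p) ^ 2 * (exp (p / 8 * T n) * exp (p / 8 * T n) * exp (p / 8 * T n))) by ring.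
      apply Rmult_le_compat_l; [apply Rmult_le_pos; apply pow2_ge_0|].
      rewrite <- !exp_plus. apply exp_le. pose proof (HT n).
      assert (0 <= p * T n) by (apply Rmult_le_pos; lra). lra.
  - intros n y Hy. rewrite Rminus_0_r in *. rewrite Rmult_0_r, exp_0.
    replace (c n * exp (lam n * y) - c n * 1 - c n * lam n * y)
      with (c n * (exp (lam n * y) - 1 - lam n * y)) by ring.
    rewrite Rabs_mult, Rmult_assoc. apply Rmult_le_compat_l; [apply Rabs_pos|].
    eapply Rle_trans; [apply exp_taylor1|].
    replace ((K * T n) ^ 2 * exp (p / 8 * T n) * y ^ 2)
      with ((K * T n) ^ 2 * y ^ 2 * exp (p / 8 * T n)) by ring.
    apply Rmult_le_compat; [apply pow2_ge_0|left; apply exp_pos| |now apply He].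
    rewrite Rpow_mult_distr. apply Rmult_le_compat_r; [apply pow2_ge_0|].
    rewrite <- (pow2_abs (lam n)). apply pow_incr. split; [apply Rabs_pos|apply Hlam].
Qed.

Lemma is_derive_exp_series_at (c lam : nat -> R) (t0 C K : R) :
  0 < K -> 
  (forall n, Rabs (c n * exp (lam n * t0)) <=
     C * (weight q r n * exp (rate q r / 2 * INR (span q r n)))) ->
  (forall n, Rabs (lam n) <= K * INR (span q r n)) ->
  is_derive (fun t => Series (fun n => c n * exp (lam n * t))) t0
    (Series (fun n => c n * lam n * exp (lam n * t0))).
Proof.
  intros HK Hc Hlam.
  pose proof (is_derive_exp_series (fun n => c n * exp (lam n * t0)) lam C K HK Hc Hlam) as H.
  apply is_derive_ext with
    (fun t => Series (fun n => c n * exp (lam n * t0) * exp (lam n * (t - t0)))).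
  { intros t. apply Series_ext. intros n. rewrite Rmult_assoc, <- exp_plus. do 2 f_equal. ring. }
  rewrite (Series_ext _ (fun n => c n * exp (lam n * t0) * lam n)) by (intros; ring).
  rewrite <- (Rmult_1_l (Series _)).
  apply (is_derive_comp (fun s => Series (fun n => c n * exp (lam n * t0) * exp (lam n * s)))
    (fun t => t - t0)).
  - rewrite Rminus_diag. exact H.
  - auto_derive; [exact I|ring].
Qed.
End ExpSeries.

(** * The derivatives of B *)

Lemma finite_bound (g : nat -> R) (N : nat) : exists K, 0 <= K /\ forall n, (n < N)%nat -> Rabs (g n) <= K.
Proof.
  induction N as [|N [K [HK H]]]; [exists 0; split; [lra|lia]|].
  exists (Rmax K (Rabs (g N))). split; [eapply Rle_trans; [exact HK|apply Rmax_l]|].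
  intros n Hn. destruct (Nat.eq_dec n N) as [->|]; [apply Rmax_r|].
  eapply Rle_trans; [apply H; lia|apply Rmax_l].
Qed.

Section LogF.
Context (q r : nat) (f : nat -> R) (hq : (2 <= q)%nat) (hr : (1 <= r)%nat)
  (hpos : forall n, 0 < f n) (hqm : quasimultiplicative q r f).

Lemma f_zero : f 0%nat = 1.
Proof.
  pose proof (hqm 0%nat 0%nat 0%nat (qpow_pos q 0 hq)) as H. rewrite Nat.mul_0_r in H. simpl in H.
  pose proof (hpos 0). nra.
Qed.

(** The number q^(r+1) a is split in two ways, with k = 0 and with k = 1. This is what admits a lone
    digit 0 as a step. *)
Lemma f_shift (a : nat) : f (q * a)%nat = f a.
Proof.
  pose proof (hqm (q * a)%nat 0%nat 0%nat (qpow_pos q 0 hq)) as H0.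
  pose proof (hqm a 0%nat 1%nat (qpow_pos q 1 hq)) as H1.
  rewrite f_zero, Rmult_1_r, Nat.add_0_r in *.
  rewrite <- H0, <- H1. f_equal. simpl. ring.
Qed.

Lemma f_step (a b : nat) : f (q ^ span q r b * a + b)%nat = f a * f b.
Proof.
  unfold span. destruct (Nat.eqb_spec b 0) as [->|Hb].
  - rewrite Nat.add_0_r, Nat.pow_1_r, f_shift, f_zero. ring.
  - apply hqm. now apply qlen_lt_pow.
Qed.

Lemma ln_f_zero : ln (f 0%nat) = 0.
Proof. rewrite f_zero. apply ln_1. Qed.

Lemma ln_f_step (a b : nat) : ln (f (q ^ span q r b * a + b)%nat) = ln (f a) + ln (f b).
Proof. rewrite f_step. now apply ln_mult. Qed.

(** The growth condition bounds |log f(n)| by a multiple of log n plus a constant, and log n is at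
    most the span times log q. Constants and the finitely many small [n] are absorbed because every
    span is at least 1. *)
Lemma ln_f_growth : poly_growth f ->
  exists K, 0 < K /\ forall n, Rabs (ln (f n)) <= K * INR (span q r n).
Proof.
  intros (c & Hc & C & HC & N & H).
  destruct (finite_bound (fun n => ln (f n)) (S N)) as [K0 [HK0 HN]].
  assert (Hlnq : 0 < ln (INR q)).
  { rewrite <- ln_1. apply ln_increasing; [lra|]. pose proof (INR_q_ge2 q hq). lra. }
  exists (K0 + (Rabs (ln C) + c * ln (INR q)) + 1).
  pose proof (Rabs_pos (ln C)) as HlC. 
  assert (Hcq : 0 <= c * ln (INR q)) by (apply Rmult_le_pos; lra).
  split; [lra|].
  intros n. assert (HT : 1 <= INR (span q r n)).
  { change 1 with (INR 1). apply le_INR, span_pos; assumption. }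
  destruct (Nat.lt_ge_cases n (S N)) as [Hn|Hn].
  { eapply Rle_trans; [now apply HN|]. nra. }
  destruct (H n ltac:(lia)) as [H1 H2].
  assert (Hn0 : 0 < INR n) by (apply lt_0_INR; lia).
  assert (Hlnn : 0 <= ln (INR n) <= INR (span q r n) * ln (INR q)).
  { split.
    - rewrite <- ln_1. apply ln_le; [lra|]. change 1 with (INR 1). apply le_INR. lia.
    - rewrite <- ln_pow by (pose proof (INR_q_ge2 q hq); lra).
      apply ln_le; [exact Hn0|]. rewrite <- INR_pow. apply le_INR. unfold span.
      destruct (Nat.eqb_spec n 0); [lia|].
      assert (n < q ^ (qlen q n + r))%nat by (apply qlen_spec; [exact hq|lia]). lia. }
  assert (U1 : ln (f n) <= ln C + c * ln (INR n)).
  { unfold Rpower in H1. apply ln_le in H1; [|apply hpos].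
    rewrite ln_mult, ln_exp in H1 by (try apply exp_pos; exact HC). exact H1. }
  assert (U2 : - c * ln (INR n) <= ln C + ln (f n)).
  { unfold Rpower in H2. apply ln_le in H2; [|apply exp_pos].
    rewrite ln_mult, ln_exp in H2 by (try apply hpos; exact HC). exact H2. }
  apply Rle_trans with (Rabs (ln C) + c * ln (INR n)).
  - apply Rabs_le. pose proof (Rle_abs (ln C)). pose proof (Rle_abs (- ln C)) as Hm.
    rewrite Rabs_Ropp in Hm. lra.
  - apply Rle_trans with (Rabs (ln C) * INR (span q r n) + c * ln (INR q) * INR (span q r n)).
    + apply Rplus_le_compat; [nra|]. rewrite Rmult_assoc, (Rmult_comm (ln (INR q))).
      apply Rmult_le_compat_l; [exact Hc|apply Hlnn].
    + nra.
Qed.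

Definition Bcoef (n : nat) : R := if inB q r n then / INR q ^ qlen q n else 0.

(** [weight] counts the closing block 0^r and B does not, hence the factor q^r between derivatives
    of B and step means. *)
Lemma Bcoef_weight (n : nat) : n <> 0%nat -> Bcoef n = INR q ^ r * weight q r n.
Proof.
  intros Hn. unfold Bcoef, weight, is_atom, span. apply Nat.eqb_neq in Hn. rewrite Hn. simpl.
  pose proof (INR_q_ge2 q hq). destruct inB; [|ring]. rewrite pow_add. field.
  split; apply pow_nonzero; lra.
Qed.

Lemma Bcoef_0 : Bcoef 0 = 0.
Proof. reflexivity. Qed.

Lemma Bcoef_bounds (n : nat) : 0 <= Bcoef n <= INR q ^ r * weight q r n.
Proof.
  pose proof (INR_q_ge2 q hq). pose proof (weight_nonneg q r hq n).
  assert (0 <= INR q ^ r) by (apply pow_le; lra).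
  destruct (Nat.eq_dec n 0) as [->|Hn].
  - rewrite Bcoef_0. split; [lra|]. now apply Rmult_le_pos.
  - rewrite Bcoef_weight by exact Hn. split; [now apply Rmult_le_pos|lra].
Qed.

Lemma Bcoef_series (G : nat -> R) : G 0%nat = 0 ->
  Series (fun n => Bcoef n * G n) = INR q ^ r * step_mean q r G.
Proof.
  intros HG. unfold step_mean. rewrite <- Series_scal_l. apply Series_ext. intros n.
  destruct (Nat.eq_dec n 0) as [->|Hn]; [rewrite HG; ring|].
  rewrite Bcoef_weight by exact Hn. ring.
Qed.

(** In the variable log(q x), which vanishes at x = 1/q, B is an exponential series in both
    variables, so the same differentiation lemma serves for [x] and for [t]. *)
Lemma Bfun_exp (x t : R) : 0 < x ->
  Bfun q r f x t =
  Series (fun n => Bcoef n * exp (INR (qlen q n) * ln (INR q * x)) * exp (ln (f n) * t)).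
Proof.
  intros Hx. apply Series_ext. intros n. unfold Bcoef, Rpower.
  destruct (inB q r n); [|ring].
  pose proof (INR_q_ge2 q hq).
  rewrite <- ln_pow, exp_ln by (try apply pow_lt; apply Rmult_lt_0_compat; lra).
  rewrite Rpow_mult_distr, (Rmult_comm t). field. apply pow_nonzero; lra.
Qed.

Section Growth.
Context (K : R) (HK : 0 < K) (HF : forall n, Rabs (ln (f n)) <= K * INR (span q r n)).

Lemma Bcoef_dominated (A : R) (n : nat) (y : R) :
  0 <= A -> Rabs y <= A * exp (rate q r / 2 * INR (span q r n)) ->
  Rabs (Bcoef n * y) <= INR q ^ r * A * (weight q r n * exp (rate q r / 2 * INR (span q r n))).
Proof.
  intros HA Hy. pose proof (Bcoef_bounds n) as [H0 H1].
  rewrite Rabs_mult, (Rabs_pos_eq _ H0).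
  apply Rle_trans with (INR q ^ r * weight q r n * (A * exp (rate q r / 2 * INR (span q r n)))).
  - apply Rmult_le_compat; try assumption. apply Rabs_pos.
  - right; ring.
Qed.

Lemma exp_lam_le (c x T p : R) : 0 <= T -> Rabs x <= c * T -> c <= p -> exp x <= exp (p * T).
Proof.
  intros HT Hx Hc. apply exp_le. pose proof (Rle_abs x). nra.
Qed.

(** Stated on a neighbourhood of (1/q, 0), because [B_tt] and [B_tx] differentiate this expression
    once more. *)
Lemma Derive_Bfun_t (x t : R) : 0 < x ->
  Rabs (ln (INR q * x)) <= rate q r / 8 -> Rabs t <= rate q r / (8 * K) ->
  is_derive (fun t => Bfun q r f x t) t
    (Series (fun n => Bcoef n * exp (INR (qlen q n) * ln (INR q * x)) * ln (f n)
                      * exp (ln (f n) * t))).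
Proof.
  intros Hx Hl Ht. pose proof (rate_pos q r hq hr) as Hrate.
  apply is_derive_ext with (fun t =>
    Series (fun n => Bcoef n * exp (INR (qlen q n) * ln (INR q * x)) * exp (ln (f n) * t))).
  { intros s. symmetry. now apply Bfun_exp. }
  apply (is_derive_exp_series_at q r hq hr _ _ _ (INR q ^ r * 1) K HK); [|exact HF].
  intros n. rewrite Rmult_assoc. apply Bcoef_dominated; [lra|].
  rewrite Rmult_1_l, <- exp_plus, Rabs_pos_eq by (left; apply exp_pos).
  pose proof (pos_INR (span q r n)) as HT.
  apply (exp_lam_le (rate q r / 4)); [exact HT| |lra].
  eapply Rle_trans; [apply Rabs_triang|]. rewrite !Rabs_mult.
  assert (H1 : Rabs (INR (qlen q n)) <= INR (span q r n)).
  { rewrite Rabs_pos_eq by apply pos_INR. apply le_INR. unfold span.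
    destruct (Nat.eqb_spec n 0) as [->|]; [rewrite qlen_0|]; lia. }
  assert (H2 : Rabs (INR (qlen q n)) * Rabs (ln (INR q * x)) <= INR (span q r n) * (rate q r / 8))
    by (apply Rmult_le_compat; try apply Rabs_pos; assumption).
  assert (H3 : Rabs (ln (f n)) * Rabs t <= K * INR (span q r n) * (rate q r / (8 * K)))
    by (apply Rmult_le_compat; try apply Rabs_pos; [apply HF|assumption]).
  replace (K * INR (span q r n) * (rate q r / (8 * K))) with (INR (span q r n) * (rate q r / 8))
    in H3 by (field; lra). lra.
Qed.

Lemma rate_ratio_pos : 0 < rate q r / (8 * K).
Proof. pose proof (rate_pos q r hq hr). apply Rdiv_lt_0_compat; lra. Qed.

Lemma invq_facts : 0 < / INR q /\ ln (INR q * / INR q) = 0.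
Proof.
  pose proof (INR_q_ge2 q hq). split; [apply Rinv_0_lt_compat; lra|].
  rewrite Rinv_r by lra. apply ln_1.
Qed.

Lemma Derive_Bfun_t_invq (t : R) : Rabs t <= rate q r / (8 * K) ->
  is_derive (fun t => Bfun q r f (/ INR q) t) t
    (Series (fun n => Bcoef n * ln (f n) * exp (ln (f n) * t))).
Proof.
  intros Ht. destruct invq_facts as [Hx Hl]. pose proof (rate_pos q r hq hr) as Hrate.
  pose proof (Derive_Bfun_t (/ INR q) t Hx) as H. rewrite Hl in H.
  rewrite Rabs_R0 in H. specialize (H ltac:(lra) Ht).
  erewrite Series_ext; [exact H|]. intros n. simpl. rewrite Rmult_0_r, exp_0. ring.
Qed.

Lemma B_t_step_mean : B_t q r f = INR q ^ r * step_mean q r (fun n => ln (f n)).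
Proof.
  unfold B_t. pose proof rate_ratio_pos.
  erewrite is_derive_unique by (apply Derive_Bfun_t_invq; rewrite Rabs_R0; lra).
  rewrite <- Bcoef_series by apply ln_f_zero.
  apply Series_ext. intros n. rewrite Rmult_0_r, exp_0. ring.
Qed.

Lemma Bcoef_ln_dominated (n : nat) :
  Rabs (Bcoef n * ln (f n)) <= INR q ^ r * (K * (4 / rate q r)) *
    (weight q r n * exp (rate q r / 2 * INR (span q r n))).
Proof.
  pose proof (rate_pos q r hq hr) as Hrate.
  assert (H4 : 0 < 4 / rate q r) by (apply Rdiv_lt_0_compat; lra).
  apply Bcoef_dominated; [apply Rmult_le_pos; lra|].
  eapply Rle_trans; [apply HF|]. rewrite Rmult_assoc. apply Rmult_le_compat_l; [lra|].
  pose proof (pos_INR (span q r n)) as HT.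
  eapply Rle_trans; [apply (le_exp_scaled (rate q r / 4)); lra|].
  replace (/ (rate q r / 4)) with (4 / rate q r) by (field; lra).
  apply Rmult_le_compat_l; [lra|]. apply exp_le. nra.
Qed.

Lemma B_tt_step_mean : B_tt q r f = INR q ^ r * step_mean q r (fun n => ln (f n) ^ 2).
Proof.
  unfold B_tt. change (Derive_n ?g 2 0) with (Derive (fun t => Derive g t) 0).
  pose proof (rate_pos q r hq hr) as Hrate. pose proof rate_ratio_pos as Hd.
  rewrite (Derive_ext_loc _ (fun t => Series (fun n => Bcoef n * ln (f n) * exp (ln (f n) * t)))).
  - erewrite is_derive_unique.
    2:{ apply (is_derive_exp_series q r hq hr _ _ (INR q ^ r * (K * (4 / rate q r))) K HK);
          [exact Bcoef_ln_dominated|exact HF]. }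
    rewrite <- Bcoef_series by (rewrite ln_f_zero; ring).
    apply Series_ext. intros n. ring.
  - exists (mkposreal _ Hd). intros t Ht. apply is_derive_unique, Derive_Bfun_t_invq.
    apply Rlt_le. unfold ball in Ht; simpl in Ht. unfold AbsRing_ball, abs, minus, plus, opp in Ht.
    simpl in Ht. now rewrite Ropp_0, Rplus_0_r in Ht.
Qed.

(** The extra factor q is the derivative of log(q x) at x = 1/q. *)
Lemma B_tx_step_mean :
  B_tx q r f = INR q ^ (r + 1) * step_mean q r (fun n => INR (qlen q n) * ln (f n)).
Proof.
  unfold B_tx. pose proof (INR_q_ge2 q hq) as Hq.
  pose proof (rate_pos q r hq hr) as Hrate. pose proof rate_ratio_pos as Hd.
  destruct invq_facts as [Hx0 Hl0].
  set (S1 := fun s => Series (fun n => Bcoef n * ln (f n) * exp (INR (qlen q n) * s))).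
  assert (Hloc : locally (/ INR q) (fun x => 0 < x /\ Rabs (ln (INR q * x)) <= rate q r / 8)).
  { apply filter_and.
    - apply (open_gt 0). exact Hx0.
    - assert (Hc : continuous (fun x => ln (INR q * x)) (/ INR q)).
      { apply (ex_derive_continuous (V := R_NormedModule)). auto_derive.
        rewrite Rinv_r; lra. }
      assert (Hr8 : 0 < rate q r / 8) by lra.
      specialize (Hc _ (locally_ball (ln (INR q * / INR q)) (mkposreal _ Hr8))).
      unfold filtermap in Hc. revert Hc. apply filter_imp. intros x Hb.
      rewrite Hl0 in Hb. unfold ball in Hb; simpl in Hb.
      unfold AbsRing_ball, abs, minus, plus, opp in Hb; simpl in Hb.
      rewrite Ropp_0, Rplus_0_r in Hb. lra. }
  rewrite (Derive_ext_loc _ (fun x => S1 (ln (INR q * x)))).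
  - erewrite is_derive_unique.
    2:{ apply (is_derive_comp S1 (fun x => ln (INR q * x))).
        - rewrite Hl0.
          apply (is_derive_exp_series q r hq hr _ _ (INR q ^ r * (K * (4 / rate q r))) 1);
            [lra|exact Bcoef_ln_dominated|].
          intros n. rewrite Rmult_1_l, Rabs_pos_eq by apply pos_INR. apply le_INR. unfold span.
          destruct (Nat.eqb_spec n 0) as [->|]; [rewrite qlen_0|]; lia.
        - auto_derive; [|reflexivity]. rewrite Rinv_r; lra. }
    rewrite (Series_ext _ (fun n => Bcoef n * (INR (qlen q n) * ln (f n)))) by (intros; ring).
    rewrite Bcoef_series by (rewrite qlen_0; simpl; ring).
    unfold scal; simpl; unfold mult; simpl. rewrite pow_add. field. lra.
  - revert Hloc. apply filter_imp. intros x [Hx Hl].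
    erewrite is_derive_unique.
    2:{ apply Derive_Bfun_t; [exact Hx|exact Hl|rewrite Rabs_R0; lra]. }
    apply Series_ext. intros n. rewrite Rmult_0_r, exp_0. ring.
Qed.

End Growth.
End LogF.

(** * Moments of one step *)

Lemma is_lim_seq_rsum (u : nat -> nat -> R) (l : nat -> R) (m : nat) :
  (forall i, (i < m)%nat -> is_lim_seq (u i) (l i)) ->
  is_lim_seq (fun n => rsum (fun i => u i n) m) (rsum l m).
Proof.
  induction m as [|m IH]; intros H; simpl; [apply is_lim_seq_const|].
  apply is_lim_seq_plus'; [apply IH; intros; apply H; lia|apply H; lia].
Qed.

Lemma is_lim_exp_decay (lam C : R) : 0 < lam -> is_lim_seq (fun k => C * exp (- lam * INR k)) 0.
Proof.
  intros Hl. replace (Finite 0) with (Finite (C * 0)) by (f_equal; ring).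
  apply is_lim_seq_mult'; [apply is_lim_seq_const|].
  apply is_lim_seq_ext with (pow (exp (- lam))); [intros; symmetry; apply exp_INR_mult|].
  apply is_lim_seq_geom. rewrite Rabs_pos_eq by (left; apply exp_pos).
  rewrite <- exp_0. apply exp_increasing. lra.
Qed.

Lemma is_lim_of_exp_decay (u : nat -> R) (l lam C : R) : 0 < lam ->
  (forall k, (1 <= k)%nat -> Rabs (u k - l) <= C * exp (- lam * INR k)) -> is_lim_seq u l.
Proof.
  intros Hl H. apply is_lim_seq_ext with (fun k => (u k - l) + l); [intros; ring|].
  replace (Finite l) with (Finite (0 + l)) by (f_equal; ring).
  apply is_lim_seq_plus'; [|apply is_lim_seq_const].
  apply is_lim_seq_abs_0.
  apply is_lim_seq_le_le_loc with (fun _ => 0) (fun k => C * exp (- lam * INR k)).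
  - exists 1%nat. intros k Hk. split; [apply Rabs_pos|now apply H].
  - apply is_lim_seq_const.
  - now apply is_lim_exp_decay.
Qed.

Lemma INR_exp_decay (lam : R) (k : nat) : 0 < lam ->
  INR k * exp (- lam * INR k) <= 2 / lam * exp (- (lam / 2) * INR k).
Proof.
  intros Hl. pose proof (le_exp_scaled (lam / 2) (INR k) ltac:(lra)) as H.
  replace (/ (lam / 2)) with (2 / lam) in H by (field; lra).
  replace (- lam * INR k) with (- (lam / 2) * INR k + - (lam / 2) * INR k) by field.
  rewrite exp_plus, <- Rmult_assoc. apply Rmult_le_compat_r; [left; apply exp_pos|].
  replace (2 / lam) with (2 / lam * exp (lam / 2 * INR k) * exp (- (lam / 2) * INR k)).
  - apply Rmult_le_compat_r; [left; apply exp_pos|exact H].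
  - rewrite Rmult_assoc, <- exp_plus. replace (_ + _) with 0 by ring. rewrite exp_0. ring.
Qed.

Lemma rsum_exp_decay (lam C : R) (m : nat) : 0 < lam -> 0 <= C ->
  rsum (fun j => C * exp (- lam * INR (S j))) m <= C * / (1 - exp (- lam)).
Proof.
  intros Hl HC. rewrite rsum_scal. apply Rmult_le_compat_l; [exact HC|].
  assert (Hy : exp (- lam) < 1) by (rewrite <- exp_0; apply exp_increasing; lra).
  pose proof (exp_pos (- lam)) as Hp.
  eapply Rle_trans; [|apply (geometric_rsum_le _ m); split; [left; exact Hp|exact Hy]].
  apply rsum_le. intros j _. rewrite exp_INR_mult. simpl.
  assert (0 <= exp (- lam) ^ j) by (apply pow_le; lra). nra.
Qed.

Section StepMoments.
Context (q r : nat) (hq : (2 <= q)%nat) (hr : (1 <= r)%nat).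
Notation T b := (INR (span q r b)).
Notation Tk k b := (INR (Nat.min k (span q r b))).

(* The factor 8 leaves room for polynomial factors in the span. *)
Definition decay_rate : R := rate q r / 8.
Notation lam := decay_rate.

Lemma decay_rate_pos : 0 < lam.
Proof. unfold decay_rate. pose proof (rate_pos q r hq hr). lra. Qed.

Lemma T_ge1 (b : nat) : 1 <= T b.
Proof. change 1 with (INR 1). apply le_INR, span_pos; assumption. Qed.

Lemma T_pow_exp (n b : nat) : T b ^ n <= (/ lam) ^ n * exp (INR n * lam * T b).
Proof.
  pose proof decay_rate_pos. rewrite (Rmult_assoc (INR n)), (Rmult_comm (INR n)), exp_INR_mult, <- Rpow_mult_distr.
  apply pow_incr. split; [apply pos_INR|]. now apply le_exp_scaled.
Qed.

Lemma T2_exp (b : nat) : T b ^ 2 <= (/ lam) ^ 2 * exp (2 * lam * T b).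
Proof. exact (T_pow_exp 2 b). Qed.

Lemma inv_decay_rate_pow_pos (n : nat) : 0 < (/ lam) ^ n.
Proof. apply pow_lt, Rinv_0_lt_compat, decay_rate_pos. Qed.

Lemma ex_step_mean_quad (G : nat -> R) (C : R) : 0 <= C ->
  (forall b, Rabs (G b) <= C * T b ^ 2) -> ex_series (fun b => weight q r b * G b).
Proof.
  intros HC HG. apply (ex_step_mean q r hq hr _ (C * (/ lam) ^ 2)). intros b.
  eapply Rle_trans; [apply HG|]. rewrite Rmult_assoc. apply Rmult_le_compat_l; [exact HC|].
  eapply Rle_trans; [apply T2_exp|].
  apply Rmult_le_compat_l; [left; apply inv_decay_rate_pow_pos|].
  apply exp_le. pose proof (T_ge1 b). pose proof decay_rate_pos. unfold decay_rate in *. nra.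
Qed.

Lemma step_mean_lin (G H : nat -> R) (c C : R) : 0 <= C ->
  (forall b, Rabs (G b) <= C * T b ^ 2) -> (forall b, Rabs (H b) <= C * T b ^ 2) ->
  step_mean q r (fun b => G b + c * H b) = step_mean q r G + c * step_mean q r H.
Proof.
  intros HC HG HH. unfold step_mean. rewrite <- Series_scal_l, <- Series_plus.
  - apply Series_ext. intros; ring.
  - now apply (ex_step_mean_quad G C).
  - apply (ex_series_scal (K := R_AbsRing) (V := R_NormedModule) c (fun b => weight q r b * H b)).
    now apply (ex_step_mean_quad H C).
Qed.

Lemma cut_mean_quad (C : R) (G : nat -> nat -> R) : 0 <= C ->
  (forall b t, (t <= span q r b)%nat -> Rabs (G b t) <= C * T b ^ 2) ->
  exists C', 0 <= C' /\ forall k, (1 <= k)%nat ->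
    Rabs (cut_mean q r k (fun b => G b (Nat.min k (span q r b)))
          - step_mean q r (fun b => G b (span q r b))) <= C' * exp (- lam * INR k).
Proof.
  intros HC HG. pose proof decay_rate_pos as Hl.
  destruct (cut_mean_converges q r hq hr (2 * lam) (C * (/ lam) ^ 2) G) as [C' [HC' H]].
  - lra.
  - unfold decay_rate. pose proof (rate_pos q r hq hr). lra.
  - apply Rmult_le_pos; [exact HC|left; apply inv_decay_rate_pow_pos].
  - intros b t Ht. eapply Rle_trans; [now apply HG|]. rewrite Rmult_assoc.
    apply Rmult_le_compat_l; [exact HC|apply T2_exp].
  - exists C'. split; [exact HC'|]. intros k Hk. eapply Rle_trans; [now apply H|].
    apply Rmult_le_compat_l; [exact HC'|]. apply exp_le. pose proof (pos_INR k). nra.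
Qed.

Lemma INR_le_quad (b t : nat) : (t <= span q r b)%nat -> Rabs (INR t) <= 1 * T b ^ 2.
Proof.
  intros Ht. rewrite Rabs_pos_eq by apply pos_INR. apply le_INR in Ht.
  pose proof (T_ge1 b). nra.
Qed.

Lemma INR2_le_quad (b t : nat) : (t <= span q r b)%nat -> Rabs (INR t ^ 2) <= 1 * T b ^ 2.
Proof.
  intros Ht. rewrite Rabs_pos_eq by apply pow2_ge_0. rewrite Rmult_1_l.
  apply pow_incr. split; [apply pos_INR|now apply le_INR].
Qed.

(** Equal to [renewal (S i) - renewal i] for [i < r]. *)
Definition jump (i : nat) : R := (/ INR q - 1) / INR q ^ i.

Lemma jump_sum (m : nat) : 1 + rsum jump m = / INR q ^ m.
Proof.
  pose proof (INR_q_ge2 q hq). induction m as [|m IH]; [simpl; field|].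
  simpl rsum. rewrite <- Rplus_assoc, IH. unfold jump. simpl. field.
  split; [apply pow_nonzero|]; lra.
Qed.

Lemma jump_sum1 (m : nat) : rsum (fun i => jump i * INR (S i)) m =
  INR m / INR q ^ m - (1 - / INR q ^ m) * INR q / (INR q - 1).
Proof.
  pose proof (INR_q_ge2 q hq). induction m as [|m IH]; [simpl; field; lra|].
  cbn [rsum]. rewrite IH. unfold jump. rewrite !S_INR. simpl. field.
  repeat split; try apply pow_nonzero; lra.
Qed.

(** The sequence a_k = k solves the renewal equation with error E min(k, T). Its increment is 1, so
    the limit of the differenced equation reads E T * q^-r = 1. *)
Lemma step_mean_T : step_mean q r (fun b => T b) = INR q ^ r.
Proof.
  pose proof (INR_q_ge2 q hq) as Hq. pose proof decay_rate_pos as Hl.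
  destruct (cut_mean_quad 1 (fun _ t => INR t) ltac:(lra) INR_le_quad) as [C [HC H]].
  cbv beta in H. set (m := step_mean q r (fun b => T b)) in *.
  set (e := fun k => cut_mean q r k (fun b => Tk k b)).
  assert (He : is_lim_seq e m) by (apply (is_lim_of_exp_decay e m lam C Hl H)).
  assert (Hd : forall k, (r < k)%nat -> 1 = e k + rsum (fun i => jump i * e (k - 1 - i)%nat) r).
  { intros k Hk. unfold jump. rewrite <- (renewal_diff q r hq hr INR e); [|reflexivity| |exact Hk].
    - replace k with (S (k - 1)) at 1 by lia. rewrite S_INR. ring.
    - clear k Hk. intros k Hk. unfold e, cut_mean. rewrite <- rsum_plus.
      rewrite (rsum_ext _ (fun b => INR k * cut_weight q r k b)).
      + rewrite rsum_scal, cut_weight_total by assumption. ring.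
      + intros b _. rewrite minus_INR by lia. ring. }
  assert (HL : is_lim_seq (fun n => e (n + S r)%nat
                 + rsum (fun i => jump i * e (n + (r - i))%nat) r) (m + rsum (fun i => jump i * m) r)).
  { apply is_lim_seq_plus'.
    - now apply (is_lim_seq_incr_n e (S r)).
    - apply is_lim_seq_rsum. intros i Hi. apply is_lim_seq_mult'; [apply is_lim_seq_const|].
      now apply (is_lim_seq_incr_n e (r - i)). }
  apply (is_lim_seq_ext _ (fun _ => 1)) in HL.
  2:{ intros n. rewrite (Hd (n + S r)%nat) by lia. f_equal. apply rsum_ext. intros i Hi.
      do 2 f_equal. lia. }
  apply is_lim_seq_unique in HL. rewrite Lim_seq_const in HL. injection HL as HL.
  rewrite (rsum_ext _ (fun i => m * jump i)), rsum_scal in HL by (intros; ring).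
  assert (E : m * / INR q ^ r = 1) by (rewrite <- jump_sum; lra).
  apply (f_equal (fun x => x * INR q ^ r)) in E.
  rewrite Rmult_assoc, Rinv_l, Rmult_1_r, Rmult_1_l in E by (apply pow_nonzero; lra). exact E.
Qed.

(** The same device with a_k = k^2: the error is 2 k E min(k, T) - E min(k, T)^2 and the increment 2
    k - 1. The parts linear in [k] cancel, and the constants that remain determine E T^2. *)
Lemma step_mean_T2 : step_mean q r (fun b => T b ^ 2) =
  INR q ^ r * (1 - 2 * INR r + 2 * INR q * (INR q ^ r - 1) / (INR q - 1)).
Proof.
  pose proof (INR_q_ge2 q hq) as Hq. pose proof decay_rate_pos as Hl.
  destruct (cut_mean_quad 1 (fun _ t => INR t) ltac:(lra) INR_le_quad) as [C1 [HC1 H1]].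
  destruct (cut_mean_quad 1 (fun _ t => INR t ^ 2) ltac:(lra) INR2_le_quad) as [C2 [HC2 H2]].
  cbv beta in H1, H2. rewrite step_mean_T in H1.
  set (m := step_mean q r (fun b => T b ^ 2)) in *.
  set (Y := INR q ^ r) in *.
  set (e := fun k => cut_mean q r k (fun b => 2 * INR k * Tk k b - Tk k b ^ 2)).
  (* [h] is the deviation of the error from its asymptote; E min(k, T) converges exponentially fast,
     which beats the factor [k]. *)
  set (h := fun k => e k - (2 * INR k * Y - m)).
  assert (Hh : is_lim_seq h 0).
  { apply (is_lim_of_exp_decay h 0 (lam / 2) (2 * C1 * (2 / lam) + C2)); [lra|].
    intros k Hk. rewrite Rminus_0_r. unfold h, e. rewrite (cut_mean_minus q r), (cut_mean_scal q r).
    specialize (H1 k Hk). specialize (H2 k Hk).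
    set (x := cut_mean q r k (fun b => Tk k b)) in *.
    set (y := cut_mean q r k (fun b => Tk k b ^ 2)) in *.
    replace (2 * INR k * x - y - (2 * INR k * Y - m)) with (2 * INR k * (x - Y) - (y - m)) by ring.
    unfold Rminus at 1. eapply Rle_trans; [apply Rabs_triang|].
    rewrite Rabs_Ropp, Rmult_plus_distr_r. apply Rplus_le_compat.
    - rewrite Rabs_mult, Rabs_mult, (Rabs_pos_eq 2), (Rabs_pos_eq (INR k)) by (try apply pos_INR; lra).
      apply Rle_trans with (2 * C1 * (INR k * exp (- lam * INR k))).
      + replace (2 * C1 * (INR k * exp (- lam * INR k)))
          with (2 * INR k * (C1 * exp (- lam * INR k))) by ring.
        apply Rmult_le_compat_l; [pose proof (pos_INR k); lra|exact H1].
      + rewrite Rmult_assoc, Rmult_assoc. rewrite Rmult_assoc.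
        apply Rmult_le_compat_l; [lra|]. apply Rmult_le_compat_l; [exact HC1|].
        now apply INR_exp_decay.
    - eapply Rle_trans; [exact H2|]. apply Rmult_le_compat_l; [exact HC2|].
      apply exp_le. pose proof (pos_INR k). nra. }
  assert (Hd : forall k, (r < k)%nat ->
    2 * INR k - 1 = e k + rsum (fun i => jump i * e (k - 1 - i)%nat) r).
  { intros k Hk. unfold jump.
    rewrite <- (renewal_diff q r hq hr (fun k => INR k ^ 2) e); [|simpl; ring| |exact Hk].
    - replace k with (S (k - 1)) at 1 2 by lia. rewrite S_INR. ring.
    - clear k Hk. intros k Hk. unfold e, cut_mean. rewrite <- rsum_plus.
      rewrite (rsum_ext _ (fun b => INR k ^ 2 * cut_weight q r k b)).
      + rewrite rsum_scal, cut_weight_total by assumption. ring.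
      + intros b _. rewrite minus_INR by lia. ring. }
  set (D := rsum (fun i => jump i * INR (S i)) r).
  assert (HL : is_lim_seq (fun n => h (n + S r)%nat
                 + rsum (fun i => jump i * h (n + (r - i))%nat) r) (0 + rsum (fun i => jump i * 0) r)).
  { apply is_lim_seq_plus'.
    - now apply (is_lim_seq_incr_n h (S r)).
    - apply is_lim_seq_rsum. intros i Hi. apply is_lim_seq_mult'; [apply is_lim_seq_const|].
      now apply (is_lim_seq_incr_n h (r - i)). }
  apply (is_lim_seq_ext _ (fun _ => m * / Y + 2 * Y * D - 1)) in HL.
  2:{ intros n. set (k := (n + S r)%nat).
      rewrite (rsum_ext _ (fun i => (jump i * e (k - 1 - i)%nat - (2 * INR k * Y - m) * jump i)
        + 2 * Y * (jump i * INR (S i)))).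
      - rewrite rsum_plus, rsum_minus, !rsum_scal. fold D. unfold h.
        pose proof (Hd k ltac:(unfold k; lia)) as E. pose proof (jump_sum r) as J. fold Y in J.
        set (E' := rsum (fun i => jump i * e (k - 1 - i)%nat) r) in *.
        replace (rsum jump r) with (/ Y - 1) by lra.
        replace (e k) with (2 * INR k - 1 - E') by lra.
        field. unfold Y. apply pow_nonzero; lra.
      - intros i Hi. unfold h. replace (n + (r - i))%nat with (k - 1 - i)%nat by (unfold k; lia).
        replace (INR (k - 1 - i)) with (INR k - INR (S i)).
        + ring.
        + rewrite <- minus_INR by (unfold k; lia). f_equal. lia. }
  apply is_lim_seq_unique in HL. rewrite Lim_seq_const in HL. injection HL as HL.
  rewrite (rsum_ext _ (fun _ => 0)), rsum_const in HL by (intros; ring).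
  assert (HY : Y <> 0) by (unfold Y; apply pow_nonzero; lra).
  assert (E : m = Y * (1 - 2 * Y * D)).
  { replace m with (Y * (m * / Y)) by (field; exact HY). f_equal. lra. }
  rewrite E. unfold D. rewrite jump_sum1. fold Y. field. split; [lra|exact HY].
Qed.

(** The cut weights form a probability, so the supremum over [I] grows at each level by at most the
    error of that level. The index set [I] makes room for the phase of characteristic functions. *)
Lemma step_mean_max_principle (I : Type) (u : I -> nat -> R) (j : I -> nat -> nat -> I)
  (err : nat -> R) (M : R) :
  (forall i, Rabs (u i 0%nat) <= M) -> (forall k, 0 <= err k) ->
  (forall i k, (1 <= k)%nat ->
     Rabs (u i k) <= rsum (fun b => cut_weight q r k b *
        Rabs (u (j i k b) (k - Nat.min k (span q r b))%nat)) (q ^ k) + err k) ->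
  forall k i, Rabs (u i k) <= M + rsum (fun n => err (S n)) k.
Proof.
  intros H0 Herr Hrec k. induction k as [k IH] using lt_wf_ind. intros i.
  destruct k as [|k]; [simpl; rewrite Rplus_0_r; apply H0|].
  eapply Rle_trans; [apply Hrec; lia|]. simpl rsum at 2. rewrite <- Rplus_assoc.
  apply Rplus_le_compat_r.
  set (V := M + rsum (fun n => err (S n)) k).
  apply Rle_trans with (rsum (fun b => V * cut_weight q r (S k) b) (q ^ S k)).
  - apply rsum_le. intros b _. rewrite Rmult_comm.
    apply Rmult_le_compat_r; [now apply cut_weight_nonneg|].
    pose proof (span_pos q hq r hr b).
    eapply Rle_trans; [apply IH; lia|]. apply Rplus_le_compat_l.
    apply rsum_monotone; [lia|]. intros; apply Herr.
  - rewrite rsum_scal, cut_weight_total by (try assumption; lia). lra.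
Qed.
End StepMoments.

(** * Mean, variance and characteristic function *)

Lemma mean_value_bound (g dg : R -> R) (y B : R) :
  (forall x, is_derive g x (dg x)) -> g 0 = 0 ->
  (forall x, Rabs x <= Rabs y -> Rabs (dg x) <= B) -> Rabs (g y) <= B * Rabs y.
Proof.
  intros Hg H0 HB.
  destruct (MVT_gen g 0 y dg) as [c [Hc E]].
  - intros x _. apply Hg.
  - intros x _. apply continuity_pt_filterlim. apply (ex_derive_continuous (V := R_NormedModule)).
    eexists; apply Hg.
  - rewrite H0, !Rminus_0_r in E. rewrite E, Rabs_mult.
    apply Rmult_le_compat_r; [apply Rabs_pos|]. apply HB.
    unfold Rmin, Rmax in Hc. unfold Rabs. destruct (Rle_dec 0 y); destruct (Rcase_abs c);
      destruct (Rcase_abs y); lra.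
Qed.

Lemma sin_abs_le (y : R) : Rabs (sin y) <= Rabs y.
Proof.
  rewrite <- (Rmult_1_l (Rabs y)). apply (mean_value_bound sin cos); [apply is_derive_sin|apply sin_0|].
  intros x _. apply Rabs_le. apply COS_bound.
Qed.

Lemma cos_m1_abs_le (y : R) : Rabs (cos y - 1) <= Rabs y.
Proof.
  rewrite <- (Rmult_1_l (Rabs y)). apply (mean_value_bound (fun x => cos x - 1) (fun x => - sin x)).
  - intros x. auto_derive; [exact I|ring].
  - rewrite cos_0; ring.
  - intros x _. rewrite Rabs_Ropp. apply Rabs_le. apply SIN_bound.
Qed.

Lemma cos_m1_quad (y : R) : Rabs (cos y - 1) <= Rabs y ^ 2.
Proof.
  replace (Rabs y ^ 2) with (Rabs y * Rabs y) by ring.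
  apply (mean_value_bound (fun x => cos x - 1) (fun x => - sin x)).
  - intros x. auto_derive; [exact I|ring].
  - rewrite cos_0; ring.
  - intros x Hx. rewrite Rabs_Ropp. pose proof (sin_abs_le x). lra.
Qed.

Lemma sin_taylor_bounds (y : R) : Rabs (sin y - y) <= Rabs y ^ 2 /\ Rabs (sin y - y) <= Rabs y ^ 3.
Proof.
  assert (Hd : forall x, is_derive (fun x => sin x - x) x (cos x - 1))
    by (intros x; auto_derive; [exact I|ring]).
  assert (H0 : sin 0 - 0 = 0) by (rewrite sin_0; ring).
  pose proof (Rabs_pos y). split.
  - replace (Rabs y ^ 2) with (Rabs y * Rabs y) by ring.
    apply (mean_value_bound (fun x => sin x - x) (fun x => cos x - 1)); [exact Hd|exact H0|].
    intros x Hx. pose proof (cos_m1_abs_le x). lra.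
  - replace (Rabs y ^ 3) with (Rabs y ^ 2 * Rabs y) by ring.
    apply (mean_value_bound (fun x => sin x - x) (fun x => cos x - 1)); [exact Hd|exact H0|].
    intros x Hx. eapply Rle_trans; [apply cos_m1_quad|]. apply pow_incr.
    split; [apply Rabs_pos|exact Hx].
Qed.

Lemma cos_taylor2 (y : R) : Rabs (cos y - 1 + y ^ 2 / 2) <= Rabs y ^ 3.
Proof.
  replace (Rabs y ^ 3) with (Rabs y ^ 2 * Rabs y) by ring.
  apply (mean_value_bound (fun x => cos x - 1 + x ^ 2 / 2) (fun x => x - sin x)).
  - intros x. auto_derive; [exact I|field].
  - rewrite cos_0; field.
  - intros x Hx. replace (x - sin x) with (- (sin x - x)) by ring. rewrite Rabs_Ropp.
    eapply Rle_trans; [apply (proj1 (sin_taylor_bounds x))|]. apply pow_incr. split; [apply Rabs_pos|exact Hx].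
Qed.

Lemma abs_mult_le_r (x y : R) : Rabs x <= 1 -> Rabs (y * x) <= Rabs y.
Proof. intros H. rewrite Rabs_mult. pose proof (Rabs_pos y). nra. Qed.

Lemma cos_shift_taylor (a y : R) :
  Rabs (cos (a + y) - (cos a - y * sin a - y ^ 2 / 2 * cos a)) <= 2 * Rabs y ^ 3.
Proof.
  rewrite cos_plus.
  replace (_ - _) with ((cos y - 1 + y ^ 2 / 2) * cos a + - ((sin y - y) * sin a)) by field.
  eapply Rle_trans; [apply Rabs_triang|]. rewrite Rabs_Ropp.
  assert (Hc : Rabs (cos a) <= 1) by (apply Rabs_le, COS_bound).
  assert (Hs : Rabs (sin a) <= 1) by (apply Rabs_le, SIN_bound).
  pose proof (abs_mult_le_r (cos a) (cos y - 1 + y ^ 2 / 2) Hc).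
  pose proof (abs_mult_le_r (sin a) (sin y - y) Hs).
  pose proof (cos_taylor2 y). pose proof (proj2 (sin_taylor_bounds y)). lra.
Qed.

Lemma cos_lipschitz (a y : R) : Rabs (cos (a + y) - cos a) <= 2 * Rabs y.
Proof.
  rewrite cos_plus.
  replace (_ - _) with ((cos y - 1) * cos a + - (sin y * sin a)) by ring.
  eapply Rle_trans; [apply Rabs_triang|]. rewrite Rabs_Ropp.
  assert (Hc : Rabs (cos a) <= 1) by (apply Rabs_le, COS_bound).
  assert (Hs : Rabs (sin a) <= 1) by (apply Rabs_le, SIN_bound).
  pose proof (abs_mult_le_r (cos a) (cos y - 1) Hc).
  pose proof (abs_mult_le_r (sin a) (sin y) Hs).
  pose proof (cos_m1_abs_le y). pose proof (sin_abs_le y). lra.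
Qed.

Lemma exp_cos_taylor (a y s : R) : 0 <= s ->
  Rabs (exp s * cos (a + y) - (cos a - y * sin a + (s - y ^ 2 / 2) * cos a))
  <= 2 * Rabs y ^ 3 + 2 * s * Rabs y + s ^ 2 * exp s.
Proof.
  intros Hs.
  replace (_ - _) with ((exp s - 1 - s) * cos (a + y)
    + (s * (cos (a + y) - cos a)
    + (cos (a + y) - (cos a - y * sin a - y ^ 2 / 2 * cos a)))) by field.
  eapply Rle_trans; [apply Rabs_triang|].
  eapply Rle_trans; [apply Rplus_le_compat_l, Rabs_triang|].
  assert (Hc : Rabs (cos (a + y)) <= 1) by (apply Rabs_le, COS_bound).
  pose proof (abs_mult_le_r _ (exp s - 1 - s) Hc).
  pose proof (exp_taylor1 s) as He. rewrite (Rabs_pos_eq s Hs) in He.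
  pose proof (cos_shift_taylor a y).
  rewrite (Rabs_mult s), (Rabs_pos_eq s Hs). pose proof (cos_lipschitz a y). nra.
Qed.

(** * The centered reward of a step and its moments *)

Section Asymptotics.
Context (q r : nat) (f : nat -> R) (hq : (2 <= q)%nat) (hr : (1 <= r)%nat)
  (hpos : forall n, 0 < f n) (hqm : quasimultiplicative q r f)
  (K : R) (HK : 0 < K) (HF : forall n, Rabs (ln (f n)) <= K * INR (span q r n)).
Notation T b := (INR (span q r b)).
Notation Tk k b := (INR (Nat.min k (span q r b))).
Notation F b := (ln (f b)).
Notation lam := (decay_rate q r).
Notation mu := (mu_const q r f).
Notation sigma2 := (sigma2_const q r f).

Definition slope : R := K + Rabs mu.

Lemma slope_pos : 0 < slope.
Proof. unfold slope. pose proof (Rabs_pos mu). lra. Qed.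

Lemma centered_step_bound (b t : nat) : (t <= span q r b)%nat ->
  Rabs (F b - mu * INR t) <= slope * T b.
Proof.
  intros Ht. unfold Rminus. eapply Rle_trans; [apply Rabs_triang|].
  rewrite Rabs_Ropp, Rabs_mult, (Rabs_pos_eq (INR t)) by apply pos_INR.
  apply le_INR in Ht. pose proof (HF b). pose proof (Rabs_pos mu). unfold slope. nra.
Qed.

Lemma quad_bound (x A t : R) : 1 <= t -> 0 <= A -> Rabs x <= A * t -> Rabs x <= A * t ^ 2.
Proof.
  intros Ht HA H. eapply Rle_trans; [exact H|]. apply Rmult_le_compat_l; [exact HA|nra].
Qed.

Lemma sq_bound (x A t : R) : 0 <= A -> Rabs x <= A * t -> Rabs (x ^ 2) <= A ^ 2 * t ^ 2.
Proof.
  intros HA H. rewrite <- Rpow_mult_distr, <- RPow_abs. apply pow_incr.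
  split; [apply Rabs_pos|exact H].
Qed.

Lemma mu_step_mean : mu * INR q ^ r = step_mean q r (fun b => F b).
Proof.
  unfold mu_const. rewrite (B_t_step_mean q r f hq hr hpos hqm K HK HF).
  replace (2 * r)%nat with (r + r)%nat by lia. rewrite pow_add.
  pose proof (INR_q_ge2 q hq). field. apply pow_nonzero; lra.
Qed.

Lemma centered_mean : step_mean q r (fun b => F b - mu * T b) = 0.
Proof.
  assert (Hs := slope_pos).
  unfold step_mean. rewrite (Series_ext _ (fun b => weight q r b * (F b + - mu * T b)))
    by (intros; ring).
  change (step_mean q r (fun b => F b + - mu * T b) = 0).
  rewrite (step_mean_lin q r hq hr _ _ (- mu) (K + 1)).
  - rewrite <- mu_step_mean, (step_mean_T q r hq hr). ring.
  - lra.
  - intros b. apply quad_bound; [apply T_ge1; assumption|lra|].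
    eapply Rle_trans; [apply HF|]. apply Rmult_le_compat_r; [apply pos_INR|lra].
  - intros b. apply quad_bound; [apply T_ge1; assumption|lra|].
    rewrite Rabs_pos_eq by apply pos_INR. pose proof (pos_INR (span q r b)). nra.
Qed.

(** The square is expanded. In the cross term T = l + r produces [B_tx] and [r] times the mean
    reward. This and E T^2 contribute half each of the term with 4 r; E T^2 also yields the terms
    divided by q - 1. *)
Lemma centered_second_moment :
  step_mean q r (fun b => (F b - mu * T b) ^ 2) = sigma2 * INR q ^ r.
Proof.
  pose proof (INR_q_ge2 q hq) as Hq. pose proof slope_pos as Hs.
  assert (HT : forall b, 1 <= T b) by (intros; apply T_ge1; assumption).
  set (C := (K + 1) ^ 2).
  assert (HC : 0 <= C) by apply pow2_ge_0.
  assert (HFq : forall b, Rabs (F b) <= C * T b ^ 2).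
  { intros b. apply Rle_trans with (K * T b); [apply HF|]. specialize (HT b). unfold C.
    apply Rmult_le_compat; nra. }
  assert (HF2 : forall b, Rabs (F b ^ 2) <= C * T b ^ 2).
  { intros b. eapply Rle_trans; [apply (sq_bound _ K (T b)); [lra|apply HF]|].
    apply Rmult_le_compat_r; [apply pow2_ge_0|]. unfold C; nra. }
  assert (HT2 : forall b, Rabs (T b ^ 2) <= C * T b ^ 2).
  { intros b. rewrite Rabs_pos_eq by apply pow2_ge_0. rewrite <- (Rmult_1_l (T b ^ 2)) at 1.
    apply Rmult_le_compat_r; [apply pow2_ge_0|]. unfold C. nra. }
  (* At [b = 0] the span is 1 and not [qlen + r]; the identity survives because log f(0) = 0. *)
  assert (Hlen : forall b, INR (qlen q b) * F b = T b * F b - INR r * F b).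
  { intros b. unfold span. destruct (Nat.eqb_spec b 0) as [->|].
    - rewrite (ln_f_zero q r f hq hpos hqm). ring.
    - rewrite plus_INR. ring. }
  assert (HlenT : forall b, INR (qlen q b) <= T b).
  { intros b. apply le_INR. unfold span. destruct (Nat.eqb_spec b 0) as [->|]; [rewrite qlen_0|]; lia. }
  assert (HlF : forall b, Rabs (INR (qlen q b) * F b) <= C * T b ^ 2).
  { intros b. rewrite Rabs_mult, (Rabs_pos_eq (INR _)) by apply pos_INR.
    pose proof (HlenT b). pose proof (HF b). pose proof (pos_INR (qlen q b)). pose proof (Rabs_pos (F b)).
    specialize (HT b). apply Rle_trans with (T b * (K * T b)); [now apply Rmult_le_compat|].
    replace (T b * (K * T b)) with (K * T b ^ 2) by ring.
    apply Rmult_le_compat_r; [apply pow2_ge_0|]. unfold C. nra. }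
  set (C' := C * (1 + 2 * Rabs mu * (1 + INR r) + mu ^ 2)).
  pose proof (pos_INR r) as Hr0. pose proof (Rabs_pos mu) as Hm. pose proof (pow2_ge_0 mu) as Hm2.
  assert (Hr1 : 0 <= Rabs mu * (1 + INR r)) by nra.
  assert (HCC : C <= C') by (unfold C'; nra).
  assert (HC' : 0 <= C') by lra.
  assert (Hup : forall x b, Rabs x <= C * T b ^ 2 -> Rabs x <= C' * T b ^ 2).
  { intros x b H. eapply Rle_trans; [exact H|]. apply Rmult_le_compat_r; [apply pow2_ge_0|exact HCC]. }
  assert (E1 : step_mean q r (fun b => (F b - mu * T b) ^ 2) =
    step_mean q r (fun b => F b ^ 2) + - (2 * mu) * step_mean q r (fun b => INR (qlen q b) * F b)
    + - (2 * mu * INR r) * step_mean q r (fun b => F b)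
    + mu ^ 2 * step_mean q r (fun b => T b ^ 2)).
  { assert (S1 : forall b, Rabs (F b ^ 2 + - (2 * mu) * (INR (qlen q b) * F b)) <=
      (C * (1 + 2 * Rabs mu)) * T b ^ 2).
    { intros b. eapply Rle_trans; [apply Rabs_triang|]. rewrite (Rabs_mult (- (2 * mu))).
      rewrite Rabs_Ropp, (Rabs_mult 2), (Rabs_pos_eq 2) by lra.
      specialize (HF2 b). specialize (HlF b). pose proof (Rabs_pos (INR (qlen q b) * F b)). nra. }
    assert (S2 : forall b, Rabs (F b ^ 2 + - (2 * mu) * (INR (qlen q b) * F b)
        + - (2 * mu * INR r) * F b) <= C' * T b ^ 2).
    { intros b. eapply Rle_trans; [apply Rabs_triang|]. rewrite (Rabs_mult (- (2 * mu * INR r))).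
      rewrite Rabs_Ropp, (Rabs_mult (2 * mu)), (Rabs_mult 2), (Rabs_pos_eq 2), (Rabs_pos_eq (INR r)) by lra.
      specialize (S1 b). specialize (HFq b).
      assert (2 * Rabs mu * INR r * Rabs (F b) <= 2 * Rabs mu * INR r * (C * T b ^ 2)).
      { apply Rmult_le_compat_l; [nra|exact HFq]. }
      apply Rle_trans with (C * (1 + 2 * Rabs mu) * T b ^ 2 + 2 * Rabs mu * INR r * (C * T b ^ 2)); [lra|].
      unfold C'. pose proof (pow2_ge_0 (T b)).
      assert (0 <= C * mu ^ 2 * T b ^ 2) by (apply Rmult_le_pos; [now apply Rmult_le_pos|assumption]).
      lra. }
    rewrite <- (step_mean_lin q r hq hr (fun b => F b ^ 2) _ _ C HC HF2 HlF).
    rewrite <- (step_mean_lin q r hq hr _ (fun b => F b) _ C' HC');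
      [|intros b; eapply Rle_trans; [apply S1|]|intros b; now apply Hup].
    2:{ apply Rmult_le_compat_r; [apply pow2_ge_0|]. unfold C'. apply Rmult_le_compat_l; nra. }
    rewrite <- (step_mean_lin q r hq hr _ (fun b => T b ^ 2) _ C' HC' S2 (fun b => Hup _ b (HT2 b))).
    unfold step_mean. apply Series_ext. intros b. rewrite Hlen. ring. }
  rewrite E1, (step_mean_T2 q r hq hr), <- mu_step_mean.
  assert (Ett := B_tt_step_mean q r f hq hr hpos hqm K HK HF).
  assert (Etx := B_tx_step_mean q r f hq hr K HK HF).
  assert (Et := B_t_step_mean q r f hq hr hpos hqm K HK HF).
  rewrite <- mu_step_mean in Et.
  unfold sigma2_const. cbv zeta. rewrite Ett, Etx, Et.
  replace (4 * r + 1)%nat with (r + r + r + r + 1)%nat by lia.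
  replace (4 * r)%nat with (r + r + r + r)%nat by lia.
  replace (3 * r)%nat with (r + r + r)%nat by lia.
  replace (2 * r)%nat with (r + r)%nat by lia.
  rewrite !pow_add, pow_1.
  generalize mu. intros m. set (Y := INR q ^ r).
  assert (HY : Y <> 0) by (unfold Y; apply pow_nonzero; lra).
  field. repeat split; try exact HY; lra.
Qed.

Lemma centered_cut_mean : exists C, 0 <= C /\ forall k, (1 <= k)%nat ->
  Rabs (cut_mean q r k (fun b => F b - mu * Tk k b)) <= C * exp (- lam * INR k).
Proof.
  pose proof slope_pos.
  destruct (cut_mean_quad q r hq hr slope (fun b t => F b - mu * INR t)) as [C [HC Hk]].
  - lra.
  - intros b t Ht. apply quad_bound; [apply T_ge1; assumption|lra|].
    now apply centered_step_bound.
  - exists C. split; [exact HC|]. intros k Hk1. specialize (Hk k Hk1).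
    cbv beta in Hk. rewrite centered_mean, Rminus_0_r in Hk. exact Hk.
Qed.

(** The comparison is with [sigma2] times the cut mean of the span, which is exactly the error term
    that [sigma2 * INR k] has in the recursion. *)
Lemma centered_cut_second : exists C, 0 <= C /\ forall k, (1 <= k)%nat ->
  Rabs (cut_mean q r k (fun b => (F b - mu * Tk k b) ^ 2)
        - sigma2 * cut_mean q r k (fun b => Tk k b)) <= C * exp (- lam * INR k).
Proof.
  pose proof slope_pos.
  destruct (cut_mean_quad q r hq hr (slope ^ 2) (fun b t => (F b - mu * INR t) ^ 2)) as [C1 [HC1 H1]].
  { apply pow2_ge_0. }
  { intros b t Ht. apply sq_bound; [lra|]. now apply centered_step_bound. }
  destruct (cut_mean_quad q r hq hr 1 (fun _ t => INR t) ltac:(lra) (INR_le_quad q r hq hr))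
    as [C2 [HC2 H2]].
  exists (C1 + Rabs sigma2 * C2). split.
  - pose proof (Rabs_pos sigma2). nra.
  - intros k Hk. specialize (H1 k Hk). specialize (H2 k Hk). cbv beta in H1, H2.
    rewrite centered_second_moment in H1. rewrite (step_mean_T q r hq hr) in H2.
    set (x := cut_mean q r k (fun b => (F b - mu * Tk k b) ^ 2)) in *.
    set (y := cut_mean q r k (fun b => Tk k b)) in *.
    replace (x - sigma2 * y) with ((x - sigma2 * INR q ^ r) + - (sigma2 * (y - INR q ^ r))) by ring.
    eapply Rle_trans; [apply Rabs_triang|]. rewrite Rabs_Ropp, (Rabs_mult sigma2).
    rewrite Rmult_plus_distr_r, Rmult_assoc. apply Rplus_le_compat; [exact H1|].
    apply Rmult_le_compat_l; [apply Rabs_pos|exact H2].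
Qed.

Lemma unif_expect_0 (X : nat -> R) : unif_expect q 0 X = X 0%nat.
Proof. unfold unif_expect. simpl. field. Qed.

(** The centering [mu * INR k] is shared between the digits read and those left. A general [phi]
    covers first moments, second moments and cosines. *)
Lemma centered_rec (phi : R -> R) (k : nat) : (1 <= k)%nat ->
  unif_expect q k (fun n => phi (F n - mu * INR k)) =
  cut_mean q r k (fun b => unif_expect q (k - Nat.min k (span q r b))
    (fun a => phi ((F a - mu * INR (k - Nat.min k (span q r b))) + (F b - mu * Tk k b)))).
Proof.
  intros Hk. rewrite (unif_expect_rec q r hq hr) by exact Hk.
  apply rsum_ext. intros b _. f_equal. apply unif_expect_ext. intros a _. f_equal.
  rewrite (ln_f_step q r f hq hpos hqm). rewrite minus_INR by lia. ring.
Qed.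

(** * Mean and variance up to bounded errors *)

Definition drift (k : nat) : R := unif_expect q k (fun n => F n - mu * INR k).
Definition spread (k : nat) : R := unif_expect q k (fun n => (F n - mu * INR k) ^ 2).

Lemma drift_rec (k : nat) : (1 <= k)%nat ->
  drift k = rsum (fun b => cut_weight q r k b * drift (k - Nat.min k (span q r b))%nat) (q ^ k)
            + cut_mean q r k (fun b => F b - mu * Tk k b).
Proof.
  intros Hk. unfold drift. rewrite (centered_rec (fun x => x)) by exact Hk.
  unfold cut_mean. rewrite <- rsum_plus. apply rsum_ext. intros b _.
  rewrite unif_expect_plus, (unif_expect_const q hq). ring.
Qed.

Lemma spread_rec (k : nat) : (1 <= k)%nat ->
  spread k = rsum (fun b => cut_weight q r k b * spread (k - Nat.min k (span q r b))%nat) (q ^ k)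
    + (2 * cut_mean q r k (fun b => (F b - mu * Tk k b) * drift (k - Nat.min k (span q r b))%nat)
       + cut_mean q r k (fun b => (F b - mu * Tk k b) ^ 2)).
Proof.
  intros Hk. unfold spread. rewrite (centered_rec (fun x => x ^ 2)) by exact Hk.
  unfold cut_mean. rewrite <- rsum_scal, <- !rsum_plus. apply rsum_ext. intros b _.
  set (j := (k - Nat.min k (span q r b))%nat). set (X := F b - mu * Tk k b).
  rewrite (unif_expect_ext q j _ (fun a => (F a - mu * INR j) ^ 2
      + (2 * X * (F a - mu * INR j) + X ^ 2))) by (intros; ring).
  rewrite !unif_expect_plus, unif_expect_scal, (unif_expect_const q hq). fold (drift j). ring.
Qed.

Lemma drift_0 : drift 0 = 0.
Proof. unfold drift. rewrite unif_expect_0, (ln_f_zero q r f hq hpos hqm). simpl. ring. Qed.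

Lemma spread_0 : spread 0 = 0.
Proof. unfold spread. rewrite unif_expect_0, (ln_f_zero q r f hq hpos hqm). simpl. ring. Qed.

Lemma drift_bounded : exists D, 0 <= D /\ forall k, Rabs (drift k) <= D.
Proof.
  destruct centered_cut_mean as [C [HC Hc]]. pose proof (decay_rate_pos q r hq hr) as Hl.
  assert (Hy : exp (- lam) < 1) by (rewrite <- exp_0; apply exp_increasing; lra).
  exists (C * / (1 - exp (- lam))). split.
  { apply Rmult_le_pos; [exact HC|]. left. apply Rinv_0_lt_compat. lra. }
  intros k.
  eapply Rle_trans; [|apply (rsum_exp_decay lam C k Hl HC)].
  rewrite <- Rplus_0_l.
  apply (step_mean_max_principle q r hq hr unit (fun _ => drift) (fun _ _ _ => tt)
    (fun n => C * exp (- lam * INR n)) 0).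
  - intros _. rewrite drift_0, Rabs_R0. lra.
  - intros n. apply Rmult_le_pos; [exact HC|left; apply exp_pos].
  - intros _ n Hn. rewrite drift_rec at 1 by exact Hn.
    eapply Rle_trans; [apply Rabs_triang|]. apply Rplus_le_compat; [|now apply Hc].
    eapply Rle_trans; [apply rsum_abs|]. apply rsum_le. intros b _.
    rewrite Rabs_mult, (Rabs_pos_eq (cut_weight q r n b)); [lra|now apply cut_weight_nonneg].
  - exact tt.
Qed.

(** By [renewal_diff] an increment involves only the errors at k, ..., k - r, which decay
    exponentially; the finitely many [k <= r] go into [A1]. *)
Lemma drift_diff : exists A, 0 <= A /\ forall k, (1 <= k)%nat ->
  Rabs (drift k - drift (k - 1)%nat) <= A * exp (- lam * INR k).
Proof.
  destruct centered_cut_mean as [C [HC Hc]]. pose proof (decay_rate_pos q r hq hr) as Hl.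
  pose proof (INR_q_ge2 q hq) as Hq.
  destruct (finite_bound (fun k => (drift k - drift (k - 1)%nat) * exp (lam * INR k)) (S r))
    as [A1 [HA1 H1]].
  (* Lowering the index by at most [r] costs the factor exp(lam r). *)
  set (A2 := C * exp (lam * INR r)).
  assert (HA2 : 0 <= A2) by (apply Rmult_le_pos; [exact HC|left; apply exp_pos]).
  exists (A1 + A2 * (1 + INR r)). pose proof (pos_INR r) as Hr0.
  assert (Hnn : 0 <= A2 * (1 + INR r)) by nra.
  split; [lra|]. intros k Hk. pose proof (exp_pos (- lam * INR k)) as Hexp.
  destruct (Nat.lt_ge_cases k (S r)) as [Hkr|Hkr].
  - specialize (H1 k Hkr). cbv beta in H1.
    rewrite Rabs_mult, (Rabs_pos_eq (exp _)) in H1 by (left; apply exp_pos).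
    apply (Rmult_le_compat_r (exp (- lam * INR k))) in H1; [|lra].
    rewrite Rmult_assoc, <- exp_plus in H1.
    replace (lam * INR k + - lam * INR k) with 0 in H1 by ring.
    rewrite exp_0, Rmult_1_r in H1. nra.
  - set (e := fun k => cut_mean q r k (fun b => F b - mu * Tk k b)) in *.
    rewrite (renewal_diff q r hq hr drift e drift_0 drift_rec k) by lia.
    eapply Rle_trans; [apply Rabs_triang|].
    assert (He : forall j, (k - r <= j <= k)%nat -> Rabs (e j) <= A2 * exp (- lam * INR k)).
    { intros j Hj. eapply Rle_trans; [apply Hc; lia|]. unfold A2.
      rewrite Rmult_assoc, <- exp_plus. apply Rmult_le_compat_l; [exact HC|]. apply exp_le.
      assert (INR k <= INR j + INR r) by (rewrite <- plus_INR; apply le_INR; lia). nra. }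
    apply Rle_trans with (A2 * exp (- lam * INR k) + INR r * (A2 * exp (- lam * INR k))); [|nra].
    apply Rplus_le_compat; [apply He; lia|].
    eapply Rle_trans; [apply rsum_abs|]. rewrite <- rsum_const. apply rsum_le. intros i Hi.
    rewrite Rabs_mult. rewrite <- (Rmult_1_l (A2 * _)).
    apply Rmult_le_compat; try apply Rabs_pos; [|apply He; lia].
    unfold Rdiv. rewrite Rabs_mult.
    assert (Hi1 : 0 < / INR q <= 1).
    { split; [apply Rinv_0_lt_compat; lra|]. rewrite <- Rinv_1. apply Rinv_le_contravar; lra. }
    assert (Hi2 : 0 < / INR q ^ i <= 1).
    { assert (1 <= INR q ^ i) by (apply pow_R1_Rle; lra).
      split; [apply Rinv_0_lt_compat; lra|]. rewrite <- Rinv_1. apply Rinv_le_contravar; lra. }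
    rewrite (Rabs_left1 (/ INR q - 1)), (Rabs_pos_eq (/ INR q ^ i)) by lra. nra.
Qed.

Lemma drift_lag (A : R) (k m : nat) : 0 <= A ->
  (forall k, (1 <= k)%nat -> Rabs (drift k - drift (k - 1)%nat) <= A * exp (- lam * INR k)) ->
  (m <= k)%nat ->
  Rabs (drift (k - m)%nat - drift k) <= INR m * A * exp (- lam * INR (k - m)).
Proof.
  intros HA H. pose proof (decay_rate_pos q r hq hr) as Hl. induction m as [|m IH]; intros Hm.
  - rewrite Nat.sub_0_r, Rminus_diag, Rabs_R0. simpl. lra.
  - specialize (IH ltac:(lia)). specialize (H (k - m)%nat ltac:(lia)).
    replace (k - m - 1)%nat with (k - S m)%nat in H by lia.
    assert (He : exp (- lam * INR (k - m)) <= exp (- lam * INR (k - S m))).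
    { apply exp_le. assert (INR (k - S m) <= INR (k - m)) by (apply le_INR; lia). nra. }
    replace (drift (k - S m)%nat - drift k) with
      (- (drift (k - m)%nat - drift (k - S m)%nat) + (drift (k - m)%nat - drift k)) by ring.
    eapply Rle_trans; [apply Rabs_triang|]. rewrite Rabs_Ropp, S_INR.
    pose proof (pos_INR m). pose proof (exp_pos (- lam * INR (k - m))).
    assert (0 <= INR m * A) by nra. nra.
Qed.

(** This is the cross term of the second moment; with [drift] merely bounded it would be O(1) at
    every level and accumulate. Since [drift] converges exponentially, [drift (k - min k T)] may be
    replaced by [drift k], which factors out and leaves the nearly vanishing mean of the centered
    reward. *)
Lemma drift_correlation : exists C, 0 <= C /\ forall k, (1 <= k)%nat ->
  Rabs (cut_mean q r k (fun b => (F b - mu * Tk k b) * drift (k - Nat.min k (span q r b))%nat))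
  <= C * exp (- lam * INR k).
Proof.
  destruct centered_cut_mean as [C [HC Hc]]. destruct drift_bounded as [D [HD Hd]].
  destruct drift_diff as [A [HA Hdiff]].
  destruct (cut_mean_exp_bounded q r hq hr) as [M [HM HMk]].
  pose proof (decay_rate_pos q r hq hr) as Hl. pose proof slope_pos as Hs.
  assert (HB : 0 <= slope * A * (/ lam) ^ 2).
  { apply Rmult_le_pos; [nra|apply pow2_ge_0]. }
  exists (slope * A * (/ lam) ^ 2 * M + D * C). split; [nra|].
  intros k Hk.
  set (X := fun b => F b - mu * Tk k b).
  set (dl := fun b => drift (k - Nat.min k (span q r b))%nat).
  change (Rabs (cut_mean q r k (fun b => X b * dl b))
    <= (slope * A * (/ lam) ^ 2 * M + D * C) * exp (- lam * INR k)).
  replace (cut_mean q r k (fun b => X b * dl b)) with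
    (cut_mean q r k (fun b => X b * (dl b - drift k)) + drift k * cut_mean q r k X).
  2:{ rewrite <- (cut_mean_scal q r), <- (cut_mean_plus q r). apply rsum_ext. intros; ring. }
  eapply Rle_trans; [apply Rabs_triang|]. rewrite Rmult_plus_distr_r. apply Rplus_le_compat.
  - eapply Rle_trans; [apply (cut_mean_abs q r hq)|].
    apply Rle_trans with (cut_mean q r k (fun b => slope * A * (/ lam) ^ 2 * exp (- lam * INR k)
      * exp (rate q r * T b))).
    + apply (cut_mean_le q r hq). intros b.
      rewrite Rabs_mult.
      assert (HX : Rabs (X b) <= slope * T b) by (apply centered_step_bound; lia).
      assert (Hdl : Rabs (dl b - drift k) <= T b * A * exp (- lam * INR k) * exp (lam * T b)).
      { eapply Rle_trans; [apply (drift_lag A); [exact HA|exact Hdiff|lia]|].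
        rewrite (Rmult_assoc (T b * A)), <- exp_plus.
        assert (Ht : Tk k b <= T b) by (apply le_INR; lia).
        apply Rmult_le_compat.
        - apply Rmult_le_pos; [apply pos_INR|exact HA].
        - left; apply exp_pos.
        - now apply Rmult_le_compat_r.
        - apply exp_le. rewrite minus_INR by lia. nra. }
      apply Rle_trans with (slope * T b * (T b * A * exp (- lam * INR k) * exp (lam * T b))).
      { apply Rmult_le_compat; try apply Rabs_pos; assumption. }
      pose proof (T2_exp q r hq hr b) as HT2.
      replace (slope * T b * (T b * A * exp (- lam * INR k) * exp (lam * T b))) with
        (slope * A * exp (- lam * INR k) * (T b ^ 2 * exp (lam * T b))) by ring.
      replace (slope * A * (/ lam) ^ 2 * exp (- lam * INR k) * exp (rate q r * T b)) with
        (slope * A * exp (- lam * INR k) * ((/ lam) ^ 2 * exp (rate q r * T b))) by ring.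
      apply Rmult_le_compat_l.
      { apply Rmult_le_pos; [nra|left; apply exp_pos]. }
      apply Rle_trans with ((/ lam) ^ 2 * exp (2 * lam * T b) * exp (lam * T b)).
      { apply Rmult_le_compat_r; [left; apply exp_pos|exact HT2]. }
      rewrite Rmult_assoc, <- exp_plus. apply Rmult_le_compat_l; [apply pow2_ge_0|].
      apply exp_le. pose proof (pos_INR (span q r b)). unfold decay_rate in *. nra.
    + rewrite (cut_mean_scal q r).
      replace (slope * A * (/ lam) ^ 2 * M * exp (- lam * INR k)) with
        (slope * A * (/ lam) ^ 2 * exp (- lam * INR k) * M) by ring.
      apply Rmult_le_compat_l; [|now apply HMk].
      apply Rmult_le_pos; [exact HB|left; apply exp_pos].
  - rewrite Rabs_mult, Rmult_assoc. apply Rmult_le_compat; try apply Rabs_pos; [apply Hd|].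
    now apply Hc.
Qed.

Lemma spread_bounded : exists D, 0 <= D /\ forall k, Rabs (spread k - sigma2 * INR k) <= D.
Proof.
  destruct centered_cut_second as [C1 [HC1 H1]]. destruct drift_correlation as [C2 [HC2 H2]].
  pose proof (decay_rate_pos q r hq hr) as Hl.
  assert (Hy : exp (- lam) < 1) by (rewrite <- exp_0; apply exp_increasing; lra).
  set (C := C1 + 2 * C2). assert (HC : 0 <= C) by (unfold C; lra).
  exists (C * / (1 - exp (- lam))). split.
  { apply Rmult_le_pos; [exact HC|]. left. apply Rinv_0_lt_compat. lra. }
  intros k.
  eapply Rle_trans; [|apply (rsum_exp_decay lam C k Hl HC)].
  rewrite <- Rplus_0_l.
  apply (step_mean_max_principle q r hq hr unit (fun _ k => spread k - sigma2 * INR k) (fun _ _ _ => tt)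
    (fun n => C * exp (- lam * INR n)) 0).
  - intros _. rewrite spread_0. simpl. rewrite Rmult_0_r, Rminus_0_r, Rabs_R0. lra.
  - intros n. apply Rmult_le_pos; [exact HC|left; apply exp_pos].
  - intros _ n Hn. rewrite spread_rec at 1 by exact Hn.
    set (c := cut_mean q r n (fun b => (F b - mu * Tk n b) * drift (n - Nat.min n (span q r b))%nat)).
    replace (_ - sigma2 * INR n) with
      (rsum (fun b => cut_weight q r n b * (spread (n - Nat.min n (span q r b))%nat
          - sigma2 * INR (n - Nat.min n (span q r b)))) (q ^ n)
       + (2 * c + (cut_mean q r n (fun b => (F b - mu * Tk n b) ^ 2)
           - sigma2 * cut_mean q r n (fun b => Tk n b)))).
    2:{ rewrite (rsum_ext (fun b => cut_weight q r n b * (spread _ - _))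
         (fun b => cut_weight q r n b * spread (n - Nat.min n (span q r b))%nat
            - (sigma2 * INR n * cut_weight q r n b - sigma2 * (cut_weight q r n b * Tk n b)))).
        - rewrite !rsum_minus, !rsum_scal, (cut_weight_total q r hq hr n Hn).
          fold (cut_mean q r n (fun b => Tk n b)). ring.
        - intros b _. rewrite minus_INR by lia. ring. }
    eapply Rle_trans; [apply Rabs_triang|]. apply Rplus_le_compat.
    + eapply Rle_trans; [apply rsum_abs|]. apply rsum_le. intros b _.
      rewrite Rabs_mult, (Rabs_pos_eq (cut_weight q r n b)); [lra|now apply cut_weight_nonneg].
    + eapply Rle_trans; [apply Rabs_triang|]. rewrite (Rabs_mult 2), (Rabs_pos_eq 2) by lra.
      specialize (H1 n Hn). specialize (H2 n Hn). fold c in H2. unfold C. lra.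
  - exact tt.
Qed.

Lemma drift_Lmean (k : nat) : drift k = Lmean q f k - mu * INR k.
Proof.
  unfold drift, Lmean. rewrite unif_expect_minus, (unif_expect_const q hq). reflexivity.
Qed.

(** Moving the centre from [mu * INR k] to the true mean subtracts the squared bias. *)
Lemma Lvar_spread (k : nat) : Lvar q f k = spread k - drift k ^ 2.
Proof.
  unfold Lvar, spread.
  rewrite (unif_expect_ext q k _ (fun n => (F n - mu * INR k) ^ 2
     + (- 2 * drift k * (F n - mu * INR k) + drift k ^ 2))).
  2:{ intros n _. rewrite drift_Lmean. ring. }
  rewrite !unif_expect_plus, unif_expect_scal, (unif_expect_const q hq).
  fold (drift k). ring.
Qed.

(** * Sign of the variance constant and its degenerate case *)

Lemma sigma2_nonneg : 0 <= sigma2.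
Proof.
  pose proof (INR_q_ge2 q hq). assert (HY : 0 < INR q ^ r) by (apply pow_lt; lra).
  apply (Rmult_le_reg_r (INR q ^ r)); [exact HY|]. rewrite Rmult_0_l, <- centered_second_moment.
  replace 0 with (Series (fun b => 0 * weight q r b)) by (rewrite Series_scal_l; ring).
  apply Series_le.
  - intros b. split; [lra|]. rewrite Rmult_0_l. apply Rmult_le_pos; [now apply weight_nonneg|apply pow2_ge_0].
  - apply (ex_step_mean_quad q r hq hr _ (slope ^ 2)); [apply pow2_ge_0|].
    intros b. apply sq_bound; [left; apply slope_pos|]. now apply centered_step_bound.
Qed.

Lemma sigma2_zero_trivial : sigma2 = 0 -> forall n, f n = 1.
Proof.
  intros H0.
  assert (HG : forall b, weight q r b * (F b - mu * T b) ^ 2 = 0).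
  { assert (Hnn : forall b, 0 <= weight q r b * (F b - mu * T b) ^ 2).
    { intros b. apply Rmult_le_pos; [now apply weight_nonneg|apply pow2_ge_0]. }
    assert (HL : is_lim_seq (rsum (fun b => weight q r b * (F b - mu * T b) ^ 2)) 0).
    { apply is_series_rsum. replace 0 with (step_mean q r (fun b => (F b - mu * T b) ^ 2)).
      - apply Series_correct, (ex_step_mean_quad q r hq hr _ (slope ^ 2)); [apply pow2_ge_0|].
        intros b. apply sq_bound; [left; apply slope_pos|]. now apply centered_step_bound.
      - rewrite centered_second_moment, H0. ring. }
    intros b. apply Rle_antisym; [|apply Hnn].
    apply Rle_trans with (rsum (fun b => weight q r b * (F b - mu * T b) ^ 2) (S b)).
    - cbn [rsum].
      assert (0 <= rsum (fun b => weight q r b * (F b - mu * T b) ^ 2) b)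
        by (apply rsum_nonneg; intros; apply Hnn). lra.
    - apply (is_lim_seq_incr_compare _ _ HL). intros n. cbn [rsum]. specialize (Hnn n). lra. }
  pose proof (INR_q_ge2 q hq) as Hq.
  assert (Hatom : forall b, is_atom q r b = true -> F b = mu * T b).
  { intros b Hb. specialize (HG b). unfold weight in HG. rewrite Hb in HG.
    apply Rmult_integral in HG. destruct HG as [HG|HG].
    - exfalso. revert HG. apply Rinv_neq_0_compat, pow_nonzero. lra.
    - replace ((F b - mu * T b) ^ 2) with (Rsqr (F b - mu * T b)) in HG by (unfold Rsqr; ring).
      apply Rsqr_0_uniq in HG. lra. }
  assert (Hmu : mu = 0).
  { specialize (Hatom 0%nat eq_refl). rewrite (ln_f_zero q r f hq hpos hqm) in Hatom.
    change (span q r 0) with 1%nat in Hatom. simpl in Hatom. lra. }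
  assert (HFatom : forall b, is_atom q r b = true -> f b = 1).
  { intros b Hb. specialize (Hatom b Hb). rewrite Hmu, Rmult_0_l in Hatom.
    rewrite <- (exp_ln (f b)) by apply hpos. rewrite Hatom. apply exp_0. }
  intros n. induction n as [n IH] using lt_wf_ind.
  destruct (parse_exists q hq r hr n) as [a [b [Hb E]]].
  rewrite E, (f_step q r f hq hpos hqm), (HFatom b Hb), Rmult_1_r.
  destruct (Nat.eq_dec a 0) as [->|Ha]; [now apply (f_zero q r f hq hpos hqm)|].
  apply IH. rewrite E.
  assert (2 <= q ^ span q r b)%nat.
  { pose proof (span_pos q hq r hr b). rewrite <- (Nat.pow_1_r 2).
    transitivity (q ^ 1)%nat; [rewrite !Nat.pow_1_r; lia|]. apply Nat.pow_le_mono_r; lia. }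
  nia.
Qed.

(* Uniform in the phase [a]: the recursion shifts the phase at each step. *)
Lemma char_function_bound : 0 < sigma2 -> exists C th0, 0 <= C /\ 0 < th0 /\
  forall th a k, Rabs th <= th0 ->
  Rabs (unif_expect q k (fun n => cos (a + th * (F n - mu * INR k)))
        - exp (- (sigma2 * th ^ 2 / 2) * INR k) * cos a)
  <= C * Rabs th + C * INR k * Rabs th ^ 3.
Proof.
  intros Hsig.
  destruct centered_cut_mean as [C1 [HC1 H1]]. destruct centered_cut_second as [C2 [HC2 H2]].
  destruct (cut_mean_exp_bounded q r hq hr) as [M [HM HMk]].
  pose proof (decay_rate_pos q r hq hr) as Hl. pose proof slope_pos as Hs.
  assert (Hy : exp (- lam) < 1) by (rewrite <- exp_0; apply exp_increasing; lra).
  (* Collects the coefficients of |th|^3 T^3 in the three remainders of [exp_cos_taylor] with y = th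
     X and s = v T. *)
  set (R0 := 2 * slope ^ 3 + sigma2 * slope + sigma2 ^ 2).
  assert (HR0 : 0 <= R0).
  { unfold R0. assert (0 <= slope ^ 3) by (apply pow_le; lra). pose proof (pow2_ge_0 sigma2). nra. }
  set (R1 := R0 * (/ lam) ^ 3).
  assert (HR1 : 0 <= R1).
  { apply Rmult_le_pos; [exact HR0|]. left. apply inv_decay_rate_pow_pos; assumption. }
  (* |th| <= 1 allows lowering powers of th, and sigma2 |th| <= lam gives v <= lam, which keeps
     exp(v T) within the exponential moments. *)
  set (th0 := Rmin 1 (lam / sigma2)).
  assert (Hth0 : 0 < th0) by (apply Rmin_pos; [lra|now apply Rdiv_lt_0_compat]).
  set (A := C1 + C2). set (B := R1 * M).
  assert (HA : 0 <= A) by (unfold A; lra). assert (HB : 0 <= B) by now apply Rmult_le_pos.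
  assert (HinvA : 0 <= A * / (1 - exp (- lam))).
  { apply Rmult_le_pos; [exact HA|]. left. apply Rinv_0_lt_compat. lra. }
  exists (A * / (1 - exp (- lam)) + B), th0. split; [lra|]. split; [exact Hth0|].
  intros th a k Hth.
  assert (Hth1 : Rabs th <= 1) by (eapply Rle_trans; [exact Hth|apply Rmin_l]).
  assert (Hth2 : Rabs th <= lam / sigma2) by (eapply Rle_trans; [exact Hth|apply Rmin_r]).
  pose proof (Rabs_pos th) as Hthp.
  set (v := sigma2 * th ^ 2 / 2).
  assert (Eth : th ^ 2 = Rabs th ^ 2) by (symmetry; apply pow2_abs).
  assert (Hsth : sigma2 * Rabs th <= lam).
  { apply (Rmult_le_compat_l sigma2) in Hth2; [|lra].
    replace (sigma2 * (lam / sigma2)) with lam in Hth2 by (field; lra). exact Hth2. }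
  assert (Hv : 0 <= v <= lam).
  { unfold v. rewrite Eth. split; [nra|]. nra. }
  apply Rle_trans with (0 + rsum (fun n => A * Rabs th * exp (- lam * INR (S n)) + B * Rabs th ^ 3) k).
  2:{ rewrite rsum_plus, rsum_const, Rplus_0_l.
      pose proof (rsum_exp_decay lam (A * Rabs th) k Hl ltac:(nra)) as HE.
      assert (0 <= Rabs th ^ 3) by (apply pow_le; exact Hthp). pose proof (pos_INR k).
      assert (0 <= INR k * Rabs th ^ 3) by nra.
      assert (0 <= A * / (1 - exp (- lam)) * (INR k * Rabs th ^ 3)) by nra.
      assert (0 <= B * Rabs th) by nra.
      nra. }
  apply (step_mean_max_principle q r hq hr R
    (fun a k => unif_expect q k (fun n => cos (a + th * (F n - mu * INR k))) - exp (- v * INR k) * cos a)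
    (fun a k b => a + th * (F b - mu * Tk k b))
    (fun n => A * Rabs th * exp (- lam * INR n) + B * Rabs th ^ 3) 0).
  - intros a'. rewrite unif_expect_0, (ln_f_zero q r f hq hpos hqm). simpl INR.
    rewrite !Rmult_0_r, Rminus_0_r, Rmult_0_r, Rplus_0_r, exp_0, Rmult_1_l, Rminus_diag, Rabs_R0. lra.
  - intros n. pose proof (exp_pos (- lam * INR n)).
    assert (0 <= Rabs th ^ 3) by (apply pow_le; exact Hthp).
    assert (0 <= A * Rabs th) by nra. nra.
  - clear a k. intros a k Hk.
    rewrite (centered_rec (fun x => cos (a + th * x))) by exact Hk.
    set (X := fun b => F b - mu * Tk k b).
    set (j := fun b => (k - Nat.min k (span q r b))%nat).
    set (E := fun b => unif_expect q (j b) (fun n => cos (a + th * X b + th * (F n - mu * INR (j b))))).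
    (* The error splits into the errors at the remaining lengths, with shifted phases, and the
       one-step defect E exp(v T) cos(a + th X) - cos a, from which exp(-v k) is pulled out. *)
    replace (cut_mean q r k _ - _) with
      (rsum (fun b => cut_weight q r k b * (E b - exp (- v * INR (j b)) * cos (a + th * X b))) (q ^ k)
       + exp (- v * INR k) * (cut_mean q r k (fun b => exp (v * Tk k b) * cos (a + th * X b)) - cos a)).
    2:{ rewrite Rmult_minus_distr_l, <- (cut_mean_scal q r). unfold cut_mean.
        replace (rsum (fun b => cut_weight q r k b * (E b - exp (- v * INR (j b)) * cos (a + th * X b))) (q ^ k)
          + (rsum (fun b => cut_weight q r k b * (exp (- v * INR k) * (exp (v * Tk k b) * cos (a + th * X b)))) (q ^ k)
          - exp (- v * INR k) * cos a))
        with (rsum (fun b => cut_weight q r k b * (E b - exp (- v * INR (j b)) * cos (a + th * X b))) (q ^ k)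
          + rsum (fun b => cut_weight q r k b * (exp (- v * INR k) * (exp (v * Tk k b) * cos (a + th * X b)))) (q ^ k)
          - exp (- v * INR k) * cos a) by ring.
        f_equal. rewrite <- rsum_plus. apply rsum_ext. intros b _.
        rewrite <- (Rmult_assoc (exp (- v * INR k))), <- exp_plus.
        replace (- v * INR k + v * Tk k b) with (- v * INR (j b))
          by (unfold j; rewrite minus_INR by lia; ring).
        replace (unif_expect q (k - Nat.min k (span q r b)) _) with (E b); [ring|].
        unfold E. apply unif_expect_ext. intros n _. f_equal. unfold X. fold (j b). ring. }
    eapply Rle_trans; [apply Rabs_triang|]. apply Rplus_le_compat.
    + eapply Rle_trans; [apply rsum_abs|]. apply rsum_le. intros b _.
      rewrite Rabs_mult, (Rabs_pos_eq (cut_weight q r k b)) by now apply cut_weight_nonneg.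
      apply Rmult_le_compat_l; [now apply cut_weight_nonneg|]. right. reflexivity.
    + rewrite Rabs_mult, (Rabs_pos_eq (exp _)) by (left; apply exp_pos).
      rewrite <- (Rmult_1_l (A * Rabs th * _ + _)).
      apply Rmult_le_compat; [left; apply exp_pos|apply Rabs_pos| |].
      { rewrite <- exp_0. apply exp_le. pose proof (pos_INR k). nra. }
      (* The Taylor polynomial of second order in th. The choice of [v] makes its quadratic part
         cancel in mean, because E X^2 = sigma2 E T. *)
      set (P := fun b => cos a - th * X b * sin a + (v * Tk k b - (th * X b) ^ 2 / 2) * cos a).
      set (Rm := fun b => exp (v * Tk k b) * cos (a + th * X b) - P b).
      assert (HRm : forall b, Rabs (Rm b) <= Rabs th ^ 3 * R1 * exp (rate q r * T b)).
      { intros b. unfold Rm, P.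
        assert (HT1 := T_ge1 q r hq hr b).
        assert (Ht : 0 <= Tk k b <= T b) by (split; [apply pos_INR|apply le_INR; lia]).
        eapply Rle_trans; [apply exp_cos_taylor; nra|].
        assert (HX : Rabs (X b) <= slope * T b) by (apply centered_step_bound; lia).
        assert (Hy1 : Rabs (th * X b) <= Rabs th * (slope * T b)).
        { rewrite Rabs_mult. now apply Rmult_le_compat_l. }
        assert (Hvt : v * Tk k b <= sigma2 * Rabs th ^ 2 / 2 * T b).
        { rewrite <- Eth. fold v. apply Rmult_le_compat_l; lra. }
        assert (Hvt0 : 0 <= v * Tk k b) by nra.
        assert (Hexp1 : 1 <= exp (lam * T b)) by (rewrite <- exp_0; apply exp_le; nra).
        assert (Hexpv : exp (v * Tk k b) <= exp (lam * T b)) by (apply exp_le; nra).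
        set (t := T b) in *. set (h := Rabs th) in *. set (ee := exp (lam * t)) in *.
        assert (Z1 : 2 * Rabs (th * X b) ^ 3 <= h ^ 3 * (2 * slope ^ 3) * t ^ 3 * ee).
        { apply Rle_trans with (2 * (h * (slope * t)) ^ 3).
          - apply Rmult_le_compat_l; [lra|]. apply pow_incr. split; [apply Rabs_pos|exact Hy1].
          - replace (2 * (h * (slope * t)) ^ 3) with (h ^ 3 * (2 * slope ^ 3) * t ^ 3 * 1) by ring.
            apply Rmult_le_compat_l; [|exact Hexp1].
            repeat apply Rmult_le_pos; try apply pow_le; lra. }
        assert (Z2 : 2 * (v * Tk k b) * Rabs (th * X b) <= h ^ 3 * (sigma2 * slope) * t ^ 3 * ee).
        { apply Rle_trans with (2 * (sigma2 * h ^ 2 / 2 * t) * (h * (slope * t))).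
          - apply Rmult_le_compat; [lra|apply Rabs_pos|lra|exact Hy1].
          - replace (2 * (sigma2 * h ^ 2 / 2 * t) * (h * (slope * t)))
              with (h ^ 3 * (sigma2 * slope) * (t ^ 2 * 1)) by field.
            rewrite (Rmult_assoc _ (t ^ 3)).
            apply Rmult_le_compat_l.
            + apply Rmult_le_pos; [apply pow_le; exact Hthp|nra].
            + apply Rmult_le_compat; [apply pow2_ge_0|lra| |exact Hexp1].
              apply Rle_pow; [exact HT1|lia]. }
        assert (Z3 : (v * Tk k b) ^ 2 * exp (v * Tk k b) <= h ^ 3 * sigma2 ^ 2 * t ^ 3 * ee).
        { apply Rmult_le_compat; [apply pow2_ge_0|left; apply exp_pos| |exact Hexpv].
          apply Rle_trans with ((sigma2 * h ^ 2 / 2 * t) ^ 2).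
          - apply pow_incr. split; assumption.
          - replace ((sigma2 * h ^ 2 / 2 * t) ^ 2) with (h ^ 3 * sigma2 ^ 2 * (h / 4 * t ^ 2)) by field.
            apply Rmult_le_compat_l.
            + apply Rmult_le_pos; [apply pow_le; exact Hthp|apply pow2_ge_0].
            + assert (t ^ 2 <= t ^ 3) by (apply Rle_pow; [exact HT1|lia]).
              assert (0 <= t ^ 2) by apply pow2_ge_0. nra. }
        apply Rle_trans with (h ^ 3 * R0 * (t ^ 3 * ee)).
        { unfold R0. nra. }
        unfold R1. rewrite <- !Rmult_assoc. rewrite (Rmult_assoc (h ^ 3 * R0)).
        rewrite (Rmult_assoc (h ^ 3 * R0)).
        apply Rmult_le_compat_l; [apply Rmult_le_pos; [apply pow_le; exact Hthp|exact HR0]|].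
        apply Rle_trans with ((/ lam) ^ 3 * exp (INR 3 * lam * t) * ee).
        { apply Rmult_le_compat_r; [left; apply exp_pos|]. apply T_pow_exp; assumption. }
        unfold ee. rewrite Rmult_assoc, <- exp_plus.
        apply Rmult_le_compat_l; [left; apply inv_decay_rate_pow_pos; assumption|].
        apply exp_le. simpl INR. unfold decay_rate in *. nra. }
      replace (cut_mean q r k (fun b => exp (v * Tk k b) * cos (a + th * X b)) - cos a) with
        (- (th * sin a) * cut_mean q r k X
         + (- (th ^ 2 / 2 * cos a) * (cut_mean q r k (fun b => X b ^ 2) - sigma2 * cut_mean q r k (fun b => Tk k b))
         + cut_mean q r k Rm)).
      2:{ transitivity (cut_mean q r k (fun b => exp (v * Tk k b) * cos (a + th * X b))
            - cut_mean q r k (fun _ => cos a)).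
          2:{ now rewrite (cut_mean_const q r hq hr k (cos a) Hk). }
          rewrite <- !(cut_mean_scal q r), <- !(cut_mean_minus q r), <- !(cut_mean_scal q r),
            <- !(cut_mean_plus q r).
          apply rsum_ext. intros b _. unfold Rm, P, v. field. }
      eapply Rle_trans; [apply Rabs_triang|].
      eapply Rle_trans; [apply Rplus_le_compat_l, Rabs_triang|].
      specialize (H1 k Hk). specialize (H2 k Hk). fold X in H1. 
      rewrite !Rabs_mult, !Rabs_Ropp, !Rabs_mult.
      assert (Hc : Rabs (cos a) <= 1) by (apply Rabs_le, COS_bound).
      assert (Hsn : Rabs (sin a) <= 1) by (apply Rabs_le, SIN_bound).
      pose proof (exp_pos (- lam * INR k)) as Hek.
      set (ek := exp (- lam * INR k)) in *.
      assert (W1 : Rabs th * Rabs (sin a) * Rabs (cut_mean q r k X) <= Rabs th * (C1 * ek)).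
      { rewrite Rmult_assoc. apply Rmult_le_compat_l; [exact Hthp|].
        rewrite <- (Rmult_1_l (C1 * ek)). apply Rmult_le_compat; try apply Rabs_pos; assumption. }
      assert (W2 : Rabs (th ^ 2 / 2) * Rabs (cos a) *
        Rabs (cut_mean q r k (fun b => X b ^ 2) - sigma2 * cut_mean q r k (fun b => Tk k b))
        <= Rabs th * (C2 * ek)).
      { apply Rmult_le_compat; [apply Rmult_le_pos; apply Rabs_pos|apply Rabs_pos| |exact H2].
        rewrite Rabs_pos_eq by (pose proof (pow2_ge_0 th); lra). rewrite Eth.
        pose proof (Rabs_pos (cos a)). nra. }
      assert (W3 : Rabs (cut_mean q r k Rm) <= B * Rabs th ^ 3).
      { eapply Rle_trans; [apply (cut_mean_abs q r hq)|].
        eapply Rle_trans; [apply (cut_mean_le q r hq); exact HRm|].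
        rewrite (cut_mean_scal q r). unfold B.
        replace (R1 * M * Rabs th ^ 3) with (Rabs th ^ 3 * R1 * M) by ring.
        apply Rmult_le_compat_l; [|now apply HMk].
        apply Rmult_le_pos; [apply pow_le; exact Hthp|exact HR1]. }
      unfold A. lra.
Qed.

End Asymptotics.

(** * The Gaussian integral *)

Lemma ex_RInt_of_continuous (g : R -> R) (a b : R) : (forall x, continuous g x) -> ex_RInt g a b.
Proof. intros H. apply (ex_RInt_continuous (V := R_CompleteNormedModule)). intros; apply H. Qed.

Lemma RInt_mult_l (g : R -> R) (a b c : R) : ex_RInt g a b ->
  c * RInt g a b = RInt (fun x => c * g x) a b.
Proof. intros H. symmetry. exact (RInt_scal (V := R_CompleteNormedModule) g a b c H). Qed.

Lemma continuous_of_ex_derive (g : R -> R) (x : R) : ex_derive g x -> continuous g x.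
Proof. apply (ex_derive_continuous (V := R_NormedModule)). Qed.

Lemma is_derive_RInt_quadratic (g : R -> R -> R) (dg : R -> R) (a b t d M : R) :
  a <= b -> 0 < d ->
  (forall s x, continuous (g s) x) -> (forall x, continuous dg x) ->
  (forall s x, Rabs (s - t) < d -> a <= x <= b ->
     Rabs (g s x - g t x - dg x * (s - t)) <= M * (s - t) ^ 2) ->
  is_derive (fun s => RInt (g s) a b) t (RInt dg a b).
Proof.
  intros Hab Hd Hg Hdg HM.
  apply (is_derive_quadratic _ _ _ ((b - a) * M) d Hd). intros s Hs.
  assert (E1 : forall s, ex_RInt (g s) a b) by (intros; now apply ex_RInt_of_continuous).
  assert (E2 : ex_RInt dg a b) by now apply ex_RInt_of_continuous.
  assert (E3 : is_RInt (fun x => (g s x - g t x) - (s - t) * dg x) a b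
    (RInt (g s) a b - RInt (g t) a b - RInt dg a b * (s - t))).
  { rewrite (Rmult_comm (RInt dg a b)).
    apply (is_RInt_minus (V := R_NormedModule)).
    - apply (is_RInt_minus (V := R_NormedModule)); apply (RInt_correct (V := R_CompleteNormedModule)), E1.
    - apply (is_RInt_scal (V := R_NormedModule)). now apply (RInt_correct (V := R_CompleteNormedModule)). }
  rewrite <- (is_RInt_unique (V := R_CompleteNormedModule) _ _ _ _ E3).
  rewrite Rmult_assoc. apply abs_RInt_le_const; [exact Hab|eexists; exact E3|].
  intros x Hx. rewrite (Rmult_comm (s - t)). now apply HM.
Qed.

(** * Total mass of the bell curve with explicit tails *)

Definition bell (x : R) : R := exp (- x ^ 2 / 2).

Lemma bell_pos (x : R) : 0 < bell x.
Proof. apply exp_pos. Qed.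

Lemma bell_derive (x : R) : is_derive bell x (- x * bell x).
Proof.
  unfold bell. auto_derive; [exact I|].
  change (- (x * (x * 1)) * / 2) with (- x ^ 2 / 2). field.
Qed.

Lemma bell_continuous (x : R) : continuous bell x.
Proof. apply continuous_of_ex_derive. eexists; apply bell_derive. Qed.

Lemma bell_le1 (x : R) : bell x <= 1.
Proof. rewrite <- exp_0. apply exp_le. pose proof (pow2_ge_0 x). lra. Qed.

Lemma bell_vanishes (eps : R) : 0 < eps -> exists A, 0 < A /\ forall x, A < Rabs x -> bell x < eps.
Proof.
  intros He. exists (1 + 2 / eps). assert (0 < 2 / eps) by (apply Rdiv_lt_0_compat; lra).
  split; [lra|]. intros x Hx.
  assert (H1 : 1 + x ^ 2 / 2 <= / bell x).
  { unfold bell. rewrite <- exp_Ropp. replace (- (- x ^ 2 / 2)) with (x ^ 2 / 2) by field.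
    apply exp_ineq1_le. }
  assert (H2 : 1 + x ^ 2 / 2 > / eps).
  { rewrite <- (pow2_abs x). set (y := Rabs x) in *.
    replace (2 / eps) with (2 * / eps) in * by reflexivity. nra. }
  rewrite <- (Rinv_inv (bell x)), <- (Rinv_inv eps). apply Rinv_lt_contravar; [|lra].
  apply Rmult_lt_0_compat; apply Rinv_0_lt_compat; [exact He|apply bell_pos].
Qed.

Definition half_bell (t : R) : R := RInt bell 0 t.
(** The auxiliary integral of the parameter-differentiation proof of the Gaussian integral: it is
    arctan 1 at s = 0 and at most [bell t] at s = t^2 / 2. *)
Definition arctan_bell (s : R) : R := RInt (fun x => exp (- s * (1 + x ^ 2)) / (1 + x ^ 2)) 0 1.

Lemma one_plus_sq_pos (x : R) : 0 < 1 + x ^ 2.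
Proof. pose proof (pow2_ge_0 x). lra. Qed.

Lemma arctan_bell_derive (s : R) :
  is_derive arctan_bell s (RInt (fun x => - exp (- s * (1 + x ^ 2))) 0 1).
Proof.
  apply (is_derive_RInt_quadratic (fun s x => exp (- s * (1 + x ^ 2)) / (1 + x ^ 2)) _ 0 1 s 1
    (exp (2 * Rabs s + 2) * 4)); [lra|lra| | |].
  - intros u x. apply continuous_of_ex_derive. auto_derive. pose proof (one_plus_sq_pos x). simpl in *. lra.
  - intros x. apply continuous_of_ex_derive. auto_derive. exact I.
  - intros u x Hu Hx. set (w := 1 + x ^ 2).
    assert (Hw : 1 <= w <= 2) by (unfold w; nra).
    set (y := - (u - s) * w).
    replace (- u * w) with (- s * w + y) by (unfold y; ring).
    rewrite exp_plus.
    replace (exp (- s * w) * exp y / w - exp (- s * w) / w - - exp (- s * w) * (u - s))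
      with (exp (- s * w) * (exp y - 1 - y) / w) by (unfold y; field; lra).
    unfold Rdiv. rewrite !Rabs_mult, (Rabs_pos_eq (exp _)) by (left; apply exp_pos).
    rewrite (Rabs_pos_eq (/ w)) by (left; apply Rinv_0_lt_compat; lra).
    assert (Hy : Rabs y <= 2 * Rabs (u - s)).
    { unfold y. rewrite Rabs_mult, Rabs_Ropp, (Rabs_pos_eq w) by lra.
      pose proof (Rabs_pos (u - s)). nra. }
    assert (Hy2 : y ^ 2 <= 4 * (u - s) ^ 2).
    { rewrite <- (pow2_abs y), <- (pow2_abs (u - s)). pose proof (Rabs_pos y). nra. }
    apply Rle_trans with (exp (- s * w) * (4 * (u - s) ^ 2 * exp (Rabs y))).
    + rewrite <- (Rmult_1_r (exp (- s * w) * (4 * (u - s) ^ 2 * exp (Rabs y)))).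
      apply Rmult_le_compat.
      * apply Rmult_le_pos; [left; apply exp_pos|apply Rabs_pos].
      * left; apply Rinv_0_lt_compat; lra.
      * apply Rmult_le_compat_l; [left; apply exp_pos|].
        eapply Rle_trans; [apply exp_taylor1|]. apply Rmult_le_compat_r; [left; apply exp_pos|exact Hy2].
      * rewrite <- Rinv_1. apply Rinv_le_contravar; lra.
    + replace (exp (- s * w) * (4 * (u - s) ^ 2 * exp (Rabs y))) with
        (exp (- s * w) * exp (Rabs y) * 4 * (u - s) ^ 2) by ring.
      apply Rmult_le_compat_r; [apply pow2_ge_0|]. apply Rmult_le_compat_r; [lra|].
      rewrite <- exp_plus. apply exp_le.
      assert (- s * w <= 2 * Rabs s).
      { pose proof (Rle_abs (- s)) as H. rewrite Rabs_Ropp in H. pose proof (Rabs_pos s). nra. }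
      lra.
Qed.

Lemma half_bell_derive (t : R) : is_derive half_bell t (bell t).
Proof.
  apply (is_derive_RInt (V := R_NormedModule) bell half_bell 0).
  - apply filter_forall. intros x. apply (RInt_correct (V := R_CompleteNormedModule)).
    apply ex_RInt_of_continuous, bell_continuous.
  - apply bell_continuous.
Qed.

Lemma half_bell_scaled (t : R) : half_bell t = RInt (fun x => t * bell (t * x)) 0 1.
Proof.
  assert (Ex : ex_RInt bell (t * 0 + 0) (t * 1 + 0)) by apply ex_RInt_of_continuous, bell_continuous.
  pose proof (RInt_comp_lin (V := R_CompleteNormedModule) bell t 0 0 1 Ex) as E.
  rewrite Rmult_0_r, Rmult_1_r, !Rplus_0_r in E. unfold half_bell. rewrite <- E.
  apply RInt_ext. intros x _. unfold scal; simpl; unfold mult; simpl. now rewrite Rplus_0_r.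
Qed.

(* Both terms have opposite derivatives, since
   [bell t * bell (t * x) = exp (- (t^2/2) * (1 + x^2))]. *)
Lemma half_bell_sq (t : R) : half_bell t ^ 2 / 2 + arctan_bell (t ^ 2 / 2) = PI / 4.
Proof.
  set (g := fun t => half_bell t ^ 2 / 2 + arctan_bell (t ^ 2 / 2) - PI / 4).
  cut (Rabs (g t) <= 0 * Rabs t).
  { intros H. rewrite Rmult_0_l in H. pose proof (Rabs_pos (g t)) as Hp.
    assert (E : g t = 0) by (apply Rabs_eq_0; lra). unfold g in E. lra. }
  apply (mean_value_bound g (fun _ => 0)).
  - intros x. unfold g.
    assert (D1 : is_derive (fun t => arctan_bell (t ^ 2 / 2)) x
      (x * RInt (fun y => - exp (- (x ^ 2 / 2) * (1 + y ^ 2))) 0 1)).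
    { apply (is_derive_comp arctan_bell (fun t => t ^ 2 / 2)); [apply arctan_bell_derive|].
      auto_derive; [exact I|field]. }
    assert (D2 : is_derive (fun t => half_bell t ^ 2 / 2) x (half_bell x * bell x)).
    { pose proof (half_bell_derive x) as Hh. auto_derive.
      - eexists; exact Hh.
      - replace (Derive (fun x0 => half_bell x0) x) with (bell x) by (symmetry; now apply is_derive_unique). field. }
    replace 0 with (half_bell x * bell x + x * RInt (fun y => - exp (- (x ^ 2 / 2) * (1 + y ^ 2))) 0 1 - 0).
    + apply (is_derive_minus (V := R_NormedModule)).
      * apply (is_derive_plus (V := R_NormedModule)); assumption.
      * apply (is_derive_const (V := R_NormedModule)).
    + rewrite half_bell_scaled.
      assert (E : x * RInt (fun y => - exp (- (x ^ 2 / 2) * (1 + y ^ 2))) 0 1 =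
        - bell x * RInt (fun y => x * bell (x * y)) 0 1).
      { assert (Ex1 : ex_RInt (fun y => - exp (- (x ^ 2 / 2) * (1 + y ^ 2))) 0 1).
        { apply ex_RInt_of_continuous. intros y. apply continuous_of_ex_derive. auto_derive. exact I. }
        assert (Ex2 : ex_RInt (fun y => x * bell (x * y)) 0 1).
        { apply ex_RInt_of_continuous. intros y. apply continuous_of_ex_derive. unfold bell. auto_derive. exact I. }
        rewrite (RInt_mult_l _ 0 1 x Ex1), (RInt_mult_l _ 0 1 (- bell x) Ex2).
        apply RInt_ext. intros y _.
        replace (exp (- (x ^ 2 / 2) * (1 + y ^ 2))) with (bell x * bell (x * y)).
        - apply Rminus_diag_uniq. ring.
        - unfold bell. rewrite <- exp_plus. f_equal. field. }
      rewrite E. ring.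
  - unfold g, half_bell. rewrite (RInt_point (V := R_CompleteNormedModule)).
    assert (E : arctan_bell (0 ^ 2 / 2) = PI / 4).
    { unfold arctan_bell. rewrite <- atan_1.
      apply (is_RInt_unique (V := R_CompleteNormedModule)).
      replace (atan 1) with (minus (atan 1) (atan 0)).
      2:{ rewrite atan_0. unfold minus, plus, opp; simpl. ring. }
      apply (is_RInt_derive (V := R_CompleteNormedModule) atan).
      - intros x _. replace (exp _ / _) with (/ (1 + x ^ 2)).
        + apply is_derive_Reals, derivable_pt_lim_atan.
        + replace (- (0 ^ 2 / 2) * (1 + x ^ 2)) with 0 by field. rewrite exp_0. unfold Rdiv; ring.
      - intros x _. apply continuous_of_ex_derive. auto_derive. pose proof (one_plus_sq_pos x).
        simpl in *. lra. }
    rewrite E. change (@zero R_CompleteNormedModule) with 0. unfold zero; simpl. field.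
  - intros x _. rewrite Rabs_R0. lra.
Qed.

Lemma arctan_bell_bounds (t : R) : 0 <= arctan_bell (t ^ 2 / 2) <= bell t.
Proof.
  unfold arctan_bell.
  assert (Hc : ex_RInt (fun x => exp (- (t ^ 2 / 2) * (1 + x ^ 2)) / (1 + x ^ 2)) 0 1).
  { apply ex_RInt_of_continuous. intros x. apply continuous_of_ex_derive. auto_derive.
    pose proof (one_plus_sq_pos x). simpl in *. lra. }
  assert (Hb : forall x, 0 <= exp (- (t ^ 2 / 2) * (1 + x ^ 2)) / (1 + x ^ 2) <= bell t).
  { intros x. pose proof (one_plus_sq_pos x). pose proof (pow2_ge_0 x). pose proof (pow2_ge_0 t). split.
    - left. apply Rdiv_lt_0_compat; [apply exp_pos|assumption].
    - apply Rle_trans with (exp (- (t ^ 2 / 2) * (1 + x ^ 2)) / 1).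
      + unfold Rdiv. apply Rmult_le_compat_l; [left; apply exp_pos|]. apply Rinv_le_contravar; lra.
      + rewrite Rdiv_1_r. apply exp_le. nra. }
  split.
  - apply RInt_ge_0; [lra|exact Hc|]. intros x _. apply Hb.
  - replace (bell t) with (RInt (fun _ => bell t) 0 1).
    + apply RInt_le; [lra|exact Hc|apply ex_RInt_const|]. intros x _. apply Hb.
    + rewrite RInt_const. unfold scal; simpl; unfold mult; simpl. ring.
Qed.

Lemma half_bell_sign (t : R) : 0 <= t -> 0 <= half_bell t.
Proof.
  intros Ht. apply RInt_ge_0; [exact Ht|apply ex_RInt_of_continuous, bell_continuous|].
  intros x _. left; apply bell_pos.
Qed.

Lemma half_bell_neg (t : R) : t <= 0 -> half_bell t <= 0.
Proof.
  intros Ht. unfold half_bell. rewrite <- (opp_RInt_swap (V := R_CompleteNormedModule)).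
  2:{ apply ex_RInt_of_continuous, bell_continuous. }
  assert (0 <= RInt bell t 0).
  { apply RInt_ge_0; [exact Ht|apply ex_RInt_of_continuous, bell_continuous|].
    intros x _. left; apply bell_pos. }
  unfold opp; simpl. lra.
Qed.

Lemma sqrt_2PI : sqrt (2 * PI) = 2 * sqrt (PI / 2) /\ 1 <= sqrt (PI / 2).
Proof.
  pose proof PI2_1. split.
  - replace (2 * PI) with (2 * 2 * (PI / 2)) by field. rewrite sqrt_mult by lra.
    rewrite sqrt_square by lra. reflexivity.
  - rewrite <- sqrt_1. apply sqrt_le_1; lra.
Qed.

(** (s - h)(s + h) = 2 e with s + h >= 1. This turns the identity for the square of [half_bell] into
    a tail bound. *)
Lemma close_roots (h s e : R) : 0 <= h -> 1 <= s -> 0 <= e -> h ^ 2 / 2 + e = s ^ 2 / 2 -> Rabs (h - s) <= 2 * e.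
Proof.
  intros Hh Hs He E. assert ((s - h) * (s + h) = 2 * e) by lra.
  assert (0 <= s - h) by nra. rewrite Rabs_minus_sym, Rabs_pos_eq by lra. nra.
Qed.

Lemma bell_integral (a b : R) : a <= 0 -> 0 <= b ->
  Rabs (RInt bell a b - sqrt (2 * PI)) <= 2 * (bell a + bell b).
Proof.
  intros Ha Hb. destruct sqrt_2PI as [E Hs]. rewrite E.
  assert (Es : sqrt (PI / 2) ^ 2 / 2 = PI / 4).
  { rewrite <- Rsqr_pow2, Rsqr_sqrt; [field|]. pose proof PI2_1. lra. }
  set (s := sqrt (PI / 2)) in *.
  assert (Hint : RInt bell a b = half_bell b - half_bell a).
  { unfold half_bell. rewrite <- (RInt_Chasles (V := R_CompleteNormedModule) bell a 0 b)
      by (apply ex_RInt_of_continuous, bell_continuous).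
    rewrite <- (opp_RInt_swap (V := R_CompleteNormedModule) bell 0 a)
      by (apply ex_RInt_of_continuous, bell_continuous).
    unfold plus, opp; simpl. ring. }
  rewrite Hint.
  pose proof (half_bell_sq a) as Sa. pose proof (half_bell_sq b) as Sb.
  pose proof (arctan_bell_bounds a) as Ba. pose proof (arctan_bell_bounds b) as Bb.
  assert (Cb : Rabs (half_bell b - s) <= 2 * arctan_bell (b ^ 2 / 2)).
  { apply close_roots; try lra; [now apply half_bell_sign]. }
  assert (Ca : Rabs (- half_bell a - s) <= 2 * arctan_bell (a ^ 2 / 2)).
  { pose proof (half_bell_neg a Ha). apply close_roots; lra. }
  replace (half_bell b - half_bell a - 2 * s) with ((half_bell b - s) + (- half_bell a - s)) by ring.
  eapply Rle_trans; [apply Rabs_triang|]. lra.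
Qed.

(* The bell solves [y' = - x y], so its Fourier transform solves the same
   equation up to the boundary terms at [a] and [b]. *)
Lemma bell_fourier (a b c t : R) : a <= b ->
  Rabs (RInt (fun x => cos (c + t * x) * bell x) a b - exp (- t ^ 2 / 2) * cos c * RInt bell a b)
  <= Rabs t * (bell a + bell b).
Proof.
  intros Hab.
  set (J := fun t => RInt (fun x => cos (c + t * x) * bell x) a b).
  set (bd := fun t => sin (c + t * b) * bell b - sin (c + t * a) * bell a).
  assert (HcJ : forall t x, continuous (fun x => cos (c + t * x) * bell x) x).
  { intros u x. apply continuous_of_ex_derive. unfold bell. auto_derive. exact I. }
  assert (HJ : forall t, is_derive J t (bd t - t * J t)).
  { intros u.
    assert (E : RInt (fun x => - x * sin (c + u * x) * bell x) a b = bd u - u * J u).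
    { assert (E1 : is_RInt (fun x => u * (cos (c + u * x) * bell x) + - x * sin (c + u * x) * bell x) a b (bd u)).
      { apply (is_RInt_derive (V := R_CompleteNormedModule) (fun x => sin (c + u * x) * bell x)).
        - intros x _. unfold bell. auto_derive; [exact I|]. 
          change (- (x * (x * 1)) * / 2) with (- x ^ 2 / 2). field.
        - intros x _. apply continuous_of_ex_derive. unfold bell. auto_derive. exact I. }
      assert (E2 : is_RInt (fun x => u * (cos (c + u * x) * bell x)) a b (u * J u)).
      { apply (is_RInt_scal (V := R_NormedModule)). apply (RInt_correct (V := R_CompleteNormedModule)).
        apply ex_RInt_of_continuous. intros x; apply HcJ. }
      apply (is_RInt_unique (V := R_CompleteNormedModule)).
      pose proof (is_RInt_minus (V := R_NormedModule) _ _ _ _ _ _ E1 E2) as E3.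
      eapply is_RInt_ext; [|exact E3]. intros x _. unfold minus, plus, opp; simpl. ring. }
    rewrite <- E.
    apply (is_derive_RInt_quadratic (fun u x => cos (c + u * x) * bell x) _ a b u 1
      (3 * Rmax (Rabs a) (Rabs b) ^ 2)); [exact Hab|lra|exact HcJ| |].
    - intros x. apply continuous_of_ex_derive. unfold bell. auto_derive. exact I.
    - intros s x _ Hx.
      set (y := (s - u) * x). replace (c + s * x) with ((c + u * x) + y) by (unfold y; ring).
      rewrite cos_plus.
      replace (_ - _ - _) with (((cos y - 1) * cos (c + u * x) + - ((sin y - y) * sin (c + u * x))) * bell x)
        by (unfold y; ring).
      rewrite Rabs_mult, (Rabs_pos_eq (bell x)) by (left; apply bell_pos).
      assert (Hc1 : Rabs (cos (c + u * x)) <= 1) by (apply Rabs_le, COS_bound).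
      assert (Hs1 : Rabs (sin (c + u * x)) <= 1) by (apply Rabs_le, SIN_bound).
      pose proof (abs_mult_le_r _ (cos y - 1) Hc1). pose proof (abs_mult_le_r _ (sin y - y) Hs1).
      pose proof (cos_m1_quad y). pose proof (proj1 (sin_taylor_bounds y)).
      pose proof (bell_le1 x). pose proof (bell_pos x).
      assert (Hxm : Rabs x <= Rmax (Rabs a) (Rabs b)).
      { apply Rabs_le. pose proof (Rmax_l (Rabs a) (Rabs b)). pose proof (Rmax_r (Rabs a) (Rabs b)).
        pose proof (Rle_abs b). pose proof (Rle_abs (- a)) as Hma. rewrite Rabs_Ropp in Hma. lra. }
      assert (Hy : Rabs y ^ 2 <= Rmax (Rabs a) (Rabs b) ^ 2 * (s - u) ^ 2).
      { unfold y. rewrite Rabs_mult, Rpow_mult_distr, pow2_abs, Rmult_comm.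
        apply Rmult_le_compat_r; [apply pow2_ge_0|]. apply pow_incr. split; [apply Rabs_pos|exact Hxm]. }
      pose proof (Rabs_triang ((cos y - 1) * cos (c + u * x)) (- ((sin y - y) * sin (c + u * x)))) as Htri.
      rewrite Rabs_Ropp in Htri.
      pose proof (pow2_ge_0 (Rabs y)). 
      set (Z := Rabs (_ + - _)) in *. assert (0 <= Z) by apply Rabs_pos.
      apply Rle_trans with (Z * 1); [apply Rmult_le_compat_l; lra|]. lra. }
  (* Integrating factor: the derivative of [g] is exp(t^2 / 2) times the boundary terms alone. *)
  set (g := fun t => exp (t ^ 2 / 2) * J t - J 0).
  assert (Hg : Rabs (g t) <= (exp (t ^ 2 / 2) * (bell a + bell b)) * Rabs t).
  { apply (mean_value_bound g (fun t => exp (t ^ 2 / 2) * bd t)).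
    - intros x. unfold g. pose proof (HJ x) as HJx. auto_derive.
      + eexists; exact HJx.
      + replace (Derive (fun x0 => J x0) x) with (bd x - x * J x) by (symmetry; now apply is_derive_unique).
        change (x * (x * 1) * / 2) with (x ^ 2 / 2). field.
    - unfold g. replace (0 ^ 2 / 2) with 0 by field. rewrite exp_0. ring.
    - intros x Hx. rewrite Rabs_mult, (Rabs_pos_eq (exp _)) by (left; apply exp_pos).
      apply Rmult_le_compat; [left; apply exp_pos|apply Rabs_pos| |].
      + apply exp_le. rewrite <- (pow2_abs x), <- (pow2_abs t).
        assert (Rabs x ^ 2 <= Rabs t ^ 2) by (apply pow_incr; split; [apply Rabs_pos|exact Hx]). lra.
      + unfold bd, Rminus. eapply Rle_trans; [apply Rabs_triang|]. rewrite Rabs_Ropp, !Rabs_mult.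
        rewrite (Rabs_pos_eq (bell a)), (Rabs_pos_eq (bell b)) by (left; apply bell_pos).
        assert (Rabs (sin (c + x * b)) <= 1) by (apply Rabs_le, SIN_bound).
        assert (Rabs (sin (c + x * a)) <= 1) by (apply Rabs_le, SIN_bound).
        pose proof (bell_pos a). pose proof (bell_pos b). nra. }
  assert (EJ0 : J 0 = cos c * RInt bell a b).
  { unfold J. rewrite RInt_mult_l by (apply ex_RInt_of_continuous, bell_continuous).
    apply RInt_ext. intros x _. rewrite Rmult_0_l, Rplus_0_r. reflexivity. }
  assert (Hee : exp (- t ^ 2 / 2) * exp (t ^ 2 / 2) = 1).
  { rewrite <- exp_plus. replace (_ + _) with 0 by field. apply exp_0. }
  replace (RInt _ a b - _) with (exp (- t ^ 2 / 2) * g t).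
  2:{ unfold g. rewrite Rmult_minus_distr_l, <- Rmult_assoc, Hee, EJ0. fold (J t). ring. }
  rewrite Rabs_mult, (Rabs_pos_eq (exp _)) by (left; apply exp_pos).
  apply Rle_trans with (exp (- t ^ 2 / 2) * ((exp (t ^ 2 / 2) * (bell a + bell b)) * Rabs t)).
  - apply Rmult_le_compat_l; [left; apply exp_pos|exact Hg].
  - rewrite <- !Rmult_assoc, Hee. right; ring.
Qed.

(** * Weak convergence from cosines *)

(* [bernstein n h x] is the expectation of [h] under the binomial law [(n, x)]. *)
Fixpoint bernstein (n : nat) (h : nat -> R) (x : R) : R :=
  match n with
  | O => h O
  | S m => x * bernstein m (fun k => h (S k)) x + (1 - x) * bernstein m h x
  end.

Lemma bernstein_le (n : nat) (h1 h2 : nat -> R) (x : R) : 0 <= x <= 1 ->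
  (forall k, h1 k <= h2 k) -> bernstein n h1 x <= bernstein n h2 x.
Proof.
  intros Hx. revert h1 h2. induction n as [|n IH]; intros h1 h2 H; simpl; [apply H|].
  apply Rplus_le_compat; apply Rmult_le_compat_l; try lra; apply IH; intros; apply H.
Qed.

Lemma bernstein_affine (n : nat) (h : nat -> R) (a b x : R) :
  bernstein n (fun k => a + b * h k) x = a + b * bernstein n h x.
Proof.
  revert h. induction n as [|n IH]; intros h; simpl; [reflexivity|].
  rewrite (IH (fun k => h (S k))), (IH h). ring.
Qed.

(** The shift [a] is general because the recursion in [n] moves it by 1. *)
Lemma bernstein_second_moment (n : nat) (x a : R) :
  bernstein n (fun k => (INR k + a) ^ 2) x = INR n * x * (1 - x) + (INR n * x + a) ^ 2.
Proof.
  assert (Hext : forall m h1 h2, (forall k, h1 k = h2 k) -> bernstein m h1 x = bernstein m h2 x).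
  { induction m as [|m IH]; intros h1 h2 H; simpl; [apply H|].
    rewrite (IH h1 h2 H), (IH (fun k => h1 (S k)) (fun k => h2 (S k))); auto. }
  revert a. induction n as [|n IH]; intros a; cbn [bernstein]; [simpl; ring|].
  rewrite (Hext n (fun k => (INR (S k) + a) ^ 2) (fun k => (INR k + (a + 1)) ^ 2)).
  - rewrite !IH, S_INR. ring.
  - intros k. rewrite S_INR. ring.
Qed.

(** Chebyshev's argument: within distance [d] continuity bounds the difference; beyond it the bound
    2 M is at most a multiple of (k - n x)^2, whose binomial mean is at most n. *)
Lemma bernstein_approx (G : R -> R) (M eps : R) : 0 < eps ->
  (forall x, Rabs (G x) <= M) ->
  (exists d, 0 < d /\ forall x y, Rabs (x - y) < d -> Rabs (G x - G y) <= eps) ->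
  exists n, (1 <= n)%nat /\ forall x, 0 <= x <= 1 ->
    Rabs (bernstein n (fun k => G (INR k / INR n)) x - G x) <= 2 * eps.
Proof.
  intros Heps HM [d [Hd HG]].
  assert (HM0 : 0 <= M) by (eapply Rle_trans; [apply Rabs_pos|apply (HM 0)]).
  assert (Hd2 : 0 < d ^ 2) by now apply pow_lt.
  destruct (INR_unbounded (2 * M / (eps * d ^ 2))) as [n0 Hn0].
  exists (S n0). split; [lia|]. intros x Hx. set (n := S n0).
  assert (Hn : 1 <= INR n) by (change 1 with (INR 1); apply le_INR; unfold n; lia).
  assert (Hn' : 2 * M <= INR n * (eps * d ^ 2)).
  { assert (He : 0 < eps * d ^ 2) by now apply Rmult_lt_0_compat.
    apply (Rmult_le_reg_r (/ (eps * d ^ 2))); [now apply Rinv_0_lt_compat|].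
    rewrite (Rmult_assoc (INR n)), Rinv_r, Rmult_1_r by lra.
    unfold n. rewrite S_INR. unfold Rdiv in Hn0. lra. }
  set (c := 2 * M / d ^ 2 / INR n ^ 2).
  assert (Hc : 0 <= c).
  { unfold c, Rdiv. apply Rmult_le_pos; [apply Rmult_le_pos; [lra|]|];
      left; apply Rinv_0_lt_compat; [assumption|apply pow_lt; lra]. }
  assert (Hpt : forall k, Rabs (G (INR k / INR n) - G x) <= eps + c * (INR k + - (INR n * x)) ^ 2).
  { intros k. destruct (Rlt_or_le (Rabs (INR k / INR n - x)) d) as [H|H].
    - specialize (HG _ _ H). pose proof (pow2_ge_0 (INR k + - (INR n * x))). nra.
    - apply Rle_trans with (2 * M).
      + unfold Rminus. eapply Rle_trans; [apply Rabs_triang|]. rewrite Rabs_Ropp.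
        pose proof (HM (INR k / INR n)). pose proof (HM x). lra.
      + apply Rle_trans with (c * (INR k + - (INR n * x)) ^ 2); [|lra].
        replace (c * (INR k + - (INR n * x)) ^ 2) with (2 * M / d ^ 2 * (INR k / INR n - x) ^ 2)
          by (unfold c; field; lra).
        rewrite <- (pow2_abs (INR k / INR n - x)).
        assert (d ^ 2 <= Rabs (INR k / INR n - x) ^ 2) by (apply pow_incr; lra).
        replace (2 * M) with (2 * M / d ^ 2 * d ^ 2) at 1 by (field; lra).
        apply Rmult_le_compat_l; [|assumption].
        unfold Rdiv. apply Rmult_le_pos; [lra|left; now apply Rinv_0_lt_compat]. }
  assert (Hmom : bernstein n (fun k => (INR k + - (INR n * x)) ^ 2) x <= INR n).
  { rewrite bernstein_second_moment. nra. }
  assert (Hcn : c * INR n <= eps).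
  { unfold c. apply (Rmult_le_reg_r (INR n * d ^ 2)); [apply Rmult_lt_0_compat; lra|].
    replace (2 * M / d ^ 2 / INR n ^ 2 * INR n * (INR n * d ^ 2)) with (2 * M) by (field; lra). lra. }
  assert (Htot : eps + c * bernstein n (fun k => (INR k + - (INR n * x)) ^ 2) x <= 2 * eps).
  { apply (Rmult_le_compat_l c) in Hmom; [lra|exact Hc]. }
  apply Rabs_le. split.
  - pose proof (bernstein_le n (fun k => (G x - eps) + - c * (INR k + - (INR n * x)) ^ 2)
      (fun k => G (INR k / INR n)) x Hx) as H.
    rewrite bernstein_affine in H.
    assert (H' := H ltac:(intros k; specialize (Hpt k); apply Rabs_le_between in Hpt; lra)). lra.
  - pose proof (bernstein_le n (fun k => G (INR k / INR n))
      (fun k => (G x + eps) + c * (INR k + - (INR n * x)) ^ 2) x Hx) as H.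
    rewrite bernstein_affine in H.
    assert (H' := H ltac:(intros k; specialize (Hpt k); apply Rabs_le_between in Hpt; lra)). lra.
Qed.

(* On [|y| <= A] the map [y -> sin (y / A)] is injective, so [g] is there a
   function of [sin (y / A)], to which the Bernstein approximation applies. *)
Lemma sine_polynomial_approx (g : R -> R) (M A eps : R) :
  continuity g -> (forall x, Rabs (g x) <= M) -> 0 < A -> 0 < eps ->
  exists n h, (forall k, Rabs (h k) <= M) /\ forall y, Rabs y <= A ->
    Rabs (bernstein n h ((1 + sin (y * / A)) / 2) - g y) <= eps.
Proof.
  intros Hg HM HA Heps.
  pose proof PI2_1 as HPI.
  assert (Hs1 : 0 < sin 1 < 1).
  { split; [apply sin_gt_0; lra|].
    assert (H : sin 1 < sin (PI / 2)) by (apply sin_increasing_1; lra). now rewrite sin_PI2 in H. }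
  (* Clamping extends the function to the whole line and keeps [asin] away from its singular end
     points. It changes nothing for |y| <= A, since then |y / A| <= 1 < PI / 2. *)
  set (clamp := fun z => Rmax (- sin 1) (Rmin z (sin 1))).
  assert (Hclamp : forall z, - sin 1 <= clamp z <= sin 1).
  { intros z. unfold clamp. split; [apply Rmax_l|]. apply Rmax_lub; [lra|apply Rmin_r]. }
  assert (Hclamp_id : forall z, - sin 1 <= z <= sin 1 -> clamp z = z).
  { intros z Hz. unfold clamp. rewrite Rmin_left, Rmax_right; lra. }
  assert (Hclamp_lip : forall x y, Rabs (clamp x - clamp y) <= Rabs (x - y)).
  { intros x y. unfold clamp, Rmax, Rmin.
    repeat destruct Rle_dec; unfold Rabs; repeat destruct Rcase_abs; lra. }
  set (u := fun z => g (A * asin z)).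
  assert (Hu : forall z, - sin 1 <= z <= sin 1 -> continuity_pt u z).
  { intros z Hz. apply (continuity_pt_comp (fun z => A * asin z) g); [|apply Hg].
    apply continuity_pt_mult; [apply continuity_pt_const; intros ? ?; reflexivity|].
    apply derivable_continuous_pt, derivable_pt_asin. lra. }
  assert (Heps2 : 0 < eps / 2) by lra.
  destruct (Heine_cor2 Hu (mkposreal _ Heps2)) as [d Hd]. simpl in Hd.
  set (G := fun x => u (clamp (2 * x - 1))).
  destruct (bernstein_approx G M (eps / 2) Heps2) as [n [Hn H]].
  - intros x. apply HM.
  - exists (d / 2). pose proof (cond_pos d). split; [lra|]. intros x y Hxy.
    left. apply Hd; try apply Hclamp.
    eapply Rle_lt_trans; [apply Hclamp_lip|].
    replace (2 * x - 1 - (2 * y - 1)) with (2 * (x - y)) by ring.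
    rewrite Rabs_mult, (Rabs_pos_eq 2) by lra. lra.
  (* The coefficients are values of [g], so the approximant stays bounded by [M] on the whole line,
     also where it is far from [g]. *)
  - exists n, (fun k => G (INR k / INR n)). split; [intros; apply HM|].
    intros y Hy.
    assert (Hv : Rabs (y * / A) <= 1).
    { rewrite Rabs_mult, Rabs_inv, (Rabs_pos_eq A) by lra.
      apply (Rmult_le_reg_r A); [exact HA|]. rewrite Rmult_assoc, Rinv_l, Rmult_1_r by lra. lra. }
    set (v := y * / A) in *. apply Rabs_le_between in Hv.
    specialize (H ((1 + sin v) / 2)). pose proof (SIN_bound v).
    replace (g y) with (G ((1 + sin v) / 2)).
    + replace eps with (2 * (eps / 2)) by field. apply H. lra.
    + unfold G. replace (2 * ((1 + sin v) / 2) - 1) with (sin v) by field.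
      rewrite Hclamp_id.
      * unfold u. rewrite asin_sin by lra. f_equal. unfold v. field. lra.
      * split.
        -- rewrite <- sin_neg. apply sin_incr_1; lra.
        -- apply sin_incr_1; lra.
Qed.

(** * Improper integrals against the Gaussian density *)

Definition gauss_integral_to (g : R -> R) (l : R) : Prop :=
  forall eps, 0 < eps -> exists A, 0 < A /\ forall a b, a < - A -> A < b ->
    Rabs (RInt (fun x => g x * gauss_density x) a b - l) < eps.

Lemma gauss_density_bell (x : R) : gauss_density x = bell x / sqrt (2 * PI).
Proof. reflexivity. Qed.

Lemma sqrt_2PI_ge2 : 2 <= sqrt (2 * PI).
Proof. destruct sqrt_2PI as [E H]. lra. Qed.

Lemma gauss_density_pos (x : R) : 0 < gauss_density x.
Proof.
  rewrite gauss_density_bell. pose proof sqrt_2PI_ge2. apply Rdiv_lt_0_compat; [apply bell_pos|lra].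
Qed.

Lemma gauss_density_continuous (x : R) : continuous gauss_density x.
Proof.
  apply continuous_of_ex_derive. unfold gauss_density. auto_derive. 
  pose proof sqrt_2PI_ge2. lra.
Qed.

Lemma RInt_gauss (g : R -> R) (a b : R) : (forall x, continuous g x) ->
  RInt (fun x => g x * gauss_density x) a b = / sqrt (2 * PI) * RInt (fun x => g x * bell x) a b.
Proof.
  intros Hg. rewrite RInt_mult_l.
  - apply RInt_ext. intros x _. rewrite gauss_density_bell. apply Rminus_diag_uniq. unfold Rdiv. ring.
  - apply ex_RInt_of_continuous. intros x. apply (continuous_mult (K := R_AbsRing)); [apply Hg|apply bell_continuous].
Qed.

Lemma gauss_prod_continuous (g : R -> R) : (forall x, continuous g x) ->
  forall x, continuous (fun x => g x * gauss_density x) x.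
Proof.
  intros Hg x. apply (continuous_mult (K := R_AbsRing)); [apply Hg|apply gauss_density_continuous].
Qed.

Lemma gauss_total (a b : R) : a <= 0 -> 0 <= b ->
  Rabs (RInt gauss_density a b - 1) <= bell a + bell b.
Proof.
  intros Ha Hb. pose proof sqrt_2PI_ge2 as Hs.
  assert (E : RInt gauss_density a b = / sqrt (2 * PI) * RInt bell a b).
  { rewrite RInt_mult_l by (apply ex_RInt_of_continuous, bell_continuous).
    apply RInt_ext. intros x _. rewrite gauss_density_bell. apply Rminus_diag_uniq. unfold Rdiv. ring. }
  pose proof (bell_integral a b Ha Hb) as H. rewrite E.
  set (s := sqrt (2 * PI)) in *.
  replace (/ s * RInt bell a b - 1) with (/ s * (RInt bell a b - s)) by (field; lra).
  rewrite Rabs_mult, Rabs_pos_eq by (left; apply Rinv_0_lt_compat; lra).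
  apply (Rmult_le_reg_l s); [lra|]. rewrite <- Rmult_assoc, Rinv_r, Rmult_1_l by lra.
  pose proof (bell_pos a). pose proof (bell_pos b). nra.
Qed.

Lemma gauss_integral_cos (c t : R) :
  gauss_integral_to (fun x => cos (c + t * x)) (exp (- t ^ 2 / 2) * cos c).
Proof.
  intros eps Heps. pose proof sqrt_2PI_ge2 as Hs. pose proof (Rabs_pos t) as Ht.
  assert (He : 0 < eps / (2 * (Rabs t + 1))) by (apply Rdiv_lt_0_compat; lra).
  destruct (bell_vanishes _ He) as [A [HA Hbell]].
  exists A. split; [exact HA|]. intros a b Ha Hb.
  rewrite RInt_gauss.
  2:{ intros x. apply continuous_of_ex_derive. auto_derive. exact I. }
  assert (Ba : bell a < eps / (2 * (Rabs t + 1))) by (apply Hbell; rewrite Rabs_left; lra).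
  assert (Bb : bell b < eps / (2 * (Rabs t + 1))) by (apply Hbell; rewrite Rabs_pos_eq; lra).
  pose proof (bell_fourier a b c t ltac:(lra)) as HF.
  pose proof (bell_integral a b ltac:(lra) ltac:(lra)) as HI.
  set (s := sqrt (2 * PI)) in *. set (J := RInt (fun x => cos (c + t * x) * bell x) a b) in *.
  set (e := exp (- t ^ 2 / 2) * cos c) in *.
  assert (He1 : Rabs e <= 1).
  { unfold e. rewrite Rabs_mult, Rabs_pos_eq by (left; apply exp_pos).
    assert (exp (- t ^ 2 / 2) <= 1).
    { rewrite <- exp_0. apply exp_le. pose proof (pow2_ge_0 t). lra. }
    assert (Rabs (cos c) <= 1) by (apply Rabs_le, COS_bound).
    pose proof (exp_pos (- t ^ 2 / 2)). pose proof (Rabs_pos (cos c)). nra. }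
  replace (/ s * J - e) with (/ s * ((J - e * RInt bell a b) + e * (RInt bell a b - s))) by (field; lra).
  rewrite Rabs_mult, (Rabs_pos_eq (/ s)) by (left; apply Rinv_0_lt_compat; lra).
  apply (Rmult_lt_reg_l s); [lra|]. rewrite <- Rmult_assoc, Rinv_r, Rmult_1_l by lra.
  apply Rle_lt_trans with (Rabs t * (bell a + bell b) + 2 * (bell a + bell b)).
  - eapply Rle_trans; [apply Rabs_triang|]. apply Rplus_le_compat; [exact HF|].
    rewrite Rabs_mult. pose proof (Rabs_pos (RInt bell a b - s)). nra.
  - assert (bell a + bell b < eps / (Rabs t + 1)).
    { replace (eps / (Rabs t + 1)) with (eps / (2 * (Rabs t + 1)) + eps / (2 * (Rabs t + 1))) by (field; lra). lra. }
    assert (E2 : (Rabs t + 1) * (eps / (Rabs t + 1)) = eps) by (field; lra).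
    pose proof (bell_pos a). pose proof (bell_pos b). nra.
Qed.

Lemma gauss_integral_lin (g h : R -> R) (a b l m : R) :
  (forall x, continuous g x) -> (forall x, continuous h x) ->
  gauss_integral_to g l -> gauss_integral_to h m ->
  gauss_integral_to (fun x => a * g x + b * h x) (a * l + b * m).
Proof.
  intros Cg Ch Hg Hh eps Heps.
  set (K := Rabs a + Rabs b + 1). pose proof (Rabs_pos a). pose proof (Rabs_pos b).
  assert (He : 0 < eps / K) by (apply Rdiv_lt_0_compat; unfold K; lra).
  destruct (Hg _ He) as [A1 [HA1 H1]]. destruct (Hh _ He) as [A2 [HA2 H2]].
  exists (Rmax A1 A2). pose proof (Rmax_l A1 A2). pose proof (Rmax_r A1 A2).
  split; [lra|]. intros x y Hx Hy. specialize (H1 x y ltac:(lra) ltac:(lra)).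
  specialize (H2 x y ltac:(lra) ltac:(lra)).
  pose proof (ex_RInt_of_continuous _ x y (gauss_prod_continuous g Cg)) as E1.
  pose proof (ex_RInt_of_continuous _ x y (gauss_prod_continuous h Ch)) as E2.
  assert (E : RInt (fun x => (a * g x + b * h x) * gauss_density x) x y =
    a * RInt (fun x => g x * gauss_density x) x y + b * RInt (fun x => h x * gauss_density x) x y).
  { apply (is_RInt_unique (V := R_CompleteNormedModule)).
    apply (is_RInt_ext (V := R_NormedModule)
      (fun x => plus (scal a (g x * gauss_density x)) (scal b (h x * gauss_density x)))).
    - intros z _. unfold plus, scal; simpl; unfold mult; simpl. ring.
    - apply (is_RInt_plus (V := R_NormedModule)); apply (is_RInt_scal (V := R_NormedModule));
        apply (RInt_correct (V := R_CompleteNormedModule)); assumption. }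
  rewrite E. set (I1 := RInt _ x y) in *. set (I2 := RInt (fun x => h x * _) x y) in *.
  replace (a * I1 + b * I2 - (a * l + b * m)) with (a * (I1 - l) + b * (I2 - m)) by ring.
  eapply Rle_lt_trans; [apply Rabs_triang|]. rewrite !Rabs_mult.
  assert (EK : K * (eps / K) = eps) by (unfold K; field; unfold K in *; lra).
  unfold K in EK at 1. nra.
Qed.

Lemma gauss_bounded_int (g : R -> R) (M a b : R) : (forall x, continuous g x) -> a <= b ->
  (forall x, a <= x <= b -> Rabs (g x) <= M) ->
  Rabs (RInt (fun x => g x * gauss_density x) a b) <= M * RInt gauss_density a b.
Proof.
  intros Cg Hab HM.
  pose proof (ex_RInt_of_continuous _ a b (gauss_prod_continuous g Cg)) as E1.
  pose proof (ex_RInt_of_continuous _ a b gauss_density_continuous) as E2.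
  rewrite (RInt_mult_l _ a b M E2).
  apply (Rle_trans _ (RInt (fun x => Rabs (g x * gauss_density x)) a b)).
  - now apply abs_RInt_le.
  - apply RInt_le; [exact Hab| | |].
    + apply ex_RInt_of_continuous. intros x.
      apply (continuous_comp (fun x => g x * gauss_density x) Rabs); [now apply gauss_prod_continuous|].
      apply continuous_Rabs.
    + apply ex_RInt_of_continuous. intros x.
      apply (continuous_mult (K := R_AbsRing)); [apply continuous_const|apply gauss_density_continuous].
    + intros x Hx. pose proof (gauss_density_pos x).
      rewrite Rabs_mult, (Rabs_pos_eq (gauss_density x)) by lra.
      apply Rmult_le_compat_r; [lra|]. apply HM. lra.
Qed.

(** The integral over the two outer pieces is at most [M] times their mass, and that mass is the
    difference of two totals, both close to 1. *)
Lemma gauss_tail (g : R -> R) (M a b a' b' : R) : (forall x, continuous g x) ->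
  (forall x, Rabs (g x) <= M) -> a' <= a -> a <= 0 -> 0 <= b -> b <= b' ->
  Rabs (RInt (fun x => g x * gauss_density x) a' b' - RInt (fun x => g x * gauss_density x) a b)
  <= M * (bell a + bell b + bell a' + bell b').
Proof.
  intros Cg HM H1 H2 H3 H4.
  assert (HM0 : 0 <= M) by (eapply Rle_trans; [apply Rabs_pos|apply (HM 0)]).
  assert (Ch : forall h, (forall x, continuous h x) ->
    RInt h a' b' - RInt h a b = RInt h a' a + RInt h b b').
  { intros h Hh.
    rewrite <- (RInt_Chasles (V := R_CompleteNormedModule) h a' a b') by now apply ex_RInt_of_continuous.
    rewrite <- (RInt_Chasles (V := R_CompleteNormedModule) h a b b') by now apply ex_RInt_of_continuous.
    unfold plus; simpl. ring. }
  rewrite Ch by now apply gauss_prod_continuous.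
  eapply Rle_trans; [apply Rabs_triang|].
  pose proof (gauss_bounded_int g M a' a Cg H1 (fun x _ => HM x)).
  pose proof (gauss_bounded_int g M b b' Cg H4 (fun x _ => HM x)).
  pose proof (Ch gauss_density gauss_density_continuous) as E.
  pose proof (gauss_total a b H2 H3) as T1. pose proof (gauss_total a' b' ltac:(lra) ltac:(lra)) as T2.
  apply Rabs_le_between in T1. apply Rabs_le_between in T2.
  apply Rle_trans with (M * (RInt gauss_density a' a + RInt gauss_density b b')); [lra|].
  apply Rmult_le_compat_l; [exact HM0|]. lra.
Qed.

Lemma gauss_integral_exists (g : R -> R) (M : R) : (forall x, continuous g x) ->
  (forall x, Rabs (g x) <= M) -> exists l, gauss_integral_to g l.
Proof.
  intros Cg HM.
  assert (HM0 : 0 <= M) by (eapply Rle_trans; [apply Rabs_pos|apply (HM 0)]).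
  set (u := fun n => RInt (fun x => g x * gauss_density x) (- INR n) (INR n)).
  assert (Hsmall : forall eps, 0 < eps -> exists N : nat, forall n a b, (N <= n)%nat ->
    a <= - INR n -> INR n <= b ->
    Rabs (RInt (fun x => g x * gauss_density x) a b - u n) < eps).
  { intros eps Heps.
    assert (He : 0 < eps / (4 * (M + 1))) by (apply Rdiv_lt_0_compat; lra).
    destruct (bell_vanishes _ He) as [A [HA Hbell]].
    destruct (INR_unbounded A) as [N HN]. exists N. intros n a b Hn Ha Hb.
    apply le_INR in Hn. unfold u.
    eapply Rle_lt_trans; [apply (gauss_tail g M); try assumption; lra|].
    assert (B1 : bell (- INR n) < eps / (4 * (M + 1))) by (apply Hbell; rewrite Rabs_left; lra).
    assert (B2 : bell (INR n) < eps / (4 * (M + 1))) by (apply Hbell; rewrite Rabs_pos_eq; lra).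
    assert (B3 : bell a < eps / (4 * (M + 1))) by (apply Hbell; rewrite Rabs_left; lra).
    assert (B4 : bell b < eps / (4 * (M + 1))) by (apply Hbell; rewrite Rabs_pos_eq; lra).
    apply Rle_lt_trans with (M * (4 * (eps / (4 * (M + 1))))).
    - apply Rmult_le_compat_l; lra.
    - replace (M * (4 * (eps / (4 * (M + 1))))) with (eps * (M / (M + 1))) by (field; lra).
      rewrite <- (Rmult_1_r eps) at 2. apply Rmult_lt_compat_l; [exact Heps|].
      apply (Rmult_lt_reg_r (M + 1)); [lra|]. unfold Rdiv. rewrite Rmult_assoc, Rinv_l by lra. lra. }
  assert (Hc : ex_finite_lim_seq u).
  { apply ex_lim_seq_cauchy_corr. intros eps.
    destruct (Hsmall (eps / 2) ltac:(pose proof (cond_pos eps); lra)) as [N HN].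
    exists N. intros n m Hn Hm.
    assert (Hl1 : - INR (n + m) <= - INR n) by (rewrite plus_INR; pose proof (pos_INR m); lra).
    assert (Hl2 : - INR (n + m) <= - INR m) by (rewrite plus_INR; pose proof (pos_INR n); lra).
    pose proof (HN n (- INR (n + m)) (INR (n + m)) Hn Hl1 ltac:(lra)) as X1.
    pose proof (HN m (- INR (n + m)) (INR (n + m)) Hm Hl2 ltac:(lra)) as X2.
    set (I := RInt _ _ _) in *.
    replace (u n - u m) with (- (I - u n) + (I - u m)) by ring.
    eapply Rle_lt_trans; [apply Rabs_triang|]. rewrite Rabs_Ropp. lra. }
  destruct Hc as [l Hl]. exists l. intros eps Heps.
  apply is_lim_seq_spec in Hl. assert (He : 0 < eps / 2) by lra.
  destruct (Hl (mkposreal _ He)) as [N1 HN1]. simpl in HN1.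
  destruct (Hsmall (eps / 2) He) as [N2 HN2].
  set (n := Nat.max 1 (Nat.max N1 N2)).
  exists (INR n). split; [apply lt_0_INR; lia|]. intros a b Ha Hb.
  specialize (HN1 n ltac:(lia)). specialize (HN2 n a b ltac:(lia) ltac:(lra) ltac:(lra)).
  replace (RInt _ a b - l) with ((RInt (fun x => g x * gauss_density x) a b - u n) + (u n - l)) by ring.
  eapply Rle_lt_trans; [apply Rabs_triang|]. lra.
Qed.

Lemma gauss_integral_is_RInt_gen (g : R -> R) (l : R) : (forall x, continuous g x) ->
  gauss_integral_to g l ->
  is_RInt_gen (fun x => g x * gauss_density x) (Rbar_locally m_infty) (Rbar_locally p_infty) l.
Proof.
  intros Cg H P [eps HP]. destruct (H eps (cond_pos eps)) as [A [HA HAb]].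
  apply (Filter_prod _ _ _ (fun a => a < - A) (fun b => A < b)).
  - exists (- A). auto.
  - exists A. auto.
  - intros a b Ha Hb. exists (RInt (fun x => g x * gauss_density x) a b). split.
    + apply (RInt_correct (V := R_CompleteNormedModule)), ex_RInt_of_continuous.
      now apply gauss_prod_continuous.
    + apply HP. now apply HAb.
Qed.

(** * From cosine limits to all bounded continuous functions *)

Section WeakConvergence.
Context (q : nat) (hq : (2 <= q)%nat) (Z : nat -> nat -> R).

(** Existence of the Gaussian integral is bundled with convergence to that same value, which makes
    the class closed under linear combinations. *)
Definition test_function (phi : R -> R) : Prop :=
  (forall x, continuous phi x) /\ exists l, gauss_integral_to phi l /\
    is_lim_seq (fun k => unif_expect q k (fun n => phi (Z k n))) l.

Lemma test_function_lin (g h : R -> R) (a b : R) :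
  test_function g -> test_function h -> test_function (fun x => a * g x + b * h x).
Proof.
  intros [Cg [l [Hg Lg]]] [Ch [m [Hh Lh]]]. split.
  - intros x. apply (continuous_plus (V := R_NormedModule));
      apply (continuous_mult (K := R_AbsRing)); try apply continuous_const; [apply Cg|apply Ch].
  - exists (a * l + b * m). split; [now apply gauss_integral_lin|].
    apply is_lim_seq_ext with (fun k => a * unif_expect q k (fun n => g (Z k n))
      + b * unif_expect q k (fun n => h (Z k n))).
    + intros k. now rewrite unif_expect_plus, !unif_expect_scal.
    + apply is_lim_seq_plus'; apply is_lim_seq_mult'; try apply is_lim_seq_const; assumption.
Qed.

Lemma test_function_ext (g h : R -> R) : (forall x, g x = h x) -> test_function g -> test_function h.
Proof.
  intros E [C [l [Hg Lg]]]. split.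
  - intros x. apply (continuous_ext g); [exact E|apply C].
  - exists l. split.
    + intros eps Heps. destruct (Hg eps Heps) as [A [HA H]]. exists A. split; [exact HA|].
      intros a b Ha Hb. rewrite <- (RInt_ext (fun x => g x * gauss_density x)); [now apply H|].
      intros x _. now rewrite E.
    + apply is_lim_seq_ext with (2 := Lg). intros k. apply unif_expect_ext. intros; apply E.
Qed.

Context (Hchar : forall t c, is_lim_seq (fun k => unif_expect q k (fun n => cos (c + t * Z k n)))
  (exp (- t ^ 2 / 2) * cos c)).

Lemma test_function_cos (c t : R) : test_function (fun x => cos (c + t * x)).
Proof.
  split.
  - intros x. apply continuous_of_ex_derive. auto_derive. exact I.
  - exists (exp (- t ^ 2 / 2) * cos c). split; [apply gauss_integral_cos|apply Hchar].
Qed.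

(* Product-to-sum formulas keep the class stable under multiplication by [sin (s x)]. *)
Lemma test_function_bernstein (n : nat) (h : nat -> R) (s c t : R) :
  test_function (fun x => bernstein n h ((1 + sin (x * s)) / 2) * cos (c + t * x)).
Proof.
  revert h c t. induction n as [|n IH]; intros h c t; cbn [bernstein].
  - apply (test_function_ext (fun x => h O * cos (c + t * x) + 0 * cos (c + t * x))).
    + intros x. ring.
    + apply test_function_lin; apply test_function_cos.
  - set (g0 := fun c t x => bernstein n h ((1 + sin (x * s)) / 2) * cos (c + t * x)).
    set (g1 := fun c t x => bernstein n (fun k => h (S k)) ((1 + sin (x * s)) / 2) * cos (c + t * x)).
    assert (T0 : forall c t, test_function (g0 c t)) by (intros; apply IH).
    assert (T1 : forall c t, test_function (g1 c t)) by (intros; apply IH).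
    (* The phase shift by PI / 2 writes sines as cosines; the factor (1 + sin) / 2 and the
       product-to-sum formula give the coefficients 1/2 and 1/4. *)
    pose proof (test_function_lin _ _ 1 (-1) (T1 (c - PI / 2) (t + s)) (T1 (c - PI / 2) (t - s))) as S1.
    pose proof (test_function_lin _ _ 1 (-1) (T0 (c - PI / 2) (t + s)) (T0 (c - PI / 2) (t - s))) as S0.
    pose proof (test_function_lin _ _ (/ 2) (/ 4) (T1 c t) S1) as R1.
    pose proof (test_function_lin _ _ (/ 2) (- / 4) (T0 c t) S0) as R0.
    apply (test_function_ext _ _ (fun x => eq_refl)) in R0.
    refine (test_function_ext _ _ _ (test_function_lin _ _ 1 1 R1 R0)).
    intros x. unfold g0, g1.
    assert (Hsum : forall y, cos (c - PI / 2 + y) = sin (c + y)).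
    { intros y. replace (c - PI / 2 + y) with (- (PI / 2 - (c + y))) by ring.
      rewrite cos_neg. apply cos_shift. }
    rewrite !Hsum.
    replace (c + (t + s) * x) with ((c + t * x) + x * s) by ring.
    replace (c + (t - s) * x) with ((c + t * x) - x * s) by ring.
    rewrite sin_plus, sin_minus. field.
Qed.

Context (V : R) (k0 : nat) (HV : forall k, (k0 <= k)%nat -> unif_expect q k (fun n => Z k n ^ 2) <= V).

Lemma weak_convergence_of_cos : weak_conv_std_gauss q Z.
Proof.
  intros g Hg [M0 HM0].
  assert (Cg : forall x, continuous g x) by (intros x; apply continuity_pt_filterlim, Hg).
  set (M := Rabs M0 + 1).
  assert (HM : forall x, Rabs (g x) <= M).
  { intros x. eapply Rle_trans; [apply HM0|]. pose proof (Rle_abs M0). unfold M. lra. }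
  assert (HMp : 1 <= M) by (unfold M; pose proof (Rabs_pos M0); lra).
  destruct (gauss_integral_exists g M Cg HM) as [l Hl].
  exists l. split; [now apply gauss_integral_is_RInt_gen|].
  (* Of the ten parts, 7 go to the gap between the two Gaussian integrals, 2 to replacing [g] by
     [phi] in the expectation, and 1 to the convergence for [phi]. *)
  apply is_lim_seq_spec. intros eps. set (e := eps / 10).
  assert (He : 0 < e) by (unfold e; pose proof (cond_pos eps); lra).
  assert (HeM : 0 < e / (4 * M)) by (apply Rdiv_lt_0_compat; lra).
  destruct (bell_vanishes _ HeM) as [A1 [HA1 Hbell]].
  set (W := Rabs V + 1). assert (HW : 1 <= W) by (unfold W; pose proof (Rabs_pos V); lra).
  (* [A2] makes the second moment bound 2 M W / A^2 at most [e], whereas [A1] makes the bell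
     negligible at the end points. *)
  set (A2 := 1 + 2 * M * W / e).
  assert (HA2 : 1 <= A2 /\ 2 * M * W <= e * A2 ^ 2).
  { assert (0 < 2 * M * W / e) by (apply Rdiv_lt_0_compat; nra).
    assert (E : e * (2 * M * W / e) = 2 * M * W) by (field; lra).
    unfold A2. split; [lra|]. set (z := 2 * M * W / e) in *. nra. }
  set (A := A1 + A2 + 1).
  assert (HA : 0 < A) by (unfold A; lra).
  destruct (sine_polynomial_approx g M A e Hg HM HA He) as [n [h [Hh Happ]]].
  set (phi := fun y => bernstein n h ((1 + sin (y * / A)) / 2)) in *.
  assert (Tphi : test_function phi).
  { apply (test_function_ext (fun x => phi x * cos (0 + 0 * x))); [|apply test_function_bernstein].
    intros x. replace (0 + 0 * x) with 0 by ring. rewrite cos_0. ring. }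
  assert (Hphi : forall x, Rabs (phi x) <= M).
  { intros x. pose proof (SIN_bound (x * / A)) as Hsin.
    assert (Hx : 0 <= (1 + sin (x * / A)) / 2 <= 1) by lra.
    apply Rabs_le. split.
    - pose proof (bernstein_le n (fun k => - M + 0 * h k) h _ Hx) as H. rewrite bernstein_affine in H.
      assert (H' := H ltac:(intros k; specialize (Hh k); apply Rabs_le_between in Hh; lra)).
      unfold phi. lra.
    - pose proof (bernstein_le n h (fun k => M + 0 * h k) _ Hx) as H. rewrite bernstein_affine in H.
      assert (H' := H ltac:(intros k; specialize (Hh k); apply Rabs_le_between in Hh; lra)).
      unfold phi. lra. }
  destruct Tphi as [Cphi [m [Hm Lm]]].
  assert (Hdiff : forall x, Rabs (g x - phi x) <= 2 * M).
  { intros x. unfold Rminus. eapply Rle_trans; [apply Rabs_triang|]. rewrite Rabs_Ropp.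
    specialize (HM x). specialize (Hphi x). lra. }
  assert (Hnear : forall x, Rabs x <= A -> Rabs (g x - phi x) <= e).
  { intros x Hx. rewrite Rabs_minus_sym. now apply Happ. }
  assert (Hlm : Rabs (l - m) <= 7 * e).
  { destruct (Hl e He) as [B1 [HB1 H1]]. destruct (Hm e He) as [B2 [HB2 H2]].
    set (B := B1 + B2 + A). 
    specialize (H1 (- B - 1) (B + 1) ltac:(unfold B; lra) ltac:(unfold B; lra)).
    specialize (H2 (- B - 1) (B + 1) ltac:(unfold B; lra) ltac:(unfold B; lra)).
    set (d := fun x => 1 * g x + - 1 * phi x).
    assert (Cd : forall x, continuous d x).
    { intros x. apply (continuous_plus (V := R_NormedModule));
        apply (continuous_mult (K := R_AbsRing)); try apply continuous_const; [apply Cg|apply Cphi]. }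
    assert (Ed : forall x, d x = g x - phi x) by (intros; unfold d; ring).
    pose proof (gauss_tail d (2 * M) (- A) A (- B - 1) (B + 1) Cd
      ltac:(intros x; rewrite Ed; apply Hdiff) ltac:(unfold B; lra) ltac:(lra) ltac:(lra)
      ltac:(unfold B; lra)) as H3.
    pose proof (gauss_bounded_int d e (- A) A Cd ltac:(lra)) as H4.
    specialize (H4 ltac:(intros x Hx; rewrite Ed; apply Hnear; now apply Rabs_le)).
    pose proof (gauss_total (- A) A ltac:(lra) ltac:(lra)) as H5.
    apply Rabs_le_between in H5.
    assert (b1 : bell (- A) < e / (4 * M)) by (apply Hbell; rewrite Rabs_left; unfold A; lra).
    assert (b2 : bell A < e / (4 * M)) by (apply Hbell; rewrite Rabs_pos_eq; unfold A; lra).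
    assert (b3 : bell (- B - 1) < e / (4 * M)) by (apply Hbell; rewrite Rabs_left; unfold B, A; lra).
    assert (b4 : bell (B + 1) < e / (4 * M)) by (apply Hbell; rewrite Rabs_pos_eq; unfold B, A; lra).
    pose proof (bell_le1 A). pose proof (bell_le1 (- A)).
    assert (E4 : 2 * M * (4 * (e / (4 * M))) = 2 * e) by (field; lra).
    assert (E : RInt (fun x => d x * gauss_density x) (- B - 1) (B + 1) =
      RInt (fun x => g x * gauss_density x) (- B - 1) (B + 1)
      - RInt (fun x => phi x * gauss_density x) (- B - 1) (B + 1)).
    { apply (is_RInt_unique (V := R_CompleteNormedModule)).
      apply (is_RInt_ext (V := R_NormedModule)
        (fun x => minus (g x * gauss_density x) (phi x * gauss_density x))).
      - intros z _. unfold minus, plus, opp, d; simpl. ring.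
      - apply (is_RInt_minus (V := R_NormedModule)); apply (RInt_correct (V := R_CompleteNormedModule));
          apply ex_RInt_of_continuous; now apply gauss_prod_continuous. }
    rewrite E in H3. set (I1 := RInt (fun x => g x * _) _ _) in *.
    set (I2 := RInt (fun x => phi x * _) _ _) in *. set (I3 := RInt (fun x => d x * _) _ _) in *.
    assert (H3' : Rabs (I1 - I2 - I3) <= 2 * e).
    { eapply Rle_trans; [exact H3|]. rewrite <- E4. apply Rmult_le_compat_l; lra. }
    assert (H4' : Rabs I3 <= 3 * e) by nra.
    replace (l - m) with (- (I1 - l) + ((I2 - m) + ((I1 - I2 - I3) + I3))) by ring.
    eapply Rle_trans; [apply Rabs_triang|]. rewrite Rabs_Ropp.
    eapply Rle_trans; [apply Rplus_le_compat_l, Rabs_triang|].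
    eapply Rle_trans; [apply Rplus_le_compat_l, Rplus_le_compat_l, Rabs_triang|]. lra. }
  apply is_lim_seq_spec in Lm. destruct (Lm (mkposreal _ He)) as [N HN]. simpl in HN.
  exists (Nat.max N k0). intros k Hk. specialize (HN k ltac:(lia)). specialize (HV k ltac:(lia)).
  assert (HEdiff : Rabs (unif_expect q k (fun n => g (Z k n)) - unif_expect q k (fun n => phi (Z k n))) <= 2 * e).
  { rewrite <- unif_expect_minus. eapply Rle_trans; [apply (unif_expect_abs q hq)|].
    (* Outside [-A, A] the bound 2 M is at most 2 M z^2 / A^2, whose mean the second moment
       controls. *)
    apply Rle_trans with (unif_expect q k (fun n => e + 2 * M / A ^ 2 * Z k n ^ 2)).
    - apply (unif_expect_le q hq). intros i. set (z := Z k i).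
      assert (HA2p : 0 < A ^ 2) by now apply pow_lt.
      assert (Hc : 0 < 2 * M / A ^ 2) by (apply Rdiv_lt_0_compat; lra).
      pose proof (pow2_ge_0 z). 
      destruct (Rle_or_lt (Rabs z) A) as [Hz|Hz].
      + specialize (Hnear z Hz). nra.
      + specialize (Hdiff z). assert (A ^ 2 <= z ^ 2).
        { rewrite <- (pow2_abs z). apply pow_incr. lra. }
        replace (2 * M) with (2 * M / A ^ 2 * A ^ 2) in Hdiff by (field; lra). nra.
    - rewrite unif_expect_plus, (unif_expect_const q hq), unif_expect_scal.
      assert (HA2p : 0 < A ^ 2) by now apply pow_lt.
      cut (2 * M / A ^ 2 * unif_expect q k (fun n => Z k n ^ 2) <= e); [lra|].
      apply (Rmult_le_reg_r (A ^ 2)); [exact HA2p|].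
      replace (2 * M / A ^ 2 * unif_expect q k (fun n => Z k n ^ 2) * A ^ 2)
        with (2 * M * unif_expect q k (fun n => Z k n ^ 2)) by (field; lra).
      apply Rle_trans with (2 * M * W).
      + apply Rmult_le_compat_l; [lra|]. pose proof (Rle_abs V). unfold W. lra.
      + destruct HA2 as [Ha Hb]. eapply Rle_trans; [exact Hb|].
        apply Rmult_le_compat_l; [lra|]. apply pow_incr. unfold A. lra. }
  replace (unif_expect q k (fun n => g (Z k n)) - l) with
    ((unif_expect q k (fun n => g (Z k n)) - unif_expect q k (fun n => phi (Z k n)))
     + ((unif_expect q k (fun n => phi (Z k n)) - m) + - (l - m))) by ring.
  eapply Rle_lt_trans; [apply Rabs_triang|].
  eapply Rle_lt_trans; [apply Rplus_le_compat_l, Rabs_triang|]. rewrite Rabs_Ropp.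
  unfold e in *. lra.
Qed.

End WeakConvergence.

(** * The theorem *)

Lemma is_lim_inv_sqrt_INR : is_lim_seq (fun k => / sqrt (INR k)) 0.
Proof.
  apply is_lim_seq_spec. intros eps. pose proof (cond_pos eps) as He.
  destruct (INR_unbounded ((/ eps) ^ 2)) as [N HN]. exists N. intros k Hk. apply le_INR in Hk.
  assert (Hie : 0 < / eps) by now apply Rinv_0_lt_compat.
  assert (H : / eps < sqrt (INR k)).
  { rewrite <- (sqrt_pow2 (/ eps)) by lra. apply sqrt_lt_1; [apply pow2_ge_0|apply pos_INR|lra]. }
  rewrite Rminus_0_r, Rabs_pos_eq by (left; apply Rinv_0_lt_compat; lra).
  rewrite <- (Rinv_inv eps). apply Rinv_lt_contravar; [|exact H].
  apply Rmult_lt_0_compat; lra.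
Qed.

Section NormalizedSum.
Context (q r : nat) (f : nat -> R) (hq : (2 <= q)%nat) (hr : (1 <= r)%nat)
  (hpos : forall n, 0 < f n) (hqm : quasimultiplicative q r f)
  (K : R) (HK : 0 < K) (HF : forall n, Rabs (ln (f n)) <= K * INR (span q r n)).
Notation mu := (mu_const q r f).
Notation sigma2 := (sigma2_const q r f).

Definition normalized (k n : nat) : R :=
  (ln (f n) - mu * INR k) / (sqrt sigma2 * sqrt (INR k)).

(** With th = t / (sigma sqrt k) the bound C |th| + C k |th|^3 is of order 1 / sqrt k, and the
    Gaussian factor is exactly exp(-t^2 / 2). *)
Lemma normalized_cos_limit (t c : R) : 0 < sigma2 ->
  is_lim_seq (fun k => unif_expect q k (fun n => cos (c + t * normalized k n)))
    (exp (- t ^ 2 / 2) * cos c).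
Proof.
  intros Hsig.
  destruct (char_function_bound q r f hq hr hpos hqm K HK HF Hsig) as [C [th0 [HC [Hth0 HB]]]].
  set (s := sqrt sigma2). assert (Hs : 0 < s) by now apply sqrt_lt_R0.
  assert (Es : s * s = sigma2) by (apply sqrt_sqrt; lra).
  set (a := Rabs t / s).
  assert (Ha : 0 <= a).
  { apply Rmult_le_pos; [apply Rabs_pos|left; now apply Rinv_0_lt_compat]. }
  set (B := C * a + C * a ^ 3).
  set (u := fun k => unif_expect q k (fun n => cos (c + t * normalized k n))).
  assert (Hlim : is_lim_seq (fun k => B * / sqrt (INR k)) 0).
  { replace (Finite 0) with (Finite (B * 0)) by (f_equal; ring).
    apply is_lim_seq_mult'; [apply is_lim_seq_const|apply is_lim_inv_sqrt_INR]. }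
  assert (Hsmall : is_lim_seq (fun k => a * / sqrt (INR k)) 0).
  { replace (Finite 0) with (Finite (a * 0)) by (f_equal; ring).
    apply is_lim_seq_mult'; [apply is_lim_seq_const|apply is_lim_inv_sqrt_INR]. }
  apply is_lim_seq_ext with (fun k => (u k - exp (- t ^ 2 / 2) * cos c) + exp (- t ^ 2 / 2) * cos c).
  { intros k. unfold u. ring. }
  set (l := exp (- t ^ 2 / 2) * cos c) in *.
  replace (Finite l) with (Finite (0 + l)) by (f_equal; ring).
  apply is_lim_seq_plus'; [|apply is_lim_seq_const].
  apply is_lim_seq_abs_0.
  apply is_lim_seq_le_le_loc with (fun _ => 0) (fun k => B * / sqrt (INR k));
    [|apply is_lim_seq_const|exact Hlim].
  apply is_lim_seq_spec in Hsmall. destruct (Hsmall (mkposreal _ Hth0)) as [N HN]. simpl in HN.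
  exists (Nat.max 1 N). intros k Hk. split; [apply Rabs_pos|].
  assert (Hk0 : 0 < INR k) by (apply lt_0_INR; lia).
  assert (Hsk : 0 < sqrt (INR k)) by now apply sqrt_lt_R0.
  assert (Esk : sqrt (INR k) * sqrt (INR k) = INR k) by (apply sqrt_sqrt; lra).
  set (w := sqrt (INR k)) in *. set (th := t / (s * w)).
  assert (Eth : Rabs th = a * / w).
  { unfold th, a, Rdiv. rewrite Rabs_mult, Rabs_inv, (Rabs_pos_eq (s * w)) by (left; now apply Rmult_lt_0_compat).
    field. lra. }
  specialize (HN k ltac:(lia)). rewrite Rminus_0_r in HN. fold w in HN.
  rewrite <- Eth, Rabs_Rabsolu in HN.
  specialize (HB th c k ltac:(lra)).
  replace (- (sigma2 * th ^ 2 / 2) * INR k) with (- t ^ 2 / 2) in HB.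
  2:{ rewrite <- Es, <- Esk. unfold th. field. lra. }
  unfold u. rewrite (unif_expect_ext q k _ (fun n => cos (c + th * (ln (f n) - mu * INR k)))).
  2:{ intros n _. unfold normalized, th. fold s. fold w. f_equal. field. lra. }
  eapply Rle_trans; [exact HB|]. rewrite Eth, <- Esk. right. unfold B. field. lra.
Qed.

(** Supplies the tightness used to truncate to [-A, A]. *)
Lemma normalized_second_moment : 0 < sigma2 -> exists V, forall k, (1 <= k)%nat ->
  unif_expect q k (fun n => normalized k n ^ 2) <= V.
Proof.
  intros Hsig. destruct (spread_bounded q r f hq hr hpos hqm K HK HF) as [D [HD HDk]].
  exists (1 + D / sigma2). intros k Hk.
  assert (Hk1 : 1 <= INR k) by (change 1 with (INR 1); now apply le_INR).
  rewrite (unif_expect_ext q k _ (fun n => / (sigma2 * INR k) * (ln (f n) - mu * INR k) ^ 2)).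
  - rewrite unif_expect_scal. change (/ (sigma2 * INR k) * spread q r f k <= 1 + D / sigma2).
    specialize (HDk k). apply Rabs_le_between in HDk.
    apply (Rmult_le_reg_l (sigma2 * INR k)); [apply Rmult_lt_0_compat; lra|].
    rewrite <- Rmult_assoc, Rinv_r, Rmult_1_l.
    + replace (sigma2 * INR k * (1 + D / sigma2)) with (sigma2 * INR k + D * INR k) by (field; lra). nra.
    + apply Rmult_integral_contrapositive. lra.
  - intros n _. unfold normalized.
    assert (E1 : sqrt sigma2 ^ 2 = sigma2) by (rewrite <- Rsqr_pow2; apply Rsqr_sqrt; lra).
    assert (E2 : sqrt (INR k) ^ 2 = INR k) by (rewrite <- Rsqr_pow2; apply Rsqr_sqrt; lra).
    unfold Rdiv. rewrite Rpow_mult_distr, pow_inv, Rpow_mult_distr, E1, E2. ring.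
Qed.

End NormalizedSum.

Theorem theorem14 (q r : nat) (f : nat -> R)
  (hq : (2 <= q)%nat) (hr : (1 <= r)%nat)
  (hpos : forall n, 0 < f n)
  (hqm : quasimultiplicative q r f)
  (hgrowth : poly_growth f) :
  let mu := mu_const q r f in
  let sigma2 := sigma2_const q r f in
  (exists C : R, exists K : nat, forall k : nat, (K <= k)%nat ->
     Rabs (Lmean q f k - mu * INR k) <= C) /\
  (exists C : R, exists K : nat, forall k : nat, (K <= k)%nat ->
     Rabs (Lvar q f k - sigma2 * INR k) <= C) /\
  ((exists n : nat, f n <> 1) ->
     sigma2 <> 0 /\
     weak_conv_std_gauss q
       (fun k n => (ln (f n) - mu * INR k) / (sqrt sigma2 * sqrt (INR k)))).
Proof.
  intros mu sigma2.
  destruct (ln_f_growth q r f hq hr hpos hgrowth) as [K [HK HF]].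
  destruct (drift_bounded q r f hq hr hpos hqm K HK HF) as [D1 [HD1 H1]].
  destruct (spread_bounded q r f hq hr hpos hqm K HK HF) as [D2 [HD2 H2]].
  split; [|split].
  - exists D1, 0%nat. intros k _. unfold mu. rewrite <- drift_Lmean by exact hq. apply H1.
  - exists (D2 + D1 ^ 2), 0%nat. intros k _. rewrite (Lvar_spread q r f hq).
    replace (spread q r f k - drift q r f k ^ 2 - sigma2 * INR k)
      with ((spread q r f k - sigma2 * INR k) + - drift q r f k ^ 2) by ring.
    eapply Rle_trans; [apply Rabs_triang|]. apply Rplus_le_compat; [apply H2|].
    rewrite Rabs_Ropp, <- RPow_abs. apply pow_incr. split; [apply Rabs_pos|apply H1].
  - intros [n Hn].
    assert (Hsig : sigma2 <> 0).
    { intros H0. apply Hn. exact (sigma2_zero_trivial q r f hq hr hpos hqm K HK HF H0 n). }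
    split; [exact Hsig|].
    pose proof (sigma2_nonneg q r f hq hr hpos hqm K HK HF) as Hnn. fold sigma2 in Hnn.
    assert (Hpos : 0 < sigma2) by lra.
    destruct (normalized_second_moment q r f hq hr hpos hqm K HK HF Hpos) as [V HV].
    apply (weak_convergence_of_cos q hq (normalized q r f)) with (V := V) (k0 := 1%nat).
    + intros t c. now apply (normalized_cos_limit q r f hq hr hpos hqm K HK HF).
    + exact HV.
Qed.
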